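(* Let $X_1,X_2,\ldots$ be i.i.d. with distribution $P_{\theta_0}$, $\theta_0\in\Theta$ (the null hypothesis $H_0$ of no change). Suppose that $E_{\theta_0}[\|\psi(X)\|^2]<\infty$, that $V(\theta_0)$ is invertible, and that $\Sigma(\theta_0)$ is invertible. Let $\{B(u)\}_{u\in[0,1]}$ be a standard Brownian motion in $\mathbb{R}^d$. Then, as $n\to\infty$, $$\sup_{u\in[0,1]}\left| n\,\mathbb{Z}_n(u,\widehat\theta_n)^\top\,\widehat\Sigma_n^{-1}\,\mathbb{Z}_n(u,\widehat\theta_n)\right| \to^{d} \sup_{u\in[0,1]}\|B(u)-uB(1)\|^2 ,$$ where $\to^d$ denotes convergence in distribution.
   Context: Let $\Theta\subset\mathbb{R}^d$ be bounded, open and convex, and let $\{P_\theta:\theta\in\Theta\}$ be a family of probability distributions on a measurable space $(\mathcal{X},\mathcal{A})$ with densities $f(\cdot;\theta)$ with respect to a measure $\mu$. Let $\psi:\mathcal{X}\to\mathbb{R}^d$ be measurable. With $X\sim P_\theta$ under $E_\theta$, put $e(\theta)=E_\theta[\psi(X)]\in\mathbb{R}^d$ (assumed to exist and to be differentiable on $\Theta$), $\Sigma(\theta)=E_\theta[(\psi(X)-e(\theta))(\psi(X)-e(\theta))^\top]$, and $V(\theta)=\dot e(\theta)=[\partial e^{(i)}(\theta)/\partial\theta_j]_{i,j=1}^d$. For $u\in[0,1]$ and $\theta\in\Theta$, $$\mathbb{Z}_n(u,\theta)=\frac1n\sum_{k=1}^{[un]}(\psi(X_k)-e(\theta)),$$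 where $[\cdot]$ is the integer part. The method of moments estimator $\widehat\theta_n$ is a $\Theta$-valued random vector solving $\mathbb{Z}_n(1,\widehat\theta_n)=0$, i.e. $e(\widehat\theta_n)=\frac1n\sum_{k=1}^n\psi(X_k)$; it is assumed that such a solution exists almost surely for all sufficiently large $n$. Also $$\widehat\Sigma_n=\frac1n\sum_{k=1}^n(\psi(X_k)-e(\widehat\theta_n))(\psi(X_k)-e(\widehat\theta_n))^\top .$$ On the event that $\widehat\Sigma_n$ is singular, $\widehat\Sigma_n^{-1}$ is given an arbitrary value (e.g. the zero matrix). $\|\cdot\|$ is the Euclidean norm. *)

(* Defs.v *)
From HB Require Import structures.
From mathcomp Require Export all_boot all_order all_algebra finmap.
From mathcomp Require Export all_classical all_reals all_analysis.
Set Implicit Arguments.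
Unset Strict Implicit.
Unset Printing Implicit Defensive.
Export Order.TTheory GRing.Theory Num.Theory.
Export numFieldNormedType.Exports.

Local Open Scope classical_set_scope.
Local Open Scope ring_scope.

(* Vectors of R^d are row vectors 'rV[R]_d, so that the x x^T of a column vector
   x is written x^T *m x, and x^T A y is written x *m A *m y^T. *)

Definition borel (T : ptopologicalType) := g_sigma_algebraType (@open T).

Definition borel_measurable (dO : measure_display) (O : measurableType dO)
    (T : ptopologicalType) (f : O -> T) : Prop :=
  measurable_fun [set: O] (f : O -> borel T).

(* The norm of the library on 'rV[R]_d is the sup norm. *)
Definition enorm (R : realType) (d : nat) (x : 'rV[R]_d) : R :=
  Num.sqrt (\sum_(i < d) x 0 i ^+ 2).

Definition mexpectation (dO : measure_display) (O : measurableType dO)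
    (R : realType) (P : probability O R) (m n : nat) (M : O -> 'M[R]_(m, n)) :
    'M[R]_(m, n) :=
  \matrix_(i, j) fine 'E_P[fun w => M w i j].

Definition mintegrable (dO : measure_display) (O : measurableType dO)
    (R : realType) (P : probability O R) (m n : nat) (M : O -> 'M[R]_(m, n)) :
    Prop :=
  forall i j, P.-integrable [set: O] (EFin \o (fun w => M w i j)).

Definition is_density (dX : measure_display) (X : measurableType dX)
    (R : realType) (mu : {measure set X -> \bar R}) (P : probability X R)
    (f : X -> R) : Prop :=
  [/\ measurable_fun [set: X] f,
      forall x, 0 <= f x
    & forall A, measurable A -> P A = (\int[mu]_(x in A) (f x)%:E)%E].

Definition mutually_independent (dO : measure_display) (O : measurableType dO)
    (R : realType) (P : probability O R) (I : choiceType)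
    (dT : measure_display) (T : measurableType dT) (X : I -> O -> T) : Prop :=
  forall (J : {fset I}) (A : I -> set T),
    (forall i, i \in J -> measurable (A i)) ->
    P (\bigcap_(i in [set` J]) (X i @^-1` A i)) =
      (\prod_(i <- J) P (X i @^-1` A i))%E.

Definition iid (dO : measure_display) (O : measurableType dO)
    (R : realType) (P : probability O R)
    (dX : measure_display) (X : measurableType dX) (Q : probability X R)
    (xi : nat -> {RV P >-> X}) : Prop :=
  (forall k A, measurable A -> distribution P (xi k) A = Q A) /\
  mutually_independent P (fun k => xi k : O -> X).

(* Y has distribution N(0, v I_d); [normal_prob m s] takes the standard
   deviation s, and is a normal distribution only for s != 0. *)
Definition centered_isotropic_gaussian (dO : measure_display)
    (O : measurableType dO) (R : realType) (P : probability O R) (d : nat)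
    (v : R) (Y : O -> 'rV[R]_d) : Prop :=
  forall A : 'I_d -> set (measurableTypeR R), (forall i, measurable (A i)) ->
    P [set w | forall i, A i (Y w 0 i)] =
      (\prod_(i < d) normal_prob 0 (Num.sqrt v) (A i))%E.

Definition standard_brownian_motion (dO : measure_display)
    (O : measurableType dO) (R : realType) (P : probability O R) (d : nat)
    (B : R -> O -> 'rV[R]_d) : Prop :=
  [/\ forall u, 0 <= u <= 1 -> borel_measurable (B u),
      {ae P, forall w, B 0 w = 0},
      forall w, {within `[0, 1], continuous (fun u => B u w)},
      forall (m : nat) (t : nat -> R),
        0 <= t 0%N -> {homo t : i j / (i <= j)%N >-> i <= j} -> t m <= 1 ->
        mutually_independent P
          (fun (k : 'I_m) w => (B (t k.+1) w - B (t k) w : borel 'rV[R]_d))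
    & forall s t, 0 <= s -> s < t -> t <= 1 ->
        centered_isotropic_gaussian P (t - s) (fun w => B t w - B s w)].

Definition cvg_in_distribution (R : realType)
    (dO : measure_display) (O : measurableType dO) (P : probability O R)
    (dO' : measure_display) (O' : measurableType dO') (P' : probability O' R)
    (X : nat -> O -> R) (Y : O' -> R) : Prop :=
  [/\ forall n, measurable_fun [set: O] (X n),
      measurable_fun [set: O'] Y
    & forall f : R -> R, continuous f -> bounded_fun f ->
        (fun n => 'E_P[f \o X n])%E @ \oo --> ('E_P'[f \o Y])%E].

Section model.
Context (R : realType) (d : nat) (dX : measure_display) (X : measurableType dX).
Variables (P : 'rV[R]_d -> probability X R) (psi : X -> 'rV[R]_d).

Definition mean_psi (theta : 'rV[R]_d) : 'rV[R]_d :=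
  mexpectation (P theta) psi.

Definition cov_psi (theta : 'rV[R]_d) : 'M[R]_d :=
  mexpectation (P theta)
    (fun x => (psi x - mean_psi theta)^T *m (psi x - mean_psi theta)).

(* The library's [jacobian] acts on row vectors: its (i, j) entry is the partial
   derivative of the j-th component with respect to the i-th variable. *)
Definition deriv_mean (theta : 'rV[R]_d) : 'M[R]_d :=
  (jacobian mean_psi theta)^T.

(* A sample x_1, x_2, ... is indexed from 0: x k is x_(k+1). *)
Definition Zn (x : nat -> X) (n : nat) (u : R) (theta : 'rV[R]_d) : 'rV[R]_d :=
  n%:R^-1 *: \sum_(k < Num.truncn (u * n%:R)) (psi (x k) - mean_psi theta).

Definition Sigma_hat (x : nat -> X) (n : nat) (theta_hat : 'rV[R]_d) :
    'M[R]_d :=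
  n%:R^-1 *: \sum_(k < n)
    (psi (x k) - mean_psi theta_hat)^T *m (psi (x k) - mean_psi theta_hat).

End model.

Definition inv_or (R : realType) (d : nat) (D A : 'M[R]_d) : 'M[R]_d :=
  if A \in unitmx then invmx A else D.

Definition test_statistic (R : realType) (d : nat) (dX : measure_display)
    (X : measurableType dX) (P : 'rV[R]_d -> probability X R)
    (psi : X -> 'rV[R]_d) (x : nat -> X) (n : nat) (theta_hat : 'rV[R]_d)
    (D : 'M[R]_d) : R :=
  sup [set `|n%:R * (Zn P psi x n u theta_hat
                       *m inv_or D (Sigma_hat P psi x n theta_hat)
                       *m (Zn P psi x n u theta_hat)^T) 0 0|
      | u in `[0, 1]].

(* Main.v *)
(** Let W be the partial sums of the whitened variables
    (psi(X_k) - e(theta_0)) A, where A^T Sigma(theta_0) A = 1.  Wherever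
    theta_hat solves the moment equation, the statistic is the maximum over
    k <= n of b_k N^-1 b_k^T, with b_k = (W_k - (k/n) W_n) / sqrt n and
    N = A^T Sigma_hat A.  The weak law of large numbers gives N -> 1 in
    probability, so only max_k |b_k|^2 matters, and its distribution function is
    squeezed between those of sup_u |B(u) - u B(1)|^2 without any weak
    convergence in a function space.  On a fixed grid j/m, Lindeberg's
    replacement compares the values of b with those of the Brownian bridge: the
    summands are exchanged one at a time for increments of B, and the test
    functions are products of smooth cut-offs of the squared norms.  Between the
    grid points, Ottaviani's inequality reduces the oscillation of b to the tails
    of the block sums, hence to the tails of the increments of B over the grid;
    the sum of the latter tends to 0 with the mesh because the increments are
    independent while their maximum tends to 0 by uniform continuity of the
    paths. *)

Require Import Defs.
From HB Require Import structures.
From mathcomp Require Import perm ring lra zify measurable_realfun.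

Set Implicit Arguments.
Unset Strict Implicit.
Unset Printing Implicit Defensive.

Local Open Scope classical_set_scope.
Local Open Scope ring_scope.

(** * Independence and expectations *)

(** Chebyshev's inequality cannot control the path between grid points: [m] blocks with variances of
    order [1 / m] leave a total of order 1, whatever the mesh. Hence the comparison of block sums
    with Brownian increments, whose tails do sum to little. Ottaviani's inequality itself asks only
    for tails at most 1/2, and there second moments suffice. The replacement serves three times:
    against Gaussian increments with two matching moments, for the grid; against 0 with second
    moments, for the hypothesis of Ottaviani's inequality; against 0 with first moments, for the
    weak law. Since partial sums are unbounded, the test functions must have Taylor expansions with
    the same constant at every base point. They are built from cubes of positive parts and from
    [1 / (1 + q)], so that all expansions follow from algebraic identities. Distribution functions
    are compared at two distinct levels [a < b]; the gap pays for the cut-offs, for the mesh and for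
    the random normalization. The bridge appears without error term because the moment equation
    turns the residuals into deviations from the sample mean. *)

Lemma bounded_integrable (dO : measure_display) (O : measurableType dO)
    (R : realType) (P : probability O R) (f : O -> R) (M : R) :
  measurable_fun [set: O] f -> (forall w, `|f w| <= M) ->
  P.-integrable [set: O] (EFin \o f).
Proof.
move=> mf fM; apply: measurable_bounded_integrable => //.
  exact: le_lt_trans (probability_le1 P measurableT) (ltry _).
by exists M; split => [|x Mx w _ /=]; rewrite ?num_real// (le_trans (fM w))// ltW.
Qed.

Lemma integrable_eq_measure (d : measure_display) (T : measurableType d)
    (R : realType) (m1 m2 : {measure set T -> \bar R}) (f : T -> \bar R) :
  (forall A, measurable A -> m1 A = m2 A) ->
  m1.-integrable [set: T] f -> m2.-integrable [set: T] f.
Proof.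
move=> m12 /integrableP[mf fi]; apply/integrableP; split => //.
by rewrite (eq_measure_integral m1)// => A mA _; rewrite m12.
Qed.

(** No integrability is assumed: both sides are split into positive and negative parts, and the
    nonnegative change of variables applies to each. *)
Lemma integral_pushforwardE (d1 d2 : measure_display) (T1 : measurableType d1)
    (T2 : measurableType d2) (R : realType) (m : {measure set T1 -> \bar R})
    (u : T1 -> T2) (f : T2 -> \bar R) :
  measurable_fun [set: T1] u -> measurable_fun [set: T2] f ->
  (\int[pushforward m u]_y f y = \int[m]_x f (u x))%E.
Proof.
move=> mu mf; rewrite [LHS]integralE [RHS]integralE; congr (_ - _)%E.
  rewrite (ge0_integral_pushforward mu)//=.
  by rewrite preimage_setT (_ : (fun x => f (u x)) = f \o u)//
      (funepos_comp f u).
  exact: measurable_funepos.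
rewrite (ge0_integral_pushforward mu)//=.
  by rewrite preimage_setT (_ : (fun x => f (u x)) = f \o u)//
      (funeneg_comp f u).
exact: measurable_funeneg.
Qed.

Definition independent_maps (dO d1 d2 : measure_display) (O : measurableType dO)
    (T1 : measurableType d1) (T2 : measurableType d2) (R : realType)
    (P : probability O R) (U : O -> T1) (Y : O -> T2) : Prop :=
  forall A B, measurable A -> measurable B ->
    P (U @^-1` A `&` Y @^-1` B) = (P (U @^-1` A) * P (Y @^-1` B))%E.

(** The law of [(U, Y)] agrees with the product of the marginal laws on rectangles, hence
    everywhere, and Fubini's theorem for the product is read back on [O]. The inner variable [w']
    acts as an independent copy. *)
Lemma independent_maps_Fubini (dO d1 d2 : measure_display)
    (O : measurableType dO) (T1 : measurableType d1) (T2 : measurableType d2)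
    (R : realType) (P : probability O R) (U : O -> T1) (Y : O -> T2)
    (h : T1 * T2 -> R) :
  measurable_fun [set: O] U -> measurable_fun [set: O] Y ->
  independent_maps P U Y -> measurable_fun [set: T1 * T2] h ->
  P.-integrable [set: O] (EFin \o (fun w => h (U w, Y w))) ->
  (\int[P]_w (h (U w, Y w))%:E = \int[P]_w \int[P]_w' (h (U w, Y w'))%:E)%E.
Proof.
move=> mU mY indep mh hi.
have mUY : measurable_fun [set: O] (fun w => (U w, Y w)).
  exact: measurable_fun_pair.
pose U' : {mfun O >-> T1} := HB.pack U (isMeasurableFun.Build _ _ _ _ _ mU).
pose Y' : {mfun O >-> T2} := HB.pack Y (isMeasurableFun.Build _ _ _ _ _ mY).
pose UY : {mfun O >-> (T1 * T2)%type} :=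
  HB.pack (fun w => (U w, Y w)) (isMeasurableFun.Build _ _ _ _ _ mUY).
have prodE A : measurable A ->
    (distribution P U' \x distribution P Y')%E A = distribution P UY A.
  by apply: product_measure_unique => A1 A2 mA1 mA2; exact: indep.
have mEh : measurable_fun setT (EFin \o h) by exact/measurable_EFinP.
have hi' : (distribution P UY).-integrable [set: T1 * T2] (EFin \o h).
  by apply: integrable_pushforward.
have hi2 : (distribution P U' \x distribution P Y')%E.-integrable
    [set: T1 * T2] (EFin \o h).
  by apply: integrable_eq_measure hi' => A mA; exact/esym/prodE.
transitivity (\int[distribution P UY]_z (h z)%:E)%E.
  by rewrite integral_pushforward.
transitivity (\int[distribution P U' \x distribution P Y']_z (h z)%:E)%E.
  by apply: eq_measure_integral => A mA _; exact/esym/prodE.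
rewrite -integral12_prod_meas1// integral_pushforwardE//=; last first.
  exact: measurable_fubini_F hi2.
apply: eq_integral => w _; rewrite /fubini_F/= integral_pushforwardE//.
apply: (measurableT_comp mEh); exact: pair1_measurable.
Qed.

(** A pi-system generating the sigma-algebra of the subfamily indexed by [J]. *)
Definition cylinders (I : choiceType) (O : Type) (dT : measure_display)
    (T : measurableType dT) (X : I -> O -> T) (J : {fset I}) : set (set O) :=
  [set C | exists2 A : I -> set T, (forall i, measurable (A i)) &
     C = \bigcap_(i in [set` J]) (X i @^-1` A i)].

Section independent_families.
Context (I : choiceType) (dO dT : measure_display) (O : measurableType dO)
  (T : measurableType dT) (R : realType) (P : probability O R).
Variable X : I -> O -> T.
Hypothesis mX : forall i, measurable_fun [set: O] (X i).

Lemma cylinders_measurable (J : {fset I}) : cylinders X J `<=` measurable.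
Proof.
move=> _ [A mA ->]; apply: fin_bigcap_measurable => // i _.
by rewrite -[_ @^-1` _]setTI; exact: mX.
Qed.

Lemma cylinders_setI (J : {fset I}) : setI_closed (cylinders X J).
Proof.
move=> _ _ [A mA ->] [B mB ->]; exists (fun i => A i `&` B i).
  by move=> i; exact: measurableI.
by rewrite -bigcapI.
Qed.

Lemma cylinders_setT (J : {fset I}) : cylinders X J setT.
Proof.
by exists (fun=> setT) => //; apply/seteqP; split.
Qed.

Lemma measurable_cylinders (J : {fset I}) (i : I) : i \in J ->
  measurable_fun [set: g_sigma_algebraType (cylinders X J)] (X i).
Proof.
move=> iJ _ A mA; rewrite setTI; apply: sub_sigma_algebra.
exists (fun j => if j == i then A else setT) => [j|]; first by case: ifP.
apply/seteqP; split => [w XA j _ /=|w /(_ i iJ)]; last by rewrite eqxx.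
by case: eqP => // ->.
Qed.

Lemma sub_sigma_cylinders (J : {fset I}) : <<s cylinders X J >> `<=` measurable.
Proof.
apply: smallest_sub; last exact: cylinders_measurable.
exact: sigma_algebra_measurable.
Qed.

(** As functions of [A], both sides are finite measures, [P] restricted to [B] and [P] scaled by
    [P B]. Finite measures that agree on a pi-system containing the whole space agree on the
    sigma-algebra it generates. *)
Lemma independent_pi_lambda (G : set (set O)) (B : set O) :
  G `<=` measurable -> setI_closed G -> G setT -> measurable B ->
  (forall A, G A -> P (A `&` B) = (P A * P B)%E) ->
  forall A, <<s G >> A -> P (A `&` B) = (P A * P B)%E.
Proof.
move=> Gm GI GT mB GE A GA.
have PB0 : 0 <= fine (P B) by rewrite fine_ge0.
pose m2 : {measure set O -> \bar R} := mscale (NngNum PB0) P.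
have m2E C : m2 C = (P C * P B)%E.
  rewrite -[LHS]/((fine (P B))%:E * P C)%E fineK ?fin_num_measure//.
  by rewrite muleC.
rewrite -m2E -[LHS]/(mrestr P mB A).
apply: (@g_sigma_algebra_measure_unique _ _ _ G Gm (fun=> setT) _ _
  (mrestr P mB) m2) => //=.
- by rewrite bigcup_const.
- by move=> C GC; rewrite -[LHS]/(P (C `&` B)) GE// -m2E.
- by move=> _; rewrite /mrestr setTI (le_lt_trans (probability_le1 P mB))// ltry.
Qed.

Hypothesis indepX : mutually_independent P X.

(** The pi-lambda argument is applied twice: it reduces first [A] and then [B] to a cylinder. Two
    cylinders over disjoint index sets form one cylinder over the union, to which mutual
    independence applies. *)
Lemma independent_sigma_cylinders (J K : {fset I}) (A B : set O) :
  [disjoint J & K]%fset -> <<s cylinders X J >> A -> <<s cylinders X K >> B ->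
  P (A `&` B) = (P A * P B)%E.
Proof.
move=> dJK sA sB.
apply: (independent_pi_lambda _ _ _ _ _ sA) => //.
- exact: cylinders_measurable.
- exact: cylinders_setI.
- exact: cylinders_setT.
- exact: sub_sigma_cylinders sB.
move=> {sA}{}A cA; rewrite setIC muleC.
apply: (independent_pi_lambda _ _ _ _ _ sB) => //.
- exact: cylinders_measurable.
- exact: cylinders_setI.
- exact: cylinders_setT.
- exact: cylinders_measurable cA.
move=> {sB}{}B cB; case: cA cB => C mC -> [D mD ->].
rewrite (indepX (J := J))// (indepX (J := K))//.
(* Glues the two families of sets; by disjointness it coincides with [D] on [K]. *)
pose E i := if i \in J then C i else D i.
have -> : \bigcap_(i in [set` K]) (X i @^-1` D i) `&`
          \bigcap_(i in [set` J]) (X i @^-1` C i) =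
          \bigcap_(i in [set` (J `|` K)%fset]) (X i @^-1` E i).
  apply/seteqP; split => [w [wD wC] i /=|w wE].
    rewrite /E inE; case: ifPn => [iJ _|iJ /= iK]; first exact: wC.
    exact: wD.
  split=> i /= iH.
    have := wE i; rewrite /E /= inE iH orbT => /(_ isT).
    by case: ifPn => // iJ; move/fdisjointP : dJK => /(_ _ iJ); rewrite iH.
  by have := wE i; rewrite /E /= inE iH => /(_ isT).
rewrite indepX => [|i _]; last by rewrite /E; case: ifP.
rewrite (perm_big (J ++ K)).
  rewrite big_cat/= muleC; congr (_ * _)%E; apply: eq_big_seq => i iH.
    rewrite /E; case: ifPn => // iJ.
    by move/fdisjointP : dJK => /(_ _ iJ); rewrite iH.
  by rewrite /E iH.
rewrite uniq_perm ?fset_uniq// => [|i]; last by rewrite mem_cat inE.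
rewrite cat_uniq !fset_uniq/= andbT; apply/hasPn => i iK.
by apply/negP => iJ; move/fdisjointP : dJK => /(_ _ iJ); rewrite iK.
Qed.
End independent_families.

Section expectation.
Context (dO : measure_display) (O : measurableType dO) (R : realType)
  (P : probability O R).
Implicit Types (f g : O -> R).

Lemma Rintegral_cstT (r : R) : \int[P]_w r = r.
Proof. by rewrite Rintegral_cst//= probability_setT mulr1. Qed.

Lemma Rintegral_indicator (A : set O) : measurable A ->
  \int[P]_w (\1_A w) = fine (P A).
Proof. by move=> mA; rewrite /Rintegral integral_indic// setIT. Qed.

Lemma normr_Rintegral_le f (M : R) : measurable_fun [set: O] f ->
  (forall w, `|f w| <= M) -> `|\int[P]_w f w| <= M.
Proof.
move=> mf fM; apply: (le_trans (le_normr_Rintegral _ _)) => //.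
  exact: bounded_integrable fM.
rewrite -[leRHS]Rintegral_cstT; apply: le_Rintegral => //.
- by apply: (@integrable_norm _ _ _ P setT f); exact: bounded_integrable fM.
- by apply: (@bounded_integrable _ _ _ _ _ `|M|).
Qed.

Lemma fine_probability_le (A B : set O) : measurable A -> measurable B ->
  A `<=` B -> fine (P A) <= fine (P B).
Proof.
move=> mA mB AB; apply: fine_le; rewrite ?fin_num_measure//.
by apply: le_measure => //; rewrite inE.
Qed.

Lemma fine_probabilityU_le (A B : set O) : measurable A -> measurable B ->
  fine (P (A `|` B)) <= fine (P A) + fine (P B).
Proof.
move=> mA mB; rewrite -fineD ?fin_num_measure//; apply: fine_le.
- by rewrite fin_num_measure//; exact: measurableU.
- by rewrite fin_numD !fin_num_measure.
- exact: measureU2.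
Qed.

Lemma fine_probabilityC (A : set O) : measurable A ->
  fine (P (~` A)) = 1 - fine (P A).
Proof. by move=> mA; rewrite probability_setC// fineB// fin_num_measure. Qed.

Lemma fine_probability_bigU_le (I : Type) (s : seq I) (F : I -> set O) :
  (forall i, measurable (F i)) ->
  fine (P (\big[setU/set0]_(i <- s) F i)) <= \sum_(i <- s) fine (P (F i)).
Proof.
move=> mF; elim: s => [|i s IH]; first by rewrite !big_nil measure0.
rewrite !big_cons; apply: (le_trans (fine_probabilityU_le _ _)) => //.
  exact: bigsetU_measurable.
by rewrite lerD2l.
Qed.
End expectation.
Arguments Rintegral_cstT {dO O R} P r.

(** * Test functions with uniform Taylor expansions *)

Section jets.
Context (R : realType) (d : nat).
Implicit Types (z u : 'rV[R]_d) (k : 'rV[R]_d -> R) (l : 'I_d -> R)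
  (h : 'I_d -> 'I_d -> R).

Definition norm1 z : R := \sum_i `|z 0 i|.
Definition sqn z : R := \sum_i z 0 i ^+ 2.
Definition lin l z : R := \sum_i l i * z 0 i.
Definition quad h z : R := \sum_i \sum_j h i j * (z 0 i * z 0 j).

Lemma norm1_ge0 z : 0 <= norm1 z. Proof. exact: sumr_ge0. Qed.

Lemma sqn_ge0 z : 0 <= sqn z.
Proof. by apply: sumr_ge0 => i _; exact: sqr_ge0. Qed.

Lemma norm1M z z' : norm1 z * norm1 z' = \sum_i \sum_j `|z 0 i| * `|z' 0 j|.
Proof. by rewrite mulr_suml; apply: eq_bigr => i _; rewrite mulr_sumr. Qed.

Lemma lin_le l (C : R) z : (forall i, `|l i| <= C) ->
  `|lin l z| <= C * norm1 z.
Proof.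
move=> lC; rewrite (le_trans (ler_norm_sum _ _ _))// mulr_sumr ler_sum// => i _.
by rewrite normrM ler_wpM2r.
Qed.

Lemma quad_le h (C : R) z : (forall i j, `|h i j| <= C) ->
  `|quad h z| <= C * norm1 z ^+ 2.
Proof.
move=> hC; rewrite (le_trans (ler_norm_sum _ _ _))// expr2 norm1M mulr_sumr.
rewrite ler_sum// => i _; rewrite (le_trans (ler_norm_sum _ _ _))// mulr_sumr.
by rewrite ler_sum// => j _; rewrite !normrM ler_wpM2r// mulr_ge0.
Qed.

Lemma sqn_le z : sqn z <= norm1 z ^+ 2.
Proof.
rewrite expr2 norm1M; apply: ler_sum => i _.
by rewrite -real_normK ?num_real// expr2 (bigD1 i)//= lerDl sumr_ge0.
Qed.

(* A second-order Taylor expansion at 0.  The single constant [C] bounds the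
   coefficients and the remainder, so that a family of functions sharing it can be
   expanded uniformly. *)
Definition jet (C : R) k := exists (k0 : R) l h,
  [/\ `|k0| <= C, forall i, `|l i| <= C, forall i j, `|h i j| <= C &
      forall z, norm1 z <= 1 ->
        `|k z - (k0 + lin l z + quad h z)| <= C * norm1 z ^+ 3].

Lemma jet_ge0 C k : jet C k -> 0 <= C.
Proof. by case=> k0 [l [h [k0C _ _ _]]]; exact: le_trans k0C. Qed.

Lemma linD l l' z : lin (fun i => l i + l' i) z = lin l z + lin l' z.
Proof. by rewrite -big_split; apply: eq_bigr => i _; rewrite mulrDl. Qed.

Lemma linZ a l z : lin (fun i => a * l i) z = a * lin l z.
Proof. by rewrite mulr_sumr; apply: eq_bigr => i _; rewrite mulrA. Qed.

Lemma quadD h h' z : quad (fun i j => h i j + h' i j) z = quad h z + quad h' z.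
Proof.
rewrite -big_split; apply: eq_bigr => i _; rewrite -big_split.
by apply: eq_bigr => j _; rewrite mulrDl.
Qed.

Lemma quadZ a h z : quad (fun i j => a * h i j) z = a * quad h z.
Proof.
rewrite mulr_sumr; apply: eq_bigr => i _; rewrite mulr_sumr.
by apply: eq_bigr => j _; rewrite -mulrA.
Qed.

Lemma linM l l' z : lin l z * lin l' z = quad (fun i j => l i * l' j) z.
Proof.
rewrite mulr_suml; apply: eq_bigr => i _; rewrite mulr_sumr.
by apply: eq_bigr => j _; rewrite mulrACA.
Qed.

Lemma lin0 z : lin (fun=> 0) z = 0.
Proof. by apply: big1 => i _; rewrite mul0r. Qed.

Lemma quad0 z : quad (fun _ _ => 0) z = 0.
Proof. by apply: big1 => i _; apply: big1 => j _; rewrite mul0r. Qed.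

Lemma normM_le (a b A B : R) : `|a| <= A -> `|b| <= B -> `|a * b| <= A * B.
Proof. by move=> aA bB; rewrite normrM ler_pM. Qed.

Lemma jet_cst C (a : R) : `|a| <= C -> jet C (fun=> a).
Proof.
move=> aC; have C0 : 0 <= C by exact: le_trans aC.
exists a, (fun=> 0), (fun _ _ => 0); split => // [i|i j|z _]; rewrite ?normr0//.
by rewrite lin0 quad0 !addr0 subrr normr0 mulr_ge0// exprn_ge0 ?norm1_ge0.
Qed.

Lemma jetD C C' k k' : jet C k -> jet C' k' -> jet (C + C') (fun z => k z + k' z).
Proof.
move=> [k0 [l [h [k0C lC hC kC]]]] [k0' [l' [h' [k0C' lC' hC' kC']]]].
exists (k0 + k0'), (fun i => l i + l' i), (fun i j => h i j + h' i j).
split; [|move=> i|move=> i j|move=> z z1].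
- exact: le_trans (ler_normD _ _) (lerD _ _).
- exact: le_trans (ler_normD _ _) (lerD _ _).
- exact: le_trans (ler_normD _ _) (lerD _ _).
rewrite linD quadD mulrDl.
have -> : k z + k' z - (k0 + k0' + (lin l z + lin l' z) +
    (quad h z + quad h' z)) = (k z - (k0 + lin l z + quad h z)) +
    (k' z - (k0' + lin l' z + quad h' z)) by ring.
by rewrite (le_trans (ler_normD _ _))// lerD// ?kC ?kC'.
Qed.

(** Compositions with [cub] and with the inverse go through this: the outer function is replaced by
    a second-order polynomial, handled by [jetD] and [jetM], at the price of a cubic error. *)
Lemma jet_rem C c k k' : jet C k -> 0 <= c ->
  (forall z, norm1 z <= 1 -> `|k' z - k z| <= c * norm1 z ^+ 3) -> jet (C + c) k'.
Proof.
move=> [k0 [l [h [k0C lC hC kC]]]] c0 kk'; exists k0, l, h.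
have CCc x : x <= C -> x <= C + c by move=> xC; rewrite (le_trans xC)// lerDl.
split; [exact: CCc|move=> i; exact: CCc|move=> i j; exact: CCc|move=> z z1].
rewrite -[k' z](subrK (k z)) -addrA addrC mulrDl.
by rewrite (le_trans (ler_normD _ _))// lerD// ?kC ?kk'.
Qed.

(** The 10 counts the terms of order at least three in the product, in units of
    [C * C' * norm1 z ^+ 3]: one for each of the three products of lower parts, 4 for the remainder
    of [k] times [k'], and 3 for the polynomial of [k] times the remainder of [k']. *)
Lemma jetM C C' k k' : jet C k -> jet C' k' -> jet (10 * (C * C')) (fun z => k z * k' z).
Proof.
move=> jk jk'; have C0 := jet_ge0 jk; have C'0 := jet_ge0 jk'.
have CC' : 0 <= C * C' by exact: mulr_ge0.
move: jk jk' => [k0 [l [h [k0C lC hC kC]]]] [k0' [l' [h' [k0C' lC' hC' kC']]]].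
exists (k0 * k0'), (fun i => k0 * l' i + k0' * l i),
  (fun i j => k0 * h' i j + k0' * h i j + l i * l' j).
split; [|move=> i|move=> i j|move=> z z1].
- by apply: (le_trans (normM_le k0C k0C')); rewrite ler_peMl//; lra.
- rewrite (le_trans (ler_normD _ _))//.
  have := normM_le k0C (lC' i); have := normM_le k0C' (lC i); lra.
- rewrite (le_trans (ler_normD _ _))//.
  have := ler_normD (k0 * h' i j) (k0' * h i j).
  have := normM_le k0C (hC' i j); have := normM_le k0C' (hC i j).
  have := normM_le (lC i) (lC' j); lra.
rewrite linD !quadD !linZ !quadZ -linM.
have {kC}:= kC z z1; have {kC'} := kC' z z1.
have {lC} := lin_le z lC; have {lC'} := lin_le z lC'.
have {hC} := quad_le z hC; have {hC'} := quad_le z hC'.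
have t0 := norm1_ge0 z.
move: (norm1 z) t0 z1 => t t0 t1.
move: (lin l z) (lin l' z) (quad h z) (quad h' z) => L L' Q Q' Q'C QC L'C LC.
set e' := k' z - _; set e := k z - _ => e'C eC.
have -> : k z * k' z - (k0 * k0' + (k0 * L' + k0' * L) +
   (k0 * Q' + k0' * Q + L * L')) =
   L * Q' + Q * L' + Q * Q' + e * (k0' + L' + Q' + e') + (k0 + L + Q) * e'.
  by rewrite /e /e'; ring.
have t2 : t ^+ 2 <= 1 by rewrite expr_le1.
have t3 : t ^+ 3 <= 1 by rewrite expr_le1.
have t30 : 0 <= t ^+ 3 by rewrite exprn_ge0.
have A1 := normM_le LC Q'C.
have A2 := normM_le QC L'C.
have A3 := normM_le QC Q'C.
have kb' : `|k0' + L' + Q' + e'| <= 4 * C'.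
  rewrite (le_trans (ler_normD _ _))//.
  have := ler_normD (k0' + L') Q'; have := ler_normD k0' L'.
  have : C' * t <= C' by rewrite ler_piMr.
  have : C' * t ^+ 2 <= C' by rewrite ler_piMr.
  have : C' * t ^+ 3 <= C' by rewrite ler_piMr.
  lra.
have kb : `|k0 + L + Q| <= 3 * C.
  rewrite (le_trans (ler_normD _ _))//.
  have := ler_normD k0 L.
  have : C * t <= C by rewrite ler_piMr.
  have : C * t ^+ 2 <= C by rewrite ler_piMr.
  lra.
have A4 := normM_le eC kb'; have A5 := normM_le kb e'C.
rewrite !(le_trans (ler_normD _ _))//.
have := ler_normD (L * Q' + Q * L' + Q * Q') (e * (k0' + L' + Q' + e')).
have := ler_normD (L * Q' + Q * L') (Q * Q').
have := ler_normD (L * Q') (Q * L').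
have E1 : C * t * (C' * t ^+ 2) = C * C' * t ^+ 3 by ring.
have E2 : C * t ^+ 2 * (C' * t) = C * C' * t ^+ 3 by ring.
have E3 : C * t ^+ 2 * (C' * t ^+ 2) <= C * C' * t ^+ 3.
  have -> : C * t ^+ 2 * (C' * t ^+ 2) = C * C' * t ^+ 3 * t by ring.
  by rewrite ler_piMr// mulr_ge0.
have E4 : C * t ^+ 3 * (4 * C') = 4 * (C * C' * t ^+ 3) by ring.
have E5 : 3 * C * (C' * t ^+ 3) = 3 * (C * C' * t ^+ 3) by ring.
rewrite E1 in A1; rewrite E2 in A2; rewrite E4 in A4; rewrite E5 in A5.
have -> : 10 * (C * C') * t ^+ 3 = 10 * (C * C' * t ^+ 3) by ring.
lra.
Qed.

(** For [norm1 z > 1] the bound [|k z| <= 1] replaces the expansion, and [1 + 3 * C] collects [k],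
    the constant, the linear and the quadratic part. The minimum makes the error integrable under
    second moments alone. *)
Lemma jet_global C k : jet C k -> (forall z, `|k z| <= 1) ->
  exists l h, [/\ forall i, `|l i| <= C, forall i j, `|h i j| <= C &
   forall z, `|k z - (k 0 + lin l z + quad h z)| <=
    (1 + 3 * C) * (norm1 z ^+ 2 * Num.min 1 (norm1 z))].
Proof.
move=> jk k1; have C0 := jet_ge0 jk.
case: jk => k0 [l [h [k0C lC hC kC]]]; exists l, h; split => // z.
have -> : k 0 = k0.
  have n0 : norm1 0 = 0 by rewrite /norm1 big1// => i _; rewrite mxE normr0.
  have := kC 0; rewrite n0 ler01 expr0n/= mulr0 => /(_ isT).
  rewrite normr_le0 subr_eq0 => /eqP ->.
  have -> : lin l 0 = 0 by apply: big1 => i _; rewrite mxE mulr0.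
  have -> : quad h 0 = 0.
    by apply: big1 => i _; apply: big1 => j _; rewrite !mxE !mulr0.
  by rewrite !addr0.
have t0 := norm1_ge0 z; have [t1|t1] := leP (norm1 z) 1.
  rewrite -exprSr (le_trans (kC z t1))// ler_wpM2r ?exprn_ge0//; lra.
rewrite mulr1.
have := lin_le z lC; have := quad_le z hC; have := k1 z.
move: (norm1 z) t0 t1 => t t0 t1 kz QC LC.
have tt : t <= t ^+ 2 by rewrite expr2 ler_peMl// ltW.
have t2 : 1 <= t ^+ 2 by lra.
have : C <= C * t ^+ 2 by rewrite ler_peMr.
have : C * t <= C * t ^+ 2 by rewrite ler_wpM2l.
have := ler_normB (k z) (k0 + lin l z + quad h z).
have := ler_normD (k0 + lin l z) (quad h z); have := ler_normD k0 (lin l z).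
lra.
Qed.

(** Cubing the positive part makes the second derivative Lipschitz, which is what a cubic remainder
    asks for. *)
Definition cub (x : R) : R := Num.max 0 x ^+ 3.

Lemma cub_expand (a e : R) :
  `|cub (a + e) - (cub a + 3 * Num.max 0 a ^+ 2 * e + 3 * Num.max 0 a * e ^+ 2)|
  <= `|e| ^+ 3.
Proof.
rewrite /cub; have [a0|a0] := leP 0 a; have [ae|ae] := leP 0 (a + e).
- rewrite (_ : _ - _ = e ^+ 3) ?normrX//; ring.
- have e0 : e < 0 by lra.
  rewrite (ltr0_norm e0).
  have -> : (0 : R) ^+ 3 - (a ^+ 3 + 3 * a ^+ 2 * e + 3 * a * e ^+ 2) =
    - (a * (a ^+ 2 + 3 * a * e + 3 * e ^+ 2)) by ring.
  have q0 : 0 <= a ^+ 2 + 3 * a * e + 3 * e ^+ 2.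
    have -> : a ^+ 2 + 3 * a * e + 3 * e ^+ 2 = (a + 3 / 2 * e) ^+ 2 + 3 / 4 * e ^+ 2 by field.
    by have := sqr_ge0 (a + 3/2 * e); have := sqr_ge0 e; lra.
  rewrite normrN ger0_norm ?mulr_ge0//.
  (* The error is [|e| ^+ 3] minus the cube of the negative part of [a + e], hence at most
     [|e| ^+ 3]. *)
  have -> : a * (a ^+ 2 + 3 * a * e + 3 * e ^+ 2) = (- e) ^+ 3 - (- (a + e)) ^+ 3 by ring.
  have : 0 <= (- (a + e)) ^+ 3 by rewrite exprn_ge0//; lra.
  lra.
- rewrite !expr0n/= !(mulr0, mul0r, addr0) subr0 ger0_norm ?exprn_ge0//.
  by rewrite ger0_norm ?lerXn2r ?nnegrE//; lra.
- by rewrite !expr0n/= !(mulr0, mul0r, addr0) subr0 normr0 exprn_ge0.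
Qed.

Lemma max0_le (a C : R) : `|a| <= C -> `|Num.max 0 a| <= C.
Proof.
by move=> aC; have [a0|a0] := leP 0 a => //; rewrite normr0; exact: le_trans aC.
Qed.

(** Term by term: the constant, linear and quadratic parts of the expansion of [cub] at [k0], with
    [2 * C] the jet constant of [k - k0], and [27 * C ^+ 3] from [|k z - k0| <= 3 * C * norm1 z]. *)
Definition jet_cub_bound (C : R) : R :=
  C ^+ 3 + 10 * (3 * C ^+ 2 * (2 * C)) +
  10 * (3 * C * (10 * (2 * C * (2 * C)))) + 27 * C ^+ 3.

Lemma jet_cub C k : jet C k -> jet (jet_cub_bound C) (fun z => cub (k z)).
Proof.
move=> jk; have C0 := jet_ge0 jk.
have [k0 [l [h [k0C lC hC kC]]]] := jk.
have jk0 : jet (2 * C) (fun z => k z - k0).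
  rewrite (_ : 2 * C = C + C); last by ring.
  by apply: jetD => //; apply: jet_cst; rewrite normrN.
apply: (jet_rem (k := fun z => cub k0 + 3 * Num.max 0 k0 ^+ 2 * (k z - k0) +
   3 * Num.max 0 k0 * ((k z - k0) * (k z - k0)))).
- apply: jetD; first apply: jetD.
  + by apply: jet_cst; rewrite normrX lerXn2r ?nnegrE// max0_le.
  + apply: jetM => //; apply: jet_cst; rewrite normrM normrX ger0_norm//.
    by rewrite ler_wpM2l// lerXn2r ?nnegrE// max0_le.
  + apply: jetM; last exact: jetM.
    by apply: jet_cst; rewrite normrM ger0_norm// ler_wpM2l// max0_le.
- by rewrite mulr_ge0// exprn_ge0.
- move=> z z1; have := cub_expand k0 (k z - k0).
  rewrite [k0 + _]addrC subrK -expr2 => /le_trans; apply.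
  rewrite (_ : 27 * C ^+ 3 * norm1 z ^+ 3 = (3 * (C * norm1 z)) ^+ 3); last by ring.
  have t0 := norm1_ge0 z.
  rewrite lerXn2r ?nnegrE//; first by rewrite !mulr_ge0.
  have := kC z z1; have := lin_le z lC; have := quad_le z hC.
  move: (lin l z) (quad h z) (norm1 z) t0 z1 => L Q t t0 t1 QC LC eC.
  have -> : k z - k0 = L + Q + (k z - (k0 + L + Q)) by ring.
  rewrite (le_trans (ler_normD _ _))//; have := ler_normD L Q.
  have : C * t ^+ 2 <= C * t by rewrite ler_wpM2l// expr2 ler_piMl.
  have : C * t ^+ 3 <= C * t by rewrite ler_wpM2l// exprS ler_piMr// expr_le1.
  lra.
Qed.

Definition jet_inv_bound : R := 1 + 10 * (1 * 1) + 10 * (1 * (10 * (1 * 1))) + 8.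

(** With [eta = r0 * (sqn (u + s *: z) - sqn u)] the function [r] equals [r0 / (1 + eta)], and the
    geometric series gives [r = r0 - r0 * eta + r0 * eta ^+ 2 - r * eta ^+ 3]. Since
    [2 * |u 0 i| <= 1 + sqn u], the coefficients of [eta] are at most 1 whatever [u] is. The 8 of
    the bound comes from [|eta z| <= 2 * norm1 z]. *)
Lemma jet_inv u (s : R) : `|s| <= 1 ->
  jet jet_inv_bound (fun z => (1 + sqn (u + s *: z))^-1).
Proof.
move=> s1; set r0 := (1 + sqn u)^-1.
have D0 : 0 < 1 + sqn u by have := sqn_ge0 u; lra.
have r00 : 0 <= r0 by rewrite invr_ge0 ltW.
have r01 : `|r0| <= 1 by rewrite ger0_norm// invf_le1//; have := sqn_ge0 u; lra.
have r0u i : `|r0 * (2 * u 0 i)| <= 1.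
  rewrite normrM (ger0_norm r00) mulrC ler_pdivrMr// mul1r normrM ger0_norm//.
  have : `|u 0 i| ^+ 2 <= sqn u.
    rewrite real_normK ?num_real// /sqn (bigD1 i)//= lerDl sumr_ge0// => j _.
    exact: sqr_ge0.
  have := sqr_ge0 (`|u 0 i| - 1); have -> : (`|u 0 i| - 1) ^+ 2 =
    `|u 0 i| ^+ 2 - 2 * `|u 0 i| + 1 by ring.
  lra.
pose l i := r0 * (2 * u 0 i) * s.
pose h (i j : 'I_d) := if i == j then r0 * (s * s) else 0.
pose eta z := lin l z + quad h z.
have l1 i : `|l i| <= 1 by rewrite -[1]mulr1 normM_le.
have h1 i j : `|h i j| <= 1.
  by rewrite /h; case: ifP => _; rewrite ?normr0// -[1]mulr1 normM_le// -[1]mulr1 normM_le.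
have etaE z : eta z = r0 * (sqn (u + s *: z) - sqn u).
  rewrite /eta /lin /quad /sqn -sumrB mulr_sumr -big_split/=; apply: eq_bigr => i _.
  rewrite (bigD1 i)//= [X in _ + (_ + X)]big1 => [|j ji]; last first.
    by rewrite /h eq_sym (negbTE ji) mul0r.
  by rewrite /h eqxx /l !mxE; ring.
have jeta : jet 1 eta.
  exists 0, l, h; split; rewrite ?normr0// => z _.
  by rewrite add0r subrr normr0 mul1r exprn_ge0 ?norm1_ge0.
apply: (jet_rem (k := fun z => r0 + (- r0) * eta z + r0 * (eta z * eta z))) => //.
- apply: jetD; first apply: jetD.
  + exact: jet_cst.
  + by apply: jetM => //; apply: jet_cst; rewrite normrN.
  + by apply: jetM; [exact: jet_cst|exact: jetM].
move=> z z1.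
set r := (_)^-1.
have D1 : 1 <= 1 + sqn (u + s *: z) by have := sqn_ge0 (u + s *: z); lra.
have r1 : 0 <= r <= 1 by rewrite /r invr_ge0 invf_le1; lra.
have rE : r * (1 + eta z) = r0.
  rewrite etaE /r /r0; field.
  by apply/andP; split; lra.
have -> : r - (r0 + - r0 * eta z + r0 * (eta z * eta z)) = - (r * eta z ^+ 3).
  by rewrite -rE; ring.
rewrite normrN -[8]mul1r -mulrA; apply: normM_le; first by rewrite ger0_norm; lra.
rewrite normrX (_ : 8 * _ = (2 * norm1 z) ^+ 3); last by ring.
have t0 := norm1_ge0 z.
rewrite lerXn2r ?nnegrE//; first by rewrite mulr_ge0.
rewrite (le_trans (ler_normD _ _))//.
have := lin_le z l1; have := quad_le z h1.
have : norm1 z ^+ 2 <= norm1 z by rewrite expr2 ler_piMl.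
lra.
Qed.

(* 0 at [q = a] and 1 at [q = b].  The variable [q], a squared norm, enters only
   through [1 / (1 + q)], whose expansion is uniform in the base point (jet_inv). *)
Definition step_arg (a b q : R) : R :=
  (1 + a)^-1 / ((1 + a)^-1 - (1 + b)^-1) -
  ((1 + a)^-1 - (1 + b)^-1)^-1 * (1 + q)^-1.

(** The inner [cub] makes the function constant up to [q = a], the outer one from [q = b] on; both
    preserve jets. *)
Definition step (a b q : R) : R := cub (1 - cub (step_arg a b q)).

Lemma cub_mono (x y : R) : x <= y -> cub x <= cub y.
Proof. 
move=> xy; apply: lerXn2r; rewrite ?nnegrE.
- by rewrite le_max lexx.
- by rewrite le_max lexx.
- by rewrite ge_max !le_max lexx xy orbT.
Qed.

Lemma cub_ge0 (x : R) : 0 <= cub x.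
Proof. by rewrite exprn_ge0// le_max lexx. Qed.

Lemma step_ge0 a b q : 0 <= step a b q. Proof. exact: cub_ge0. Qed.

Lemma step_le1 a b q : step a b q <= 1.
Proof.
have -> : 1 = cub 1 by rewrite /cub max_r// expr1n.
by apply: cub_mono; have := cub_ge0 (step_arg a b q); lra.
Qed.

Lemma step_gap (a b : R) : 0 <= a -> a < b -> 0 < (1 + a)^-1 - (1 + b)^-1.
Proof. by move=> a0 ab; rewrite subr_gt0 ltf_pV2 ?posrE; lra. Qed.

Lemma step1 (a b q : R) : 0 <= a -> a < b -> 0 <= q -> q <= a -> step a b q = 1.
Proof.
move=> a0 ab q0 qa; have g := step_gap a0 ab.
have x0 : step_arg a b q <= 0.
  rewrite /step_arg [X in _ - X]mulrC -mulrBl mulr_le0_ge0 ?invr_ge0 ?(ltW g)//.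
  by rewrite subr_le0 lef_pV2 ?posrE; lra.
by rewrite /step /cub (max_l x0) expr0n subr0 max_r// expr1n.
Qed.

Lemma step0 (a b q : R) : 0 <= a -> a < b -> b <= q -> step a b q = 0.
Proof.
move=> a0 ab bq; have g := step_gap a0 ab.
have x0 : 1 <= step_arg a b q.
  rewrite /step_arg [X in _ - X]mulrC -mulrBl ler_pdivlMr// mul1r lerD2l lerN2.
  by rewrite lef_pV2 ?posrE; lra.
have : 1 <= cub (step_arg a b q).
  by rewrite /cub exprn_ege1// le_max x0 orbT.
by move=> c1; rewrite /step {1}/cub max_l ?expr0n//; lra.
Qed.

Definition jet_step_bound (a b : R) : R :=
  let c := ((1 + a)^-1 - (1 + b)^-1)^-1 in
  jet_cub_bound (1 + jet_cub_bound (`|(1 + a)^-1 * c| + 10 * (`|c| * jet_inv_bound))).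

(** The constant depends on [a] and [b] but not on the base point [u], which stands for a partial
    sum of unbounded size. *)
Lemma jet_step (a b : R) u (s : R) : `|s| <= 1 ->
  jet (jet_step_bound a b) (fun z => step a b (sqn (u + s *: z))).
Proof.
move=> s1; apply: jet_cub; set c := (_)^-1.
have jN C k : jet C k -> jet C (fun z => - k z).
  move=> [k0 [l [h [k0C lC hC kC]]]].
  exists (- k0), (fun i => -1 * l i), (fun i j => -1 * h i j).
  rewrite normrN; split=> // [i|i j|z /kC]; rewrite ?mulN1r ?normrN//.
  rewrite linZ quadZ !mulN1r -normrN; congr (`|_| <= _); ring.
apply: jetD; first by apply: jet_cst; rewrite normr1.
apply/jN/jet_cub/jetD; first exact: jet_cst.
by apply/jN/jetM; [exact: jet_cst|exact: jet_inv].
Qed.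

End jets.

Section step_product.
Context (R : realType) (d J : nat) (a b : R).

Definition step_prod (x : 'M[R]_(J, d)) : R := \prod_(j < J) step a b (sqn (row j x)).

Definition jet_prod_bound : R :=
  iter J (fun D => 10 * (jet_step_bound a b * D)) 1.

(** An expansion in a single summand [z]: the column [s] holds the weights with which [z] enters the
    [J] linear combinations, and [x] freezes all the other summands. *)
Lemma jet_step_prod (x : 'M[R]_(J, d)) (s : 'cV[R]_J) :
  (forall j, `|s j 0| <= 1) ->
  jet jet_prod_bound (fun z : 'rV[R]_d => step_prod (x + s *m z)).
Proof.
move=> s1; have rowE j (z : 'rV[R]_d) : row j (x + s *m z) = row j x + s j 0 *: z.
  by apply/rowP => i; rewrite !mxE big_ord1.
have -> : (fun z : 'rV[R]_d => step_prod (x + s *m z)) =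
    (fun z => \prod_(j <- enum 'I_J) step a b (sqn (row j x + s j 0 *: z))).
  apply/funext => z; rewrite /step_prod big_enum/=.
  by apply: eq_bigr => j _; rewrite rowE.
rewrite /jet_prod_bound -{1}[J]size_enum_ord.
elim: (enum 'I_J) => [|j r IH] /=.
  by under eq_fun do rewrite big_nil; apply: jet_cst; rewrite normr1.
rewrite (_ : (fun _ => _) = (fun z : 'rV[R]_d =>
    step a b (sqn (row j x + s j 0 *: z)) *
    \prod_(j <- r) step a b (sqn (row j x + s j 0 *: z)))).
  by apply: jetM => //; exact: jet_step.
by apply/funext => z; rewrite big_cons.
Qed.

Lemma step_prod_ge0 x : 0 <= step_prod x.
Proof. by apply: prodr_ge0 => j _; exact: step_ge0. Qed.

Lemma step_prod_le1 x : step_prod x <= 1.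
Proof.
suff /andP[] : 0 <= step_prod x <= 1 by [].
apply: (big_ind (fun y => 0 <= y <= 1)); rewrite ?ler01 ?lexx//.
  by move=> y y' /andP[y0 y1] /andP[y0' y1']; rewrite mulr_ge0//= mulr_ile1.
by move=> j _; rewrite step_ge0 step_le1.
Qed.

Lemma step_prod_norm_le1 x : `|step_prod x| <= 1.
Proof. by rewrite ger0_norm ?step_prod_ge0// step_prod_le1. Qed.

End step_product.

(** * Lindeberg's replacement *)

Lemma Rintegral_Fubini (d1 d2 : measure_display) (T1 : measurableType d1)
    (T2 : measurableType d2) (R : realType) (P1 : probability T1 R)
    (P2 : probability T2 R) (h : T1 * T2 -> R) (M : R) :
  measurable_fun [set: T1 * T2] h -> (forall z, `|h z| <= M) ->
  \int[P1]_x \int[P2]_y h (x, y) = \int[P2]_y \int[P1]_x h (x, y).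
Proof.
move=> mh hM.
have hi : (P1 \x P2)%E.-integrable [set: T1 * T2] (EFin \o h).
  apply: measurable_bounded_integrable => //.
    apply: le_lt_trans (ltry 1).
    have -> : [set: T1 * T2] = [set: T1] `*` [set: T2] by rewrite setXTT.
    rewrite [leLHS]product_measure1E//.
    by rewrite -[leRHS]mule1 lee_pmul// probability_le1.
  by exists M; split => [|x Mx w _ /=]; rewrite ?num_real// (le_trans (hM w))// ltW.
have hi1 x : P2.-integrable [set: T2] (EFin \o (fun y => h (x, y))).
  apply: (@bounded_integrable _ _ _ _ _ M) => //.
  by apply: (measurableT_comp mh); exact: pair1_measurable.
have hi2 y : P1.-integrable [set: T1] (EFin \o (fun x => h (x, y))).
  apply: (@bounded_integrable _ _ _ _ _ M) => //.
  by apply: (measurableT_comp mh); exact: pair2_measurable.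
rewrite /Rintegral; congr fine.
transitivity (\int[P1]_x \int[P2]_y (EFin \o h) (x, y))%E.
  by apply: eq_integral => x _; rewrite fineK// (integrable_fin_num measurableT (hi1 x)).
rewrite Fubini//.
by apply: eq_integral => y _; rewrite fineK// (integrable_fin_num measurableT (hi2 y)).
Qed.

Section vector_valued.
Context (R : realType) (J d : nat).
Implicit Types (g : 'M[R]_(J, d) -> R).

Definition vmeas (dT : measure_display) (T : measurableType dT)
    (A : T -> 'M[R]_(J, d)) : Prop :=
  forall i j, measurable_fun [set: T] (fun w => A w i j).

(** Measurability is stated through the composites with all entrywise measurable maps, so that no
    sigma-algebra on matrices has to be chosen. *)
Definition mtest g : Prop :=
  forall (dT : measure_display) (T : measurableType dT) (A : T -> 'M[R]_(J, d)),
    vmeas A -> measurable_fun [set: T] (g \o A).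

Lemma vmeasD (dT : measure_display) (T : measurableType dT)
    (A B : T -> 'M[R]_(J, d)) :
  vmeas A -> vmeas B -> vmeas (fun w => A w + B w).
Proof.
move=> mA mB i j; under eq_fun do rewrite mxE; exact: measurable_funD.
Qed.

Lemma vmeas_cst (dT : measure_display) (T : measurableType dT)
    (x : 'M[R]_(J, d)) : vmeas (T := T) (fun=> x).
Proof. by move=> i j; exact: measurable_cst. Qed.

Lemma vmeas_sum (dT : measure_display) (T : measurableType dT)
    (A : nat -> T -> 'M[R]_(J, d)) n : (forall k, (k < n)%N -> vmeas (A k)) ->
  vmeas (fun w => \sum_(k < n) A k w).
Proof.
elim: n => [mA|n IH mA].
  by under eq_fun do rewrite big_ord0; exact: vmeas_cst.
under eq_fun do rewrite big_ord_recr/=; apply: vmeasD; last exact: mA.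
by apply: IH => k kn; apply: mA; rewrite ltnS ltnW.
Qed.

Lemma vmeas_comp (d1 d2 : measure_display) (T1 : measurableType d1)
    (T2 : measurableType d2) (f : T1 -> T2) (A : T2 -> 'M[R]_(J, d)) :
  measurable_fun [set: T1] f -> vmeas A -> vmeas (A \o f).
Proof. by move=> mf mA i j; exact: measurableT_comp (mA i j) mf. Qed.

Lemma mtest_shift g x : mtest g -> mtest (fun y => g (x + y)).
Proof.
by move=> mg dT T A mA; apply: (mg _ _ (fun w => x + A w)); exact: vmeasD (vmeas_cst x) mA.
Qed.

Lemma mtest_pair g (d1 d2 : measure_display) (T1 : measurableType d1)
    (T2 : measurableType d2) (A : T1 -> 'M[R]_(J, d)) (B : T2 -> 'M[R]_(J, d)) :
  mtest g -> vmeas A -> vmeas B ->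
  measurable_fun [set: T1 * T2] (fun z => g (A z.1 + B z.2)).
Proof.
move=> mg mA mB; apply: (mg _ _ (fun z => A z.1 + B z.2)); apply: vmeasD.
- exact: (vmeas_comp measurable_fst).
- exact: (vmeas_comp measurable_snd).
Qed.

Lemma mtest_mean g (dO : measure_display) (O : measurableType dO)
    (P : probability O R) (A : O -> 'M[R]_(J, d)) :
  mtest g -> (forall x, `|g x| <= 1) -> vmeas A ->
  mtest (fun y => \int[P]_w g (y + A w)).
Proof.
move=> mg g1 mA dT T S mS.
have mgy y : measurable_fun [set: O] (fun w => g (y + A w)).
  by apply: (mg _ _ (fun w => y + A w)); exact: vmeasD (vmeas_cst y) mA.
have gi y : P.-integrable [set: O] (EFin \o (fun w => g (y + A w))).
  exact: bounded_integrable (mgy y) (fun w => g1 _).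
have c1 : P.-integrable [set: O] (EFin \o (fun=> 1 : R)).
  by apply: (@bounded_integrable _ _ _ _ _ 1) => // w; rewrite normr1.
(* Adding 1 makes the integrand nonnegative, as Tonelli's theorem requires. *)
have -> : (fun y => \int[P]_w g (y + A w)) \o S =
   (fun t => fine (\int[P]_w (1 + g (S t + A w))%:E)%E - 1).
  apply/funext => t /=.
  have := RintegralD measurableT c1 (gi (S t)).
  by rewrite (Rintegral_cstT P) {1}/Rintegral => ->; rewrite addrAC subrr add0r.
apply: measurable_funB => //; apply: (measurableT_comp (fine_measurable _)) => //.
apply: (@measurable_fun_fubini_tonelli_F _ _ T O R P
  (fun z => (1 + g (S z.1 + A z.2))%:E)).
  by apply/measurable_EFinP; apply: measurable_funD => //; exact: (mtest_pair (A := S) (B := A)).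
by move=> z; rewrite lee_fin; have := g1 (S z.1 + A z.2); rewrite ler_norml => /andP[]; lra.
Qed.

(* Independence in the only form that Lindeberg's replacement uses. *)
Definition indep_vectors (dO : measure_display) (O : measurableType dO)
    (P : probability O R) (S A : O -> 'M[R]_(J, d)) : Prop :=
  forall g, mtest g -> (forall x, `|g x| <= 1) ->
    \int[P]_w g (S w + A w) = \int[P]_w \int[P]_w' g (S w + A w').

Lemma indep_vectors0r (dO : measure_display) (O : measurableType dO)
    (P : probability O R) (A : O -> 'M[R]_(J, d)) : indep_vectors P A (fun=> 0).
Proof.
by move=> g mg g1; apply: eq_Rintegral => w _; rewrite (Rintegral_cstT P).
Qed.

(** [independent_maps_Fubini] is applied to the identity map twice, with [O] carrying [<<s G1 >>]
    and then [<<s G2 >>] as target sigma-algebra. *)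
Lemma indep_vectors_sigma (dO : measure_display) (O : measurableType dO)
    (P : probability O R) (G1 G2 : set (set O)) (S A : O -> 'M[R]_(J, d)) :
  <<s G1 >> `<=` measurable -> <<s G2 >> `<=` measurable ->
  (forall C D, <<s G1 >> C -> <<s G2 >> D -> P (C `&` D) = (P C * P D)%E) ->
  vmeas (S : g_sigma_algebraType G1 -> _) ->
  vmeas (A : g_sigma_algebraType G2 -> _) ->
  indep_vectors P S A.
Proof.
move=> G1m G2m indep mS mA g mg g1.
have mU : @measurable_fun _ _ O (g_sigma_algebraType G1) setT id.
  by move=> _ B mB; rewrite setTI; exact: G1m.
have mY : @measurable_fun _ _ O (g_sigma_algebraType G2) setT id.
  by move=> _ B mB; rewrite setTI; exact: G2m.
have mS' : vmeas S by exact: vmeas_comp mU mS.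
have mA' : vmeas A by exact: vmeas_comp mY mA.
have gi : P.-integrable [set: O] (EFin \o (fun w => g (S w + A w))).
  apply: (@bounded_integrable _ _ _ _ _ 1) => //.
  by apply: (mg _ _ (fun w => S w + A w)); exact: vmeasD.
have giw w : P.-integrable [set: O] (EFin \o (fun w' => g (S w + A w'))).
  apply: (@bounded_integrable _ _ _ _ _ 1) => //.
  by apply: (mg _ _ (fun w' => S w + A w')); exact: vmeasD (vmeas_cst _) mA'.
rewrite /Rintegral; congr fine.
rewrite (independent_maps_Fubini (T1 := g_sigma_algebraType G1)
  (T2 := g_sigma_algebraType G2) (h := fun z => g (S z.1 + A z.2)) mU mY)//=.
- by apply: eq_integral => w _; rewrite fineK// (integrable_fin_num measurableT (giw w)).
- exact: (mtest_pair (T1 := g_sigma_algebraType G1)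
    (T2 := g_sigma_algebraType G2) (A := S) (B := A)).
Qed.

(** The two families live on different spaces, so the hybrid sum of the first [n] terms of [B] and
    of [A n] exists only as an iterated integral, which [Rintegral_Fubini] lets one read from either
    side. The induction hypothesis, uniform in the base point, exchanges the first [n] summands with
    [A n] frozen; [ek] then exchanges the last one with the [B] part frozen. The arguments of
    [indep_vectors] stand in the order of integration used on each side. *)
Lemma lindeberg (d1 d2 : measure_display) (T1 : measurableType d1)
    (T2 : measurableType d2) (P : probability T1 R) (P' : probability T2 R)
    (A : nat -> T1 -> 'M[R]_(J, d)) (B : nat -> T2 -> 'M[R]_(J, d))
    (g : 'M[R]_(J, d) -> R) (e : nat -> R) (n : nat) :
  (forall k, (k < n)%N -> vmeas (A k)) -> (forall k, (k < n)%N -> vmeas (B k)) ->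
  (forall k, (k < n)%N -> indep_vectors P (A k) (fun w => \sum_(i < k) A i w)) ->
  (forall k, (k < n)%N -> indep_vectors P' (fun w => \sum_(i < k) B i w) (B k)) ->
  mtest g -> (forall x, `|g x| <= 1) ->
  (forall k, (k < n)%N -> forall x,
     `|\int[P]_w g (x + A k w) - \int[P']_w g (x + B k w)| <= e k) ->
  forall x, `|\int[P]_w g (x + \sum_(k < n) A k w) -
              \int[P']_w g (x + \sum_(k < n) B k w)| <= \sum_(k < n) e k.
Proof.
move=> + + + + mg g1; elim: n => [|n IH] mA mB iA iB ek x.
  under eq_Rintegral do rewrite big_ord0.
  under [X in _ - X]eq_Rintegral do rewrite big_ord0.
  by rewrite !Rintegral_cstT subrr normr0 big_ord0.
have ltS k : (k < n -> k < n.+1)%N by move=> kn; rewrite ltnS ltnW.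
have {}IH := IH (fun k kn => mA k (ltS k kn)) (fun k kn => mB k (ltS k kn))
  (fun k kn => iA k (ltS k kn)) (fun k kn => iB k (ltS k kn))
  (fun k kn => ek k (ltS k kn)).
pose SA w := \sum_(k < n) A k w; pose SB w := \sum_(k < n) B k w.
have mSA : vmeas SA by apply: vmeas_sum => k kn; exact/mA/ltS.
have mSB : vmeas SB by apply: vmeas_sum => k kn; exact/mB/ltS.
have mAn := mA n (ltnSn n); have mBn := mB n (ltnSn n).
pose FA y := \int[P]_w g (y + SA w); pose FB y := \int[P']_w g (y + SB w).
pose GA y := \int[P]_w g (y + A n w); pose GB y := \int[P']_w g (y + B n w).
have mFA : mtest FA by exact: mtest_mean.
have mFB : mtest FB by exact: mtest_mean.
have mGA : mtest GA by exact: mtest_mean.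
have mGB : mtest GB by exact: mtest_mean.
have mgx (dT : measure_display) (T : measurableType dT) (C : T -> 'M[R]_(J, d)) (y : 'M[R]_(J, d)) :
    vmeas C -> measurable_fun [set: T] (fun w => g (y + C w)).
  by move=> mC; apply: (mg _ _ (fun w => y + C w)); exact: vmeasD (vmeas_cst _) mC.
have b1 (dT : measure_display) (T : measurableType dT) (Q : probability T R)
    (C : T -> 'M[R]_(J, d)) (y : 'M[R]_(J, d)) : vmeas C -> `|\int[Q]_w g (y + C w)| <= 1.
  by move=> mC; apply: normr_Rintegral_le => //; exact: mgx.
have int (dT : measure_display) (T : measurableType dT) (Q : probability T R)
    (C : T -> 'M[R]_(J, d)) (h : 'M[R]_(J, d) -> R) : mtest h -> (forall y, `|h y| <= 1) ->
    vmeas C -> Q.-integrable [set: T] (EFin \o (fun w => h (x + C w))).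
  move=> mh h1 mC; apply: (@bounded_integrable _ _ _ _ _ 1) => //.
  by apply: (mh _ _ (fun w => x + C w)); exact: vmeasD (vmeas_cst _) mC.
have E1 : \int[P]_w g (x + \sum_(k < n.+1) A k w) = \int[P]_w FA (x + A n w).
  rewrite (eq_Rintegral _ (g := fun w => g (x + (A n w + SA w)))); last first.
    by move=> w _; rewrite big_ord_recr/= [A n w + _]addrC.
  have -> := iA n (ltnSn n) _ (mtest_shift x mg) (fun y => g1 (x + y)).
  by apply: eq_Rintegral => w _; apply: eq_Rintegral => w' _; rewrite addrA.
have E2 : \int[P']_w g (x + \sum_(k < n.+1) B k w) = \int[P']_w GB (x + SB w).
  rewrite (eq_Rintegral _ (g := fun w => g (x + (SB w + B n w)))); last first.
    by move=> w _; rewrite big_ord_recr.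
  have -> := iB n (ltnSn n) _ (mtest_shift x mg) (fun y => g1 (x + y)).
  by apply: eq_Rintegral => w _; apply: eq_Rintegral => w' _; rewrite addrA.
have E3 : \int[P]_w FB (x + A n w) = \int[P']_w GA (x + SB w).
  have mh := mtest_pair (A := fun w => x + A n w) (B := SB) mg
    (vmeasD (vmeas_cst x) mAn) mSB.
  have := Rintegral_Fubini P P' mh (fun z => g1 _).
  rewrite /FB /GA => ->.
  by apply: eq_Rintegral => w _; apply: eq_Rintegral => w' _; rewrite addrAC.
rewrite E1 E2 -(subrK (\int[P]_w FB (x + A n w)) (\int[P]_w FA _)) -addrA E3.
rewrite big_ord_recr/= (le_trans (ler_normD _ _))//; apply: lerD.
  rewrite -E3 -(RintegralB measurableT
    (int _ _ P (A n) FA mFA (fun y => b1 _ _ P SA y mSA) mAn)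
    (int _ _ P (A n) FB mFB (fun y => b1 _ _ P' SB y mSB) mAn)).
  apply: normr_Rintegral_le => [|w]; last exact: IH.
  apply: measurable_funB.
    by apply: (mFA _ _ (fun w => x + A n w)); exact: vmeasD (vmeas_cst _) mAn.
  by apply: (mFB _ _ (fun w => x + A n w)); exact: vmeasD (vmeas_cst _) mAn.
rewrite -(RintegralB measurableT
  (int _ _ P' SB GA mGA (fun y => b1 _ _ P (A n) y mAn) mSB)
  (int _ _ P' SB GB mGB (fun y => b1 _ _ P' (B n) y mBn) mSB)).
apply: normr_Rintegral_le => [|w]; last exact: ek.
apply: measurable_funB.
  by apply: (mGA _ _ (fun w => x + SB w)); exact: vmeasD (vmeas_cst _) mSB.
by apply: (mGB _ _ (fun w => x + SB w)); exact: vmeasD (vmeas_cst _) mSB.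
Qed.

End vector_valued.

(** * Gaussian moments *)

Section normal_moments.
Context (R : realType) (s : R).
Hypothesis s0 : 0 < s.
Local Notation mu := (@lebesgue_measure R).

Let sn0 : s != 0. Proof. by rewrite gt_eqF. Qed.

(* Layer cake: [f x] is the length of [[0, f x[], and Tonelli's theorem moves the
   computation to sets, where the density is known. *)
Lemma ge0_integral_normal_prob (f : R -> R) :
  measurable_fun [set: R] f -> (forall x, 0 <= f x) ->
  (\int[normal_prob 0 s]_x (f x)%:E =
   \int[mu]_x (f x * normal_pdf 0 s x)%:E)%E.
Proof.
move=> mf f0; pose S := [set z : measurableTypeR R * measurableTypeR R | 0 <= z.2 < f z.1].
have mS : measurable S.
  rewrite (_ : S = [set z | 0 <= z.2] `&` [set z | z.2 < f z.1]); last first.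
    by apply/seteqP; split => z /=; [move=> /andP|move=> [? ?]; apply/andP].
  apply: measurableI; rewrite -[X in measurable X]setTI.
    by apply: measurable_fun_ler => //; exact: measurable_snd.
  apply: (@measurable_fun_ltr _ _ _ setT snd (fun z => f z.1)) => //.
  by apply: (measurableT_comp mf); exact: measurable_fst.
have layer x : (\int[mu]_t (\1_S (x, t))%:E = (f x)%:E)%E.
  rewrite (_ : (fun t => _) = (fun t => (\1_(`[0%R, f x[%classic) t)%:E)); last first.
    by apply/funext => t; rewrite !indicE; congr (_ %:R%:E); apply/idP/idP; rewrite !inE /S /= in_itv.
  transitivity (mu `[0%R, f x[%classic); first by rewrite integral_indic// setIT.
  rewrite (@lebesgue_measure_itv R `[0%R, f x[) /= lte_fin.
  by case: ltP => fx; rewrite ?sube0//; congr (_%:E); apply/eqP; rewrite eq_le f0 fx.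
have mi : measurable_fun [set: measurableTypeR R * measurableTypeR R] (\1_S : _ -> R).
  exact: measurable_indic.
have mp := measurable_normal_pdf (0 : R) s.
have mS1 : measurable_fun [set: measurableTypeR R * measurableTypeR R] (fun z => (\1_S z : R)%:E).
  exact/measurable_EFinP.
have S0 (z : R * R) : (0 <= (\1_S z : R)%:E)%E by rewrite lee_fin.
under eq_integral do rewrite -layer.
rewrite (fubini_tonelli (m1 := normal_prob 0 s) (m2 := mu) _ mS1 S0).
transitivity (\int[mu]_t \int[mu]_x (\1_S (x, t) * normal_pdf 0 s x)%:E)%E.
  apply: eq_integral => t _; pose St := [set x : measurableTypeR R | S (x, t)].
  have mSt : measurable St.
    have := measurable_ysection t mS; congr (measurable _).
    by apply/seteqP; split => x; rewrite /ysection /= inE.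
  have E x : \1_S (x, t) = \1_St x :> R by [].
  under eq_integral do rewrite E.
  rewrite integral_indic// setIT.
  transitivity (\int[mu]_(x in St) (normal_pdf 0 s x)%:E)%E => //; rewrite integral_mkcond.
  apply: eq_integral => x _; rewrite patchE E indicE.
  by case: ifP => _; rewrite ?mul1r ?mul0r.
have mSp : measurable_fun [set: measurableTypeR R * measurableTypeR R] (fun z => (\1_S z * normal_pdf 0 s z.1)%:E).
  apply/measurable_EFinP; apply: measurable_funM => //.
  by apply: (measurableT_comp mp); exact: measurable_fst.
have Sp0 (z : R * R) : (0 <= (\1_S z * normal_pdf 0 s z.1)%:E :> \bar R)%E.
  by rewrite lee_fin mulr_ge0// normal_pdf_ge0.
rewrite -(fubini_tonelli (m1 := mu) (m2 := mu) _ mSp Sp0).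
apply: eq_integral => x _; under eq_integral do rewrite EFinM /=.
rewrite ge0_integralZr//=.
- by rewrite layer.
- by apply/measurable_EFinP; apply: (measurableT_comp mi); exact: measurable_pair1.
- by rewrite lee_fin normal_pdf_ge0.
Qed.

(* Completing the square turns the integrand into a multiple of another normal
   density; the same happens for [expR (h * x ^+ 2)].  All moments below are
   deduced from these two integrals. *)
Lemma normal_exp_linear (t : R) :
  (\int[normal_prob 0 s]_x (expR (t * x))%:E = (expR (t ^+ 2 * s ^+ 2 / 2))%:E)%E.
Proof.
rewrite ge0_integral_normal_prob//; last first.
  by apply: measurableT_comp => //; exact: measurable_funM.
under eq_integral => x _.
  rewrite (_ : _ * _ = expR (t ^+ 2 * s ^+ 2 / 2) * normal_pdf (t * s ^+ 2) s x).
    rewrite EFinM; over.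
  rewrite !normal_pdfE// /normal_fun mulrCA [RHS]mulrCA -!expRD.
  by congr (_ * expR _); rewrite -mulr_natr; field.
rewrite ge0_integralZl//.
- by rewrite integral_normal_pdf mule1.
- by apply/measurable_EFinP; exact: measurable_normal_pdf.
- by move=> x _; rewrite lee_fin; exact: normal_pdf_ge0.
Qed.

Lemma normal_exp_square (h : R) : 2 * h * s ^+ 2 < 1 ->
  (\int[normal_prob 0 s]_x (expR (h * x ^+ 2))%:E =
   ((Num.sqrt (1 - 2 * h * s ^+ 2))^-1)%:E)%E.
Proof.
move=> hs; set q := 1 - 2 * h * s ^+ 2.
have q0 : 0 < q by rewrite subr_gt0.
have sq0 : 0 < Num.sqrt q by rewrite sqrtr_gt0.
pose s' := s / Num.sqrt q.
have s'0 : s' != 0 by rewrite gt_eqF// divr_gt0.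
have s'2 : s' ^+ 2 = s ^+ 2 / q by rewrite expr_div_n sqr_sqrtr// ltW.
rewrite ge0_integral_normal_prob//; last first.
  by apply: measurableT_comp => //; exact: measurable_funM.
under eq_integral => x _.
  rewrite (_ : _ * _ = (Num.sqrt q)^-1 * normal_pdf 0 s' x).
    rewrite EFinM; over.
  rewrite !normal_pdfE// /normal_fun mulrCA -expRD mulrA; congr (_ * expR _).
    rewrite /normal_peak s'2.
    have -> : s ^+ 2 / q * pi *+ 2 = s ^+ 2 * pi *+ 2 / q.
      by rewrite mulrAC mulrnAl.
    rewrite [in RHS]sqrtrM; last by rewrite mulrn_wge0// mulr_ge0 ?sqr_ge0 ?pi_ge0.
    rewrite sqrtrV ?(ltW q0)// invfM invrK mulrCA mulVf ?gt_eqF// mulr1 //.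
  rewrite s'2 /q; have : q != 0 by rewrite gt_eqF.
  rewrite /q => qn0; rewrite subr0 -2!mulr_natr; field.
  by rewrite qn0 sn0.
rewrite ge0_integralZl//.
- by rewrite integral_normal_pdf mule1.
- by apply/measurable_EFinP; exact: measurable_normal_pdf.
- by move=> x _; rewrite lee_fin; exact: normal_pdf_ge0.
Qed.

End normal_moments.

Section gaussian_variable.
Context (R : realType) (s : R) (dO : measure_display) (O : measurableType dO)
  (P : probability O R) (Y : O -> R).
Hypothesis s0 : 0 < s.
Hypothesis mY : measurable_fun [set: O] Y.
Hypothesis YE : forall A : set (measurableTypeR R), measurable A ->
  P (Y @^-1` A) = normal_prob 0 s A.

Let transfer (f : R -> R) : measurable_fun [set: R] f ->
  (\int[P]_w (f (Y w))%:E = \int[normal_prob 0 s]_x (f x)%:E)%E.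
Proof.
move=> mf; have mYm : @measurable_fun _ _ O (measurableTypeR R) setT Y by [].
have mEf : @measurable_fun _ _ (measurableTypeR R) _ setT (EFin \o f).
  exact/measurable_EFinP.
rewrite -(integral_pushforwardE P mYm mEf).
by apply: eq_measure_integral => A mA _; exact: YE.
Qed.

Let mexp_lin t : measurable_fun [set: R] (fun x => expR (t * x)).
Proof. by apply: measurableT_comp => //; exact: measurable_funM. Qed.

Let mexp_sq h : measurable_fun [set: R] (fun x => expR (h * x ^+ 2)).
Proof.
by apply: measurableT_comp => //; exact: measurable_funM.
Qed.

Let int_exp (f : R -> R) c : measurable_fun [set: R] f ->
  (forall x, 0 <= f x) -> (\int[normal_prob 0 s]_x (f x)%:E = c%:E)%E ->
  P.-integrable [set: O] (EFin \o (f \o Y)) /\ \int[P]_w f (Y w) = c.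
Proof.
move=> mf f0 fc; split; last by rewrite /Rintegral transfer// fc.
apply/integrableP; split.
  by apply/measurable_EFinP; exact: measurableT_comp mY.
under eq_integral do rewrite /= ger0_norm//.
by rewrite transfer// fc ltry.
Qed.

(** Half of the critical exponent [1 / (2 * s ^+ 2)], from which on [expR (h * Y ^+ 2)] has infinite
    mean. *)
Let hs := (4 * s ^+ 2)^-1.
Let hs0 : 0 < hs. Proof. by rewrite invr_gt0 mulr_gt0// exprn_gt0. Qed.

Let exp_hs : P.-integrable [set: O] (EFin \o (fun w => expR (hs * Y w ^+ 2))) /\
  \int[P]_w expR (hs * Y w ^+ 2) = Num.sqrt 2.
Proof.
have E : 2 * hs * s ^+ 2 = 1 / 2 by rewrite /hs; field; rewrite gt_eqF.
have := int_exp (mexp_sq hs) (fun x => expR_ge0 _) (normal_exp_square s0 _).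
case; first by rewrite E; lra.
move=> ? ->; split => //; rewrite E (_ : 1 - 1 / 2 = 2^-1); last by field.
by rewrite sqrtrV// invrK.
Qed.

Lemma expR_ge_square (x : R) : 0 <= x -> x ^+ 2 / 4 <= expR x.
Proof.
move=> x0; have := expR_ge1Dx (x / 2).
have -> : expR x = expR (x / 2) ^+ 2.
  by rewrite expr2 -expRD; congr expR; field.
move=> e1; have : (x / 2) ^+ 2 <= expR (x / 2) ^+ 2.
  by rewrite lerXn2r ?nnegrE ?expR_ge0//; lra.
by rewrite expr_div_n (_ : 2 ^+ 2 = 4)//; ring.
Qed.

(** With [x = hs * Y w ^+ 2] one has [Y w ^+ 4 = 16 * s ^+ 4 * x ^+ 2], and
    [x ^+ 2 <= 4 * expR x]. *)
Let Y4_le w : Y w ^+ 4 <= 64 * s ^+ 4 * expR (hs * Y w ^+ 2).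
Proof.
have := expR_ge_square (x := hs * Y w ^+ 2).
rewrite mulr_ge0 ?(ltW hs0) ?sqr_ge0// => /(_ isT) e.
have -> : Y w ^+ 4 = 64 * s ^+ 4 * ((hs * Y w ^+ 2) ^+ 2 / 4).
  by rewrite /hs; field; rewrite gt_eqF.
by rewrite ler_wpM2l// mulr_ge0// exprn_ge0// ltW.
Qed.

Lemma gaussian_integrable4 :
  P.-integrable [set: O] (EFin \o (fun w => Y w ^+ 4)).
Proof.
have i1 := integrableZl measurableT (64 * s ^+ 4) exp_hs.1.
apply: le_integrable i1 => //.
  by apply/measurable_EFinP; exact: measurable_funX.
move=> w _ /=; rewrite lee_fin ger0_norm ?exprn_even_ge0//.
by rewrite (le_trans (Y4_le w))// ler_norm.
Qed.

(** A crude bound is enough (the exact value is [3 * s ^+ 4]): the mean of the exponential is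
    [Num.sqrt 2], which is at most 2. *)
Lemma gaussian_moment4 : \int[P]_w Y w ^+ 4 <= 128 * s ^+ 4.
Proof.
apply: (@le_trans _ _ (\int[P]_w (64 * s ^+ 4 * expR (hs * Y w ^+ 2)))).
  apply: le_Rintegral => //; first exact: gaussian_integrable4.
  exact: (integrableZl measurableT (64 * s ^+ 4) exp_hs.1).
rewrite RintegralZl//; last exact: exp_hs.1.
rewrite exp_hs.2; have : Num.sqrt (2 : R) <= 2.
  by rewrite -[leRHS]ger0_norm// -sqrtr_sqr ler_wsqrtr//; lra.
have : 0 <= s ^+ 4 by rewrite exprn_ge0// ltW.
nra.
Qed.

Lemma integrable_pow_le (m k : nat) (Z : O -> R) : (m <= k)%N ->
  measurable_fun [set: O] Z ->
  P.-integrable [set: O] (EFin \o (fun w => `|Z w| ^+ k)) ->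
  P.-integrable [set: O] (EFin \o (fun w => Z w ^+ m)).
Proof.
move=> mk mZ ik.
have c1 : P.-integrable [set: O] (EFin \o (fun=> 1 : R)).
  by apply: (@bounded_integrable _ _ _ _ _ 1) => // w; rewrite normr1.
have i1 := integrableD measurableT c1 ik.
apply: le_integrable i1 => //.
  by apply/measurable_EFinP; exact: measurable_funX.
move=> w _ /=; rewrite lee_fin normrX [leRHS]ger0_norm ?addr_ge0 ?exprn_ge0//.
have [z1|z1] := leP `|Z w| 1.
  by rewrite (le_trans (exprn_ile1 _ (normr_ge0 _) z1))// lerDl exprn_ge0.
by rewrite (le_trans (ler_weXn2l (ltW z1) mk))// lerDr.
Qed.

Lemma gaussian_integrable (m : nat) : (m <= 4)%N ->
  P.-integrable [set: O] (EFin \o (fun w => Y w ^+ m)).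
Proof.
move=> m4; apply: (integrable_pow_le m4 mY).
apply: eq_integrable gaussian_integrable4 => // w _ /=.
by rewrite -normrX ger0_norm// exprn_even_ge0.
Qed.

Let c1 : P.-integrable [set: O] (EFin \o (fun=> 1 : R)).
Proof. by apply: (@bounded_integrable _ _ _ _ _ 1) => // w; rewrite normr1. Qed.

(* [1 + t Y <= expR (t Y)], for both signs of a small [t]. *)
Lemma gaussian_mean : \int[P]_w Y w = 0.
Proof.
have iY : P.-integrable [set: O] (EFin \o Y) by exact: (gaussian_integrable (m := 1)).
have bnd (t : R) : 1 + t * \int[P]_w Y w <= expR (t ^+ 2 * s ^+ 2 / 2).
  have [ie <-] := int_exp (mexp_lin t) (fun x => expR_ge0 _) (normal_exp_linear s0 t).
  have itY : P.-integrable [set: O] (EFin \o (fun w => t * Y w)).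
    exact: (integrableZl measurableT t iY).
  rewrite -RintegralZl// -[X in X + _](Rintegral_cstT P) -(RintegralD measurableT c1 itY).
  apply: le_Rintegral => //; first exact: (integrableD measurableT c1 itY).
  by move=> w _; exact: expR_ge1Dx.
(* For [0 <= x <= 1/2], the inequality [expR x * (1 - x) <= 1] yields [expR x <= 1 + 2 * x], so the
   right-hand side becomes quadratic in [t]. *)
have bnd2 (t : R) : t ^+ 2 * s ^+ 2 <= 1 -> t * \int[P]_w Y w <= t ^+ 2 * s ^+ 2.
  move=> ts; have := bnd t; set x := t ^+ 2 * s ^+ 2 / 2.
  have x0 : 0 <= x by rewrite /x divr_ge0// mulr_ge0// sqr_ge0.
  have x1 : x <= 1 / 2 by rewrite /x; lra.
  have : expR x * (1 - x) <= 1.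
    have := expR_ge1Dx (- x); have := expR_gt0 x.
    have : expR x * expR (- x) = 1 by rewrite -expRD subrr expR0.
    nra.
  have := expR_gt0 x; rewrite (_ : t ^+ 2 * s ^+ 2 = 2 * x); last by rewrite /x; field.
  nra.
set m := \int[P]_w Y w.
have s2 : 0 < s ^+ 2 by rewrite exprn_gt0.
apply/eqP; rewrite -normr_le0; apply/ler_addgt0Pl => e e0; rewrite addr0.
(* The first bound makes [t * s ^+ 2 <= e], the second keeps [t] in the range of [bnd2]. *)
pose t := Num.min (e / s ^+ 2) s^-1.
have t0 : 0 < t by rewrite lt_min divr_gt0// invr_gt0.
have ts : t ^+ 2 * s ^+ 2 <= 1.
  rewrite -exprMn expr_le1 ?mulr_ge0 ?(ltW t0) ?(ltW s0)//.
  by rewrite -ler_pdivlMr// div1r ge_min lexx orbT.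
have te : t * s ^+ 2 <= e by rewrite -ler_pdivlMr// ge_min lexx.
have := bnd2 t ts; have := bnd2 (- t); rewrite sqrrN => /(_ ts).
rewrite ler_norml -/m; nra.
Qed.

(* [1 + h Y^2 <= expR (h Y^2)], for both signs of a small [h]. *)
Lemma gaussian_variance : \int[P]_w Y w ^+ 2 = s ^+ 2.
Proof.
have iY : P.-integrable [set: O] (EFin \o (fun w => Y w ^+ 2)).
  exact: gaussian_integrable.
set v := \int[P]_w Y w ^+ 2.
have s2 : 0 < s ^+ 2 by rewrite exprn_gt0.
have bnd (h : R) : `|2 * h * s ^+ 2| <= 1 / 2 -> h * v <= h * s ^+ 2 + 4 * h ^+ 2 * s ^+ 4.
  move=> hs2; have hs1 : 2 * h * s ^+ 2 < 1 by have := ler_norm (2 * h * s ^+ 2); lra.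
  have [ie ieE] := int_exp (mexp_sq h) (fun x => expR_ge0 _) (normal_exp_square s0 hs1).
  have : 1 + h * v <= (Num.sqrt (1 - 2 * h * s ^+ 2))^-1.
    have ihY : P.-integrable [set: O] (EFin \o (fun w => h * Y w ^+ 2)).
      exact: (integrableZl measurableT h iY).
    rewrite -ieE /v -RintegralZl// -[X in X + _](Rintegral_cstT P) -(RintegralD measurableT c1 ihY).
    apply: le_Rintegral => //; first exact: (integrableD measurableT c1 ihY).
    by move=> w _; exact: expR_ge1Dx.
  have -> : 4 * h ^+ 2 * s ^+ 4 = (2 * h * s ^+ 2) ^+ 2 by ring.
  have -> : h * s ^+ 2 = (2 * h * s ^+ 2) / 2 by field.
  move: (2 * h * s ^+ 2) hs1 hs2 => u u1; rewrite ler_norml => /andP[ul ur] /le_trans H.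
  (* A second-order upper bound valid for [|u| <= 1/2], proved below by squaring. *)
  suff : (Num.sqrt (1 - u))^-1 <= 1 + u / 2 + u ^+ 2 by move=> /H; lra.
  have q0 : 0 < Num.sqrt (1 - u) by rewrite sqrtr_gt0; lra.
  rewrite -div1r ler_pdivrMr//.
  have p0 : 0 <= 1 + u / 2 + u ^+ 2 by have := sqr_ge0 u; lra.
  have -> : 1 + u / 2 + u ^+ 2 = Num.sqrt ((1 + u / 2 + u ^+ 2) ^+ 2) by rewrite sqrtr_sqr ger0_norm.
  rewrite -sqrtrM ?sqr_ge0// -[leLHS]sqrtr1 ler_wsqrtr//.
  have -> : (1 + u / 2 + u ^+ 2) ^+ 2 * (1 - u) = 1 + u ^+ 2 * (5/4 * (1 - u) - u ^+ 3) by field.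
  rewrite lerDl mulr_ge0 ?sqr_ge0//.
  have : u ^+ 3 <= 1 / 4.
    have := sqr_ge0 u; have : u ^+ 2 <= 1 / 4 by rewrite expr2; nra.
    rewrite exprSr; nra.
  lra.
suff : `|v - s ^+ 2| <= 0 by rewrite normr_le0 subr_eq0 => /eqP.
apply/ler_addgt0Pl => e e0; rewrite addr0.
have s4 : 0 < s ^+ 4 by rewrite exprn_gt0.
pose h := Num.min (e / (4 * s ^+ 4)) hs.
have h0 : 0 < h by rewrite lt_min divr_gt0// mulr_gt0.
have h1 : 4 * h * s ^+ 4 <= e.
  by rewrite mulrAC mulrC -ler_pdivlMr ?mulr_gt0// ge_min lexx.
have hh : `|2 * h * s ^+ 2| <= 1 / 2.
  rewrite ger0_norm; last first.
    by apply: mulr_ge0; [apply: mulr_ge0 => //; exact: ltW|exact: ltW].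
  have : h <= hs by rewrite ge_min lexx orbT.
  have : 4 * hs * s ^+ 2 = 1 by rewrite /hs; field; rewrite gt_eqF.
  nra.
have := bnd h hh; have := bnd (- h); rewrite mulrN mulNr normrN => /(_ hh).
rewrite sqrrN ler_norml => H1 H2.
have K1 : h * (v - s ^+ 2) <= h * e by nra.
have K2 : h * - e <= h * (v - s ^+ 2) by nra.
by rewrite !ler_pM2l// in K1 K2; rewrite K1 K2.
Qed.

End gaussian_variable.

(** * Central limit comparison and weak law *)

Lemma continuous_borel_measurable (R : realType) (T : ptopologicalType)
    (f : T -> R) : continuous f -> measurable_fun [set: borel T] f.
Proof.
move=> /continuousP cf; apply: (measurability _ (RGenOpens.measurableE R)).
move=> _ [_ [a [b ->]] <-]; rewrite setTI; apply: sub_sigma_algebra.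
by apply: cf; exact: interval_open.
Qed.

Lemma borel_measurable_entry (R : realType) (m n : nat) (dO : measure_display)
    (O : measurableType dO) (f : O -> 'M[R]_(m, n)) i j :
  borel_measurable f -> measurable_fun [set: O] (fun w => f w i j).
Proof.
move=> mf; have me : measurable_fun [set: borel 'M[R]_(m, n)] (fun x : 'M[R]_(m, n) => x i j).
  by apply: (@continuous_borel_measurable R 'M[R]_(m, n)); exact: coord_continuous.
exact: (measurableT_comp me mf).
Qed.

Section sums.
Context (dO : measure_display) (O : measurableType dO) (R : realType)
  (P : probability O R).

Lemma integrable_Rsum (I : Type) (r : seq I) (F : I -> O -> R) :
  (forall i, P.-integrable [set: O] (EFin \o F i)) ->
  P.-integrable [set: O] (EFin \o (fun w => \sum_(i <- r) F i w)).
Proof.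
move=> iF; elim: r => [|i r IH].
  by under eq_fun do rewrite big_nil; exact: integrable0.
under [X in EFin \o X]eq_fun do rewrite big_cons.
exact: (integrableD measurableT (iF i) IH).
Qed.

Lemma Rintegral_sum (I : Type) (r : seq I) (F : I -> O -> R) :
  (forall i, P.-integrable [set: O] (EFin \o F i)) ->
  \int[P]_w (\sum_(i <- r) F i w) = \sum_(i <- r) \int[P]_w F i w.
Proof.
move=> iF; elim: r => [|i r IH].
  by under eq_Rintegral do rewrite big_nil; rewrite big_nil Rintegral_cstT.
under eq_Rintegral do rewrite big_cons.
by rewrite big_cons -IH (RintegralD measurableT (iF i) (integrable_Rsum r iF)).
Qed.

Lemma le_integrable_fun (f g : O -> R) : measurable_fun [set: O] f ->
  (forall w, `|f w| <= g w) -> P.-integrable [set: O] (EFin \o g) ->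
  P.-integrable [set: O] (EFin \o f).
Proof.
move=> mf fg ig; apply: le_integrable ig => //; first exact/measurable_EFinP.
by move=> w _ /=; rewrite lee_fin (le_trans (fg w))// ler_norm.
Qed.

Lemma integrable_scale (a : R) (f : O -> R) :
  P.-integrable [set: O] (EFin \o f) ->
  P.-integrable [set: O] (EFin \o (fun w => a * f w)).
Proof. by move=> hf; exact: (integrableZl measurableT a hf). Qed.

Lemma measurable_integrable (f : O -> R) : 
  P.-integrable [set: O] (EFin \o f) -> measurable_fun [set: O] f.
Proof. by move=> /integrableP[/measurable_EFinP]. Qed.
End sums.

Section square_integrable.
Context (R : realType) (d : nat).
Implicit Types z : 'rV[R]_d.

(** The size of the error in [jet_global]: cubic near 0 and quadratic at infinity. *)
Definition rho z : R := norm1 z ^+ 2 * Num.min 1 (norm1 z).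

Lemma rho_ge0 z : 0 <= rho z.
Proof. by rewrite mulr_ge0 ?sqr_ge0// le_min ler01 norm1_ge0. Qed.

Lemma rho_le2 z : rho z <= norm1 z ^+ 2.
Proof. by rewrite ler_piMr ?sqr_ge0// ge_min lexx. Qed.

Lemma rho_le3 z : rho z <= norm1 z ^+ 3.
Proof. by rewrite exprSr ler_wpM2l ?sqr_ge0// ge_min lexx orbT. Qed.

Lemma norm1_sqr_le z : norm1 z ^+ 2 <= d%:R * \sum_i z 0 i ^+ 2.
Proof.
rewrite expr2 norm1M; apply: (@le_trans _ _
    (\sum_i \sum_j (z 0 i ^+ 2 / 2 + z 0 j ^+ 2 / 2))).
  apply: ler_sum => i _; apply: ler_sum => j _.
  have := sqr_ge0 (`|z 0 i| - `|z 0 j|).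
  rewrite sqrrB !real_normK ?num_real//.
  have := mulr2n (`|z 0 i| * `|z 0 j|) => ->; lra.
under eq_bigr do rewrite big_split/= sumr_const card_ord.
rewrite big_split/= sumr_const card_ord sumrMnl -!mulr_suml -mulrnDl -splitr.
by rewrite mulr_natl.
Qed.

Context (dO : measure_display) (O : measurableType dO) (P : probability O R).

Definition sqint (Z : O -> 'rV[R]_d) : Prop :=
  forall i, measurable_fun [set: O] (fun w => Z w 0 i) /\
    P.-integrable [set: O] (EFin \o (fun w => Z w 0 i ^+ 2)).

Variable Z : O -> 'rV[R]_d.
Hypothesis sZ : sqint Z.

Lemma measurable_norm1 : measurable_fun [set: O] (fun w => norm1 (Z w)).
Proof.
apply: measurable_sum => i; apply: measurableT_comp => //.
exact: (sZ i).1.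
Qed.

Lemma measurable_rho : measurable_fun [set: O] (fun w => rho (Z w)).
Proof.
apply: measurable_funM; first exact/measurable_funX/measurable_norm1.
by apply: measurable_minr => //; exact: measurable_norm1.
Qed.

Lemma integrable_entryM i j :
  P.-integrable [set: O] (EFin \o (fun w => Z w 0 i * Z w 0 j)).
Proof.
have [mi ii] := sZ i; have [mj ij] := sZ j.
apply: (le_integrable_fun (g := fun w => Z w 0 i ^+ 2 + Z w 0 j ^+ 2)).
- exact: measurable_funM.
- move=> w; rewrite normrM -[X in _ <= X + _]real_normK ?num_real//.
  rewrite -[X in _ <= _ + X]real_normK ?num_real//.
  have := sqr_ge0 (`|Z w 0 i| - `|Z w 0 j|); have := sqr_ge0 (`|Z w 0 i| + `|Z w 0 j|).
  by rewrite sqrrB sqrrD !mulr2n; lra.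
- exact: (integrableD measurableT ii ij).
Qed.

Lemma integrable_entry i : P.-integrable [set: O] (EFin \o (fun w => Z w 0 i)).
Proof.
have [mi ii] := sZ i; apply: (integrable_pow_le (m := 1) (k := 2)) => //.
apply: eq_integrable ii => // w _ /=.
by rewrite real_normK ?num_real.
Qed.

Lemma integrable_norm1_sqr :
  P.-integrable [set: O] (EFin \o (fun w => norm1 (Z w) ^+ 2)).
Proof.
apply: (le_integrable_fun (g := fun w => d%:R * \sum_i Z w 0 i ^+ 2)).
- exact/measurable_funX/measurable_norm1.
- by move=> w; rewrite ger0_norm ?sqr_ge0// norm1_sqr_le.
- by apply: integrable_scale; apply: integrable_Rsum => i; exact: (sZ i).2.
Qed.

Lemma integrable_rho : P.-integrable [set: O] (EFin \o (fun w => rho (Z w))).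
Proof.
apply: (le_integrable_fun _ _ integrable_norm1_sqr); first exact: measurable_rho.
by move=> w; rewrite ger0_norm ?rho_ge0 ?rho_le2.
Qed.

Lemma Rintegral_lin l :
  P.-integrable [set: O] (EFin \o (fun w => lin l (Z w))) /\
  \int[P]_w lin l (Z w) = \sum_i l i * \int[P]_w Z w 0 i.
Proof.
have il i := integrable_scale (l i) (integrable_entry i).
split; first exact: integrable_Rsum.
rewrite Rintegral_sum//; apply: eq_bigr => i _.
by rewrite RintegralZl//; exact: integrable_entry.
Qed.

Lemma Rintegral_quad h :
  P.-integrable [set: O] (EFin \o (fun w => quad h (Z w))) /\
  \int[P]_w quad h (Z w) = \sum_i \sum_j h i j * \int[P]_w (Z w 0 i * Z w 0 j).
Proof.
have ih i j := integrable_scale (h i j) (integrable_entryM i j).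
split; first by apply: integrable_Rsum => i; exact: integrable_Rsum.
rewrite Rintegral_sum//; last by move=> i; exact: integrable_Rsum.
apply: eq_bigr => i _; rewrite Rintegral_sum//; apply: eq_bigr => j _.
by rewrite RintegralZl//; exact: integrable_entryM.
Qed.

Lemma jet_mean (k : 'rV[R]_d -> R) (c D : R) l h :
  measurable_fun [set: O] (k \o Z) -> (forall z, `|k z| <= 1) ->
  (forall z, `|k z - (c + lin l z + quad h z)| <= D * rho z) ->
  `|\int[P]_w k (Z w) - (c + \sum_i l i * \int[P]_w Z w 0 i +
     \sum_i \sum_j h i j * \int[P]_w (Z w 0 i * Z w 0 j))| <=
  D * \int[P]_w rho (Z w).
Proof.
move=> mk k1 kD; have [il <-] := Rintegral_lin l; have [ih <-] := Rintegral_quad h.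
have ic : P.-integrable [set: O] (EFin \o (fun=> c)).
  by apply: (@bounded_integrable _ _ _ _ _ `|c|).
have ik : P.-integrable [set: O] (EFin \o (fun w => k (Z w))).
  by apply: (@bounded_integrable _ _ _ _ _ 1).
have icl := integrableD measurableT ic il.
have iclh := integrableD measurableT icl ih.
rewrite -[X in X + _ + _](Rintegral_cstT P).
rewrite -(RintegralD measurableT ic il) -(RintegralD measurableT icl ih).
rewrite -(RintegralB measurableT ik iclh) -RintegralZl//; last exact: integrable_rho.
have iB := integrableB measurableT ik iclh.
apply: (le_trans (le_normr_Rintegral measurableT iB)).
apply: le_Rintegral => //.
- exact: (integrable_norm iB).
- exact: integrable_scale integrable_rho.
Qed.

End square_integrable.

(** Equal first and second moments make the polynomial parts cancel; only the two remainders
    survive. *)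
Lemma jet_compare (R : realType) (d : nat) (d1 d2 : measure_display)
    (T1 : measurableType d1) (T2 : measurableType d2) (P : probability T1 R)
    (P' : probability T2 R) (Z : T1 -> 'rV[R]_d) (Z' : T2 -> 'rV[R]_d)
    (k : 'rV[R]_d -> R) (C : R) :
  sqint P Z -> sqint P' Z' ->
  (forall i, \int[P]_w Z w 0 i = \int[P']_w Z' w 0 i) ->
  (forall i j, \int[P]_w (Z w 0 i * Z w 0 j) = \int[P']_w (Z' w 0 i * Z' w 0 j)) ->
  jet C k -> (forall z, `|k z| <= 1) ->
  measurable_fun [set: T1] (k \o Z) -> measurable_fun [set: T2] (k \o Z') ->
  `|\int[P]_w k (Z w) - \int[P']_w k (Z' w)| <=
    (1 + 3 * C) * (\int[P]_w rho (Z w) + \int[P']_w rho (Z' w)).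
Proof.
move=> sZ sZ' E1 E2 jk k1 mk mk'.
have [l [h [_ _ kD]]] := jet_global jk k1.
have H := jet_mean sZ mk k1 kD; have H' := jet_mean sZ' mk' k1 kD.
rewrite mulrDr.
have El : \sum_i l i * \int[P]_w Z w 0 i = \sum_i l i * \int[P']_w Z' w 0 i.
  by apply: eq_bigr => i _; rewrite E1.
have Eh : \sum_i \sum_j h i j * \int[P]_w (Z w 0 i * Z w 0 j) =
    \sum_i \sum_j h i j * \int[P']_w (Z' w 0 i * Z' w 0 j).
  by apply: eq_bigr => i _; apply: eq_bigr => j _; rewrite E2.
rewrite El Eh in H.
set m := k 0 + _ + _ in H H'.
rewrite -[X in `|X - _|](subrK m) -addrA (le_trans (ler_normD _ _))// lerD//.
by rewrite distrC.
Qed.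

(** The counterpart of [jet_compare] for the replacement by 0: the quadratic part has nothing to
    cancel with and joins the error, hence [4 * C] for [3 * C]. *)
Lemma jet_second_order (R : realType) (d : nat) (d1 : measure_display)
    (T1 : measurableType d1) (P : probability T1 R) (Z : T1 -> 'rV[R]_d)
    (k : 'rV[R]_d -> R) (C : R) :
  sqint P Z -> (forall i, \int[P]_w Z w 0 i = 0) ->
  jet C k -> (forall z, `|k z| <= 1) -> measurable_fun [set: T1] (k \o Z) ->
  `|\int[P]_w k (Z w) - k 0| <= (1 + 4 * C) * \int[P]_w norm1 (Z w) ^+ 2.
Proof.
move=> sZ E1 jk k1 mk; have C0 := jet_ge0 jk.
have [l [h [_ hC kD]]] := jet_global jk k1.
have [il ilE] := Rintegral_lin sZ l.
have ic : P.-integrable [set: T1] (EFin \o (fun=> k 0)).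
  by apply: (@bounded_integrable _ _ _ _ _ `|k 0|).
have ik : P.-integrable [set: T1] (EFin \o (fun w => k (Z w))).
  by apply: (@bounded_integrable _ _ _ _ _ 1).
have icl := integrableD measurableT ic il.
have iB := integrableB measurableT ik icl.
have -> : k 0 = \int[P]_w (k 0 + lin l (Z w)).
  rewrite (RintegralD measurableT ic il) Rintegral_cstT ilE big1 ?addr0// => i _.
  by rewrite E1 mulr0.
rewrite -(RintegralB measurableT ik icl) -RintegralZl//; last exact: integrable_norm1_sqr.
apply: (le_trans (le_normr_Rintegral measurableT iB)).
apply: le_Rintegral => //.
- exact: (integrable_norm iB).
- exact: integrable_scale (integrable_norm1_sqr sZ).
- move=> w _; have := kD (Z w); have := quad_le (Z w) hC; have := rho_le2 (Z w).
  rewrite -/(rho _) => r2 qC kw.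
  have -> : k (Z w) - (k 0 + lin l (Z w)) =
    (k (Z w) - (k 0 + lin l (Z w) + quad h (Z w))) + quad h (Z w) by ring.
  rewrite (le_trans (ler_normD _ _))//.
  have : (1 + 3 * C) * rho (Z w) <= (1 + 3 * C) * norm1 (Z w) ^+ 2.
    by rewrite ler_wpM2l//; lra.
  lra.
Qed.

Section step_test.
Context (R : realType) (d J : nat) (a b : R).

Lemma measurable_cub : measurable_fun [set: R] (@cub R).
Proof. by apply: measurable_funX; exact: measurable_maxr. Qed.

Lemma measurable_step (dT : measure_display) (T : measurableType dT) (f : T -> R) :
  measurable_fun [set: T] f -> (forall w, 0 <= f w) ->
  measurable_fun [set: T] (fun w => step a b (f w)).
Proof.
move=> mf f0; apply: (measurableT_comp measurable_cub).
apply: measurable_funB => //; apply: (measurableT_comp measurable_cub).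
apply: measurable_funB => //; apply: measurable_funM => //.
(* The inverse as an exponential of a logarithm, legitimate because [1 + f w] is positive. *)
have -> : (fun w => (1 + f w)^-1) = (fun w => expR (- ln (1 + f w))).
  by apply/funext => w; rewrite expRN lnK// posrE; have := f0 w; lra.
apply: measurableT_comp => //; apply: measurableT_comp => //; apply: (measurableT_comp (@measurable_ln R)).
exact: measurable_funD.
Qed.

Lemma measurable_sqn (dT : measure_display) (T : measurableType dT)
    (A : T -> 'M[R]_(J, d)) j : vmeas A ->
  measurable_fun [set: T] (fun w => sqn (row j (A w))).
Proof.
move=> mA; apply: measurable_sum => i; apply: measurable_funX.
rewrite (_ : (fun _ => _) = (fun w => A w j i)); first exact: mA.
by apply/funext => w; rewrite mxE.
Qed.

Lemma mtest_step_prod : mtest (@step_prod R d J a b).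
Proof.
move=> dT T A mA; apply: measurable_prod => j _.
by apply: measurable_step => [|w]; [exact: measurable_sqn|exact: sqn_ge0].
Qed.
End step_test.

Lemma vmeas_mul (R : realType) (J d : nat) (dT : measure_display)
    (T : measurableType dT) (s : 'cV[R]_J) (Z : T -> 'rV[R]_d) :
  (forall i, measurable_fun [set: T] (fun w => Z w 0 i)) ->
  vmeas (fun w => s *m Z w).
Proof.
move=> mZ i j; under eq_fun do rewrite mxE big_ord1.
exact: measurable_funM.
Qed.

(** The map [e] lets the sequence be drawn from a family with another index type. As [e k] differs
    from all earlier indices, the finite index sets [K] and [L] are disjoint. Both orders are
    recorded, one for each side of [lindeberg]. *)
Lemma indep_vectors_family (R : realType) (J d : nat) (I : choiceType)
    (dO dT : measure_display) (O : measurableType dO) (T : measurableType dT)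
    (P : probability O R) (X : I -> O -> T) (e : nat -> I)
    (F : nat -> T -> 'M[R]_(J, d)) (k : nat) :
  (forall i, measurable_fun [set: O] (X i)) -> mutually_independent P X ->
  (forall i, vmeas (F i)) -> (forall i, (i < k)%N -> e i != e k) ->
  let A i w := F i (X (e i) w) in
  indep_vectors P (A k) (fun w => \sum_(i < k) A i w) /\
  indep_vectors P (fun w => \sum_(i < k) A i w) (A k).
Proof.
move=> mX iX mF ek A.
pose K := [fset e k]%fset; pose L := [fset x in [seq e i | i <- iota 0 k]]%fset.
have dKL : [disjoint K & L]%fset.
  apply/fdisjointP => x; rewrite !inE => /eqP ->; apply/mapP => -[i].
  by rewrite mem_iota/= add0n => ik /eqP; rewrite eq_sym (negbTE (ek i ik)).
have dLK : [disjoint L & K]%fset by rewrite fdisjoint_sym.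
have mK : vmeas (A k : g_sigma_algebraType (cylinders X K) -> _).
  apply: (vmeas_comp (T1 := g_sigma_algebraType (cylinders X K)) (f := X (e k)) _ (mF k)).
  by apply: measurable_cylinders; rewrite // inE.
have mL : vmeas ((fun w => \sum_(i < k) A i w) : g_sigma_algebraType (cylinders X L) -> _).
  apply: (vmeas_sum (T := g_sigma_algebraType (cylinders X L))) => i ik.
  apply: (vmeas_comp (T1 := g_sigma_algebraType (cylinders X L)) (f := X (e i)) _ (mF i)).
  apply: measurable_cylinders => //; rewrite inE/=; apply/mapP.
  by exists i; rewrite // mem_iota.
split.
- apply: (indep_vectors_sigma _ _ _ mK mL); try exact: sub_sigma_cylinders.
  by move=> C D cC cD; exact: (independent_sigma_cylinders mX iX dKL).
- apply: (indep_vectors_sigma _ _ _ mL mK); try exact: sub_sigma_cylinders.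
  by move=> C D cC cD; exact: (independent_sigma_cylinders mX iX dLK).
Qed.

Lemma Rintegral_dominated_cvg (dO : measure_display) (O : measurableType dO)
    (R : realType) (P : probability O R) (f_ : nat -> O -> R) (f g : O -> R) :
  (forall n, measurable_fun [set: O] (f_ n)) -> measurable_fun [set: O] f ->
  (forall w, f_ ^~ w @ \oo --> f w) ->
  (forall n w, `|f_ n w| <= g w) -> P.-integrable [set: O] (EFin \o g) ->
  (fun n => \int[P]_w f_ n w) @ \oo --> \int[P]_w f w.
Proof.
move=> mf_ mf ff fg ig.
have [] := @dominated_convergence _ _ _ P setT measurableT
  (fun n => EFin \o f_ n) (EFin \o f) (EFin \o g).
- by move=> n; exact/measurable_EFinP.
- exact/measurable_EFinP.
- by apply: aeW => w _; apply: cvg_EFin; [exact: nearW|exact: ff].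
- by [].
- by apply: aeW => w n _ /=; rewrite lee_fin.
move=> iF _ cF; rewrite /Rintegral; apply: fine_cvg.
by rewrite fineK//; exact: integrable_fin_num.
Qed.

Section step_probability.
Context (R : realType) (d J : nat) (dO : measure_display) (O : measurableType dO)
  (P : probability O R) (a b : R) (A : O -> 'M[R]_(J, d)).
Hypotheses (a0 : 0 <= a) (ab : a < b) (mA : vmeas A).

Lemma measurable_all_sqn_le c :
  measurable [set w | forall j, sqn (row j (A w)) <= c].
Proof.
rewrite (_ : [set _ | _] = \bigcap_(j in [set: 'I_J]) [set w | sqn (row j (A w)) <= c]).
  apply: fin_bigcap_measurable => // j _.
  rewrite (_ : [set _ | _] = (fun w => sqn (row j (A w))) @^-1` `]-oo, c]).
    by rewrite -[_ @^-1` _]setTI; exact: measurable_sqn.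
  by apply/seteqP; split=> w /=; rewrite in_itv.
by apply/seteqP; split=> w /= H j; [move=> _|]; exact: H.
Qed.

Lemma integrable_step_prod : P.-integrable [set: O] (EFin \o (fun w => step_prod a b (A w))).
Proof.
apply: (@bounded_integrable _ _ _ _ _ 1).
  exact: (@mtest_step_prod R d J a b).
by move=> w; exact: step_prod_norm_le1.
Qed.

Lemma prob_le_step :
  fine (P [set w | forall j, sqn (row j (A w)) <= a]) <=
  \int[P]_w step_prod a b (A w).
Proof.
have mS := measurable_all_sqn_le a; rewrite -Rintegral_indicator//.
apply: le_Rintegral => //.
- apply: (@bounded_integrable _ _ _ _ _ 1); first exact: measurable_indic.
  by move=> w; rewrite indicE; case: (_ \in _); rewrite ?normr1 ?normr0.
- exact: integrable_step_prod.
move=> w _; rewrite indicE; case: (boolP (w \in _)) => [|_]; last exact: step_prod_ge0.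
rewrite inE/= => H; rewrite /step_prod big1// => j _.
by rewrite step1// ?sqn_ge0.
Qed.

Lemma step_le_prob :
  \int[P]_w step_prod a b (A w) <=
  fine (P [set w | forall j, sqn (row j (A w)) <= b]).
Proof.
have mS := measurable_all_sqn_le b; rewrite -Rintegral_indicator//.
apply: le_Rintegral => //.
- exact: integrable_step_prod.
- apply: (@bounded_integrable _ _ _ _ _ 1); first exact: measurable_indic.
  by move=> w; rewrite indicE; case: (_ \in _); rewrite ?normr1 ?normr0.
move=> w _; rewrite indicE; case: (boolP (w \in _)) => [_|]; first exact: step_prod_le1.
rewrite notin_setE/= => /existsNP[j /negP]; rewrite -ltNge => /ltW bj.
by rewrite /step_prod (bigD1 j)//= step0// mul0r.
Qed.
End step_probability.

Section scaling.
Context (R : realType) (d : nat).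
Implicit Types z : 'rV[R]_d.

Lemma norm1Z (c : R) z : norm1 (c *: z) = `|c| * norm1 z.
Proof. by rewrite mulr_sumr; apply: eq_bigr => i _; rewrite mxE normrM. Qed.

Lemma sqnZ (c : R) z : sqn (c *: z) = c ^+ 2 * sqn z.
Proof. by rewrite mulr_sumr; apply: eq_bigr => i _; rewrite mxE exprMn. Qed.

Lemma sqint_scale (dO : measure_display) (O : measurableType dO)
    (P : probability O R) (Z : O -> 'rV[R]_d) (c : R) :
  sqint P Z -> sqint P (fun w => c *: Z w).
Proof.
move=> sZ i; have [mi ii] := sZ i; split.
  by under eq_fun do rewrite mxE; exact: measurable_funM.
by under [X in EFin \o X]eq_fun do rewrite mxE exprMn; exact: integrable_scale.
Qed.

End scaling.

(* Lindeberg's condition for i.i.d. summands: this tends to 0 for [c = n^(-1/2)]. *)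
Definition trunc_moment (R : realType) (d : nat) (dO : measure_display)
    (O : measurableType dO) (P : probability O R) (Z : O -> 'rV[R]_d) (c : R) : R :=
  \int[P]_w (norm1 (Z w) ^+ 2 * Num.min 1 (c * norm1 (Z w))).

Lemma invsqrt_cvg0 (R : realType) : (Num.sqrt (n%:R : R))^-1 @[n --> \oo] --> (0 : R).
Proof.
apply/cvgrPdist_le => e e0; near=> n.
rewrite sub0r normrN ger0_norm ?invr_ge0 ?sqrtr_ge0//.
have n0 : (0 < n%:R :> R).
  by rewrite ltr0n; near: n; exists 1%N.
rewrite -[leRHS]invrK lef_pV2 ?posrE ?invr_gt0 ?sqrtr_gt0//.
rewrite -[leLHS]ger0_norm ?invr_ge0 ?(ltW e0)// -sqrtr_sqr ler_wsqrtr//.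
near: n; exact: nbhs_infty_ger.
Unshelve. all: by end_near. Qed.

Lemma trunc_moment_cvg0 (R : realType) (d : nat) (dO : measure_display)
    (O : measurableType dO) (P : probability O R) (Z : O -> 'rV[R]_d) :
  sqint P Z -> trunc_moment P Z (Num.sqrt n%:R)^-1 @[n --> \oo] --> (0 : R).
Proof.
move=> sZ; rewrite -[X in _ --> X](Rintegral_cstT P 0).
apply: (Rintegral_dominated_cvg (g := fun w => norm1 (Z w) ^+ 2)) => //.
- move=> n; apply: measurable_funM.
    exact/measurable_funX/(measurable_norm1 sZ).
  by apply: measurable_minr => //; apply: measurable_funM => //; exact: measurable_norm1 sZ.
- move=> w; rewrite -(mulr0 (norm1 (Z w) ^+ 2)); apply: cvgM; first exact: cvg_cst.
  apply: (@squeeze_cvgr _ _ _ _ (fun=> 0) (fun n => (Num.sqrt n%:R)^-1 * norm1 (Z w))).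
  + near=> n; rewrite le_min ler01 mulr_ge0 ?invr_ge0 ?sqrtr_ge0 ?norm1_ge0//=.
    by rewrite ge_min lexx orbT.
  + exact: cvg_cst.
  + rewrite -(mul0r (norm1 (Z w))); apply: cvgM; last exact: cvg_cst.
    exact: invsqrt_cvg0.
- move=> n w; rewrite normrM ger0_norm ?sqr_ge0// ler_piMr ?sqr_ge0// ger0_norm.
    by rewrite ge_min lexx.
  by rewrite le_min ler01 mulr_ge0// ?invr_ge0 ?sqrtr_ge0 ?norm1_ge0.
- exact: integrable_norm1_sqr sZ.
Unshelve. all: by end_near. Qed.

Lemma Rintegral_rho_scale (R : realType) (d : nat) (dO : measure_display)
    (O : measurableType dO) (P : probability O R) (Z : O -> 'rV[R]_d) (c : R) :
  sqint P Z -> 0 <= c ->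
  \int[P]_w rho (c *: Z w) = c ^+ 2 * trunc_moment P Z c.
Proof.
move=> sZ c0; rewrite /trunc_moment -RintegralZl//.
  by apply: eq_Rintegral => w _; rewrite /rho norm1Z ger0_norm// exprMn mulrA.
apply: (le_integrable_fun _ _ (integrable_norm1_sqr sZ)).
  apply: measurable_funM; first exact/measurable_funX/(measurable_norm1 sZ).
  by apply: measurable_minr => //; apply: measurable_funM => //; exact: measurable_norm1 sZ.
move=> w; rewrite normrM ger0_norm ?sqr_ge0// ler_piMr ?sqr_ge0// ger0_norm.
  by rewrite ge_min lexx.
by rewrite le_min ler01 mulr_ge0// norm1_ge0.
Qed.

(** Quantified over all weights, so that one fact about the sequence serves every system of linear
    combinations. The variants [_l] and [_r] differ in the order of integration; [lindeberg] takes
    one on each side. *)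
Definition adapted_indep_l (R : realType) (d : nat) (dO : measure_display)
    (O : measurableType dO) (P : probability O R) (n : nat)
    (z : nat -> O -> 'rV[R]_d) : Prop :=
  forall J (s : nat -> 'cV[R]_J) k, (k < n)%N ->
    indep_vectors P (fun w => s k *m z k w) (fun w => \sum_(i < k) s i *m z i w).

Definition adapted_indep_r (R : realType) (d : nat) (dO : measure_display)
    (O : measurableType dO) (P : probability O R) (n : nat)
    (z : nat -> O -> 'rV[R]_d) : Prop :=
  forall J (s : nat -> 'cV[R]_J) k, (k < n)%N ->
    indep_vectors P (fun w => \sum_(i < k) s i *m z i w) (fun w => s k *m z k w).

Definition centered_with_cov (R : realType) (d : nat) (dO : measure_display)
    (O : measurableType dO) (P : probability O R) (v : R)
    (Z : O -> 'rV[R]_d) : Prop :=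
  [/\ sqint P Z, forall i, \int[P]_w Z w 0 i = 0 &
      forall i j, \int[P]_w (Z w 0 i * Z w 0 j) = v *+ (i == j)].

Lemma centered_scale (R : realType) (d : nat) (dO : measure_display)
    (O : measurableType dO) (P : probability O R) (v c : R) (Z : O -> 'rV[R]_d) :
  centered_with_cov P v Z -> centered_with_cov P (c ^+ 2 * v) (fun w => c *: Z w).
Proof.
move=> [sZ EZ CZ]; split; first exact: sqint_scale.
- move=> i; under eq_Rintegral do rewrite mxE.
  by rewrite RintegralZl ?EZ ?mulr0//; exact: (integrable_entry sZ i).
- move=> i j; rewrite (eq_Rintegral _ (g := fun w => c ^+ 2 * (Z w 0 i * Z w 0 j))).
    by rewrite RintegralZl ?CZ ?mulrnAr//; exact: (integrable_entryM sZ i j).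
  by move=> w _; rewrite !mxE; ring.
Qed.

(** Each of the [n] exchanges costs a multiple of [e]. The sum stays small when [e] is of smaller
    order than [1 / n], which Lindeberg's condition provides for summands scaled by [n^(-1/2)]. *)
Lemma clt_comparison (R : realType) (d J : nat) (d1 d2 : measure_display)
    (T1 : measurableType d1) (T2 : measurableType d2) (P : probability T1 R)
    (P' : probability T2 R) (n : nat) (z : nat -> T1 -> 'rV[R]_d)
    (y : nat -> T2 -> 'rV[R]_d) (v e a b : R) (s : nat -> 'cV[R]_J) :
  (forall k, (k < n)%N -> centered_with_cov P v (z k)) ->
  (forall k, (k < n)%N -> centered_with_cov P' v (y k)) ->
  (forall k, (k < n)%N -> \int[P]_w rho (z k w) + \int[P']_w rho (y k w) <= e) ->
  adapted_indep_l P n z -> adapted_indep_r P' n y ->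
  (forall k j, `|s k j 0| <= 1) ->
  `|\int[P]_w step_prod a b (\sum_(k < n) s k *m z k w) -
    \int[P']_w step_prod a b (\sum_(k < n) s k *m y k w)| <=
  n%:R * ((1 + 3 * @jet_prod_bound R J a b) * e).
Proof.
move=> cz cy re iz iy s1.
set D := (1 + 3 * _).
(* A jet is exhibited only to learn that its constant is nonnegative. *)
have jb := jet_ge0 (@jet_step_prod R d J a b 0 (s 0%N) (s1 0%N)).
have D0 : 0 <= D by rewrite /D; lra.
have mz k i : (k < n)%N -> measurable_fun [set: T1] (fun w => z k w 0 i).
  by move=> /cz[/(_ i)[]].
have my k i : (k < n)%N -> measurable_fun [set: T2] (fun w => y k w 0 i).
  by move=> /cy[/(_ i)[]].
have mAz k : (k < n)%N -> vmeas (fun w => s k *m z k w).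
  by move=> kn; apply: vmeas_mul => i; exact: mz.
have mAy k : (k < n)%N -> vmeas (fun w => s k *m y k w).
  by move=> kn; apply: vmeas_mul => i; exact: my.
have mg := @mtest_step_prod R d J a b.
have := lindeberg (e := fun=> D * e) mAz mAy (fun k => iz J s k) (fun k => iy J s k)
   mg (@step_prod_norm_le1 R d J a b) _ 0.
rewrite sumr_const card_ord -[_ *+ n]mulr_natl.
have -> : \int[P]_w step_prod a b (0 + \sum_(k < n) s k *m z k w) =
    \int[P]_w step_prod a b (\sum_(k < n) s k *m z k w).
  by apply: eq_Rintegral => w _; rewrite add0r.
have -> : \int[P']_w step_prod a b (0 + \sum_(k < n) s k *m y k w) =
    \int[P']_w step_prod a b (\sum_(k < n) s k *m y k w).
  by apply: eq_Rintegral => w _; rewrite add0r.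
apply=> k kn x.
have [sz Ez Cz] := cz k kn; have [sy Ey Cy] := cy k kn.
apply: (le_trans (jet_compare (k := fun u => step_prod a b (x + s k *m u)) sz sy _ _
  (jet_step_prod a b x (s1 k)) _ _ _)).
- by move=> i; rewrite Ez Ey.
- by move=> i j; rewrite Cz Cy.
- by move=> u; exact: step_prod_norm_le1.
- by apply: (mg _ _ (fun w => x + s k *m z k w)); exact: vmeasD (vmeas_cst _) (mAz k kn).
- by apply: (mg _ _ (fun w => x + s k *m y k w)); exact: vmeasD (vmeas_cst _) (mAy k kn).
- by rewrite ler_wpM2l// re.
Qed.

(* Lindeberg's replacement by the zero variable. *)
Lemma sum_tail (R : realType) (d : nat) (d1 : measure_display)
    (T1 : measurableType d1) (P : probability T1 R) (n : nat)
    (A : nat -> T1 -> 'M[R]_(1, d)) (b : R) (e : nat -> R) :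
  0 < b -> (forall k, (k < n)%N -> vmeas (A k)) ->
  (forall k, (k < n)%N -> indep_vectors P (A k) (fun w => \sum_(i < k) A i w)) ->
  (forall k, (k < n)%N -> forall x,
    `|\int[P]_w step_prod 0 b (x + A k w) - step_prod 0 b x| <= e k) ->
  fine (P [set w | b < sqn (row 0 (\sum_(k < n) A k w))]) <= \sum_(k < n) e k.
Proof.
move=> b0 mA iA ek; have mg := @mtest_step_prod R d 1 0 b.
have mS := measurable_all_sqn_le (vmeas_sum mA) b.
have g0 : step_prod 0 b (0 : 'M[R]_(1, d)) = 1.
  rewrite /step_prod big_ord1 step1//.
  - exact: sqn_ge0.
  - by rewrite /sqn big1// => j _; rewrite !mxE expr0n.
have := lindeberg (B := fun (k : nat) (w : T1) => 0 : 'M[R]_(1, d)) (P' := P)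
  (e := e) mA _ iA _ mg (@step_prod_norm_le1 R d 1 0 b) _ 0.
have -> : \int[P]_w step_prod 0 b (0 + \sum_(k < n) A k w) =
    \int[P]_w step_prod 0 b (\sum_(k < n) A k w).
  by apply: eq_Rintegral => w _; rewrite add0r.
have -> : \int[P]_w step_prod 0 b (0 + \sum_(k < n) 0 : 'M[R]_(1, d)) = 1.
  by under eq_Rintegral do rewrite big1// addr0 g0; exact: Rintegral_cstT.
move=> H; have {}H : `|\int[P]_w step_prod 0 b (\sum_(k < n) A k w) - 1| <= \sum_(k < n) e k.
  apply: H.
  - by move=> k _; exact: vmeas_cst.
  - by move=> k _; exact: indep_vectors0r.
  - move=> k kn x.
    have -> : \int[P]_w step_prod 0 b (x + 0) = step_prod 0 b x.
      by under eq_Rintegral do rewrite addr0; exact: Rintegral_cstT.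
    exact: ek.
have -> : [set w | b < sqn (row 0 (\sum_(k < n) A k w))] =
    ~` [set w | forall j, sqn (row j (\sum_(k < n) A k w)) <= b].
  apply/seteqP; split=> w /=.
    by move=> bA /(_ 0); rewrite leNgt bA.
  by move=> /existsNP[j]; rewrite ord1 => /negP; rewrite -ltNge.
rewrite fine_probabilityC//.
have := step_le_prob P (lexx 0) b0 (vmeas_sum mA).
move: H; rewrite ler_norml => /andP[]; lra.
Qed.

(** A substitute for Chebyshev's inequality, linear in the number of summands and in their second
    moment. The independence at hand concerns initial segments, so the sum starts at 0 with weights
    that vanish below [i]. *)
Lemma partial_sum_tail (R : realType) (d : nat) (d1 : measure_display)
    (T1 : measurableType d1) (P : probability T1 R) (i l : nat)
    (z : nat -> T1 -> 'rV[R]_d) (v b m2 : R) :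
  (i <= l)%N -> 0 < b ->
  (forall k, (k < l)%N -> centered_with_cov P v (z k)) ->
  (forall k, (k < l)%N -> \int[P]_w norm1 (z k w) ^+ 2 <= m2) ->
  adapted_indep_l P l z ->
  fine (P [set w | b < sqn (\sum_(i <= k < l) z k w)]) <=
  (l - i)%:R * ((1 + 4 * @jet_prod_bound R 1 0 b) * m2).
Proof.
move=> il b0 cz m2z iz; set D := (1 + 4 * _) * m2.
pose s (k : nat) : 'cV[R]_1 := (i <= k)%N%:R *: const_mx 1.
have s1 k j : `|s k j 0| <= 1.
  by rewrite !mxE mulr1 normr_nat; case: (i <= k)%N; rewrite ?lexx ?ler01.
have mz k j : (k < l)%N -> measurable_fun [set: T1] (fun w => z k w 0 j).
  by move=> /cz[/(_ j)[]].
have mAz k : (k < l)%N -> vmeas (fun w => s k *m z k w).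
  by move=> kn; apply: vmeas_mul => j; exact: mz.
have rowA w : row 0 (\sum_(k < l) s k *m z k w) = \sum_(i <= k < l) z k w.
  rewrite -(big_mkord xpredT (fun k => s k *m z k w)) (big_cat_nat (leq0n i) il)//=.
  rewrite big_nat big1 ?add0r => [|k /andP[_ ki]]; last first.
    by rewrite /s leqNgt ki/= scale0r mul0mx.
  apply/rowP => j; rewrite mxE !summxE; apply: eq_big_nat => k /andP[ik _].
  by rewrite !mxE big_ord1 !mxE ik !mul1r.
have DE : \sum_(k < l) (i <= k)%N%:R * D = (l - i)%:R * D.
  rewrite -mulr_suml -(big_mkord xpredT (fun k => (i <= k)%N%:R : R)).
  rewrite (big_cat_nat (leq0n i) il)//= big_nat big1 ?add0r => [|k /andP[_ ki]]; last first.
    by rewrite leqNgt ki.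
  congr (_ * _); rewrite big_nat (eq_bigr (fun=> 1)) => [|k /andP[-> _]//].
  by rewrite -big_nat sumr_const_nat.
have -> : [set w | b < sqn (\sum_(i <= k < l) z k w)] =
    [set w | b < sqn (row 0 (\sum_(k < l) s k *m z k w))].
  by apply/seteqP; split=> w /=; rewrite rowA.
rewrite -DE; apply: (sum_tail (A := fun k w => s k *m z k w)
  (e := fun k => (i <= k)%N%:R * D)) => // [k kl|k kl x].
  exact: iz.
case: (leqP i k) => ik; last first.
  rewrite mul0r; under eq_Rintegral do rewrite /s leqNgt ik/= scale0r mul0mx addr0.
  by rewrite Rintegral_cstT subrr normr0.
have [sz Ez Cz] := cz k kl.
have jk := jet_step_prod 0 b x (s1 k).
have := jet_second_order sz Ez jk _ _.
rewrite mulmx0 addr0 mul1r => /(_ (fun u => step_prod_norm_le1 _ _ _)) H1.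
apply: (le_trans (H1 _)).
  apply: (@mtest_step_prod R d 1 0 b _ _ (fun w => x + s k *m z k w)).
  exact: vmeasD (vmeas_cst _) (mAz k kl).
by rewrite ler_wpM2l ?m2z//; have := jet_ge0 jk; lra.
Qed.

(** * Replacement by 0 at first order, and the weak law *)

Section first_order.
Context (R : realType) (d : nat) (dO : measure_display)
  (O : measurableType dO) (P : probability O R).

(** Near 0 the quadratic part joins the remainder; far away [|k z|] and [|k 0|] are at most 1,
    whence the 2. The error grows only linearly, so first moments control its mean. *)
Lemma jet_first_order (C : R) (k : 'rV[R]_d -> R) : jet C k ->
  (forall z, `|k z| <= 1) -> exists l, forall z,
   `|k z - (k 0 + lin l z)| <= (2 + 4 * C) * (norm1 z * Num.min 1 (norm1 z)).
Proof.
move=> jk k1; have C0 := jet_ge0 jk.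
have [l [h [lC hC kD]]] := jet_global jk k1; exists l => z.
have := kD z; have := quad_le z hC; have := lin_le z lC.
have := k1 z; have := k1 0; have t0 := norm1_ge0 z.
have [t1|t1] := leP (norm1 z) 1.
  move=> _ _ _ q r.
  have -> : k z - (k 0 + lin l z) = (k z - (k 0 + lin l z + quad h z)) + quad h z by ring.
  rewrite (le_trans (ler_normD _ _))//.
  have : norm1 z ^+ 2 * norm1 z <= norm1 z * norm1 z by rewrite expr2 ler_piMr// mulr_ge0.
  move: r q; rewrite expr2; have := mulr_ge0 t0 t0; nra.
move=> k0 kz L _ _; rewrite mulr1.
have := ler_normB (k z) (k 0 + lin l z); have := ler_normD (k 0) (lin l z).
nra.
Qed.

(** The first-moment analogue of [trunc_moment]; it is used with [c = 1 / n]. *)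
Definition trunc_mean (Y : O -> 'rV[R]_d) (c : R) : R :=
  \int[P]_w (norm1 (Y w) * Num.min 1 (c * norm1 (Y w))).

Variable Y : O -> 'rV[R]_d.
Hypothesis iY : forall i, P.-integrable [set: O] (EFin \o (fun w => Y w 0 i)).

Lemma integrable_norm1 : P.-integrable [set: O] (EFin \o (fun w => norm1 (Y w))).
Proof. by apply: integrable_Rsum => i; exact: (integrable_norm (iY i)). Qed.

Let mtm (c : R) : measurable_fun [set: O] (fun w => norm1 (Y w) * Num.min 1 (c * norm1 (Y w))).
Proof.
have mn := measurable_integrable integrable_norm1.
by apply: measurable_funM => //; apply: measurable_minr => //; exact: measurable_funM.
Qed.

Let min_norm (c : R) w : 0 <= c -> `|norm1 (Y w) * Num.min 1 (c * norm1 (Y w))| <= norm1 (Y w).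
Proof.
move=> c0; rewrite normrM ger0_norm ?norm1_ge0// ler_piMr ?norm1_ge0// ger0_norm.
  by rewrite ge_min lexx.
by rewrite le_min ler01 mulr_ge0// norm1_ge0.
Qed.

Lemma trunc_mean_cvg0 : trunc_mean Y n%:R^-1 @[n --> \oo] --> (0 : R).
Proof.
rewrite -[X in _ --> X](Rintegral_cstT P 0).
apply: (Rintegral_dominated_cvg (g := fun w => norm1 (Y w))) => //.
- move=> w; rewrite -(mulr0 (norm1 (Y w))); apply: cvgM; first exact: cvg_cst.
  apply: (@squeeze_cvgr _ _ _ _ (fun=> 0) (fun n => n%:R^-1 * norm1 (Y w))).
  + near=> n; rewrite le_min ler01 mulr_ge0 ?invr_ge0 ?norm1_ge0//=.
    by rewrite ge_min lexx orbT.
  + exact: cvg_cst.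
  + rewrite -(mul0r (norm1 (Y w))); apply: cvgM; last exact: cvg_cst.
    by apply/gtr0_cvgV0; [near=> n; rewrite ltr0n; near: n; exists 1%N|exact: cvgr_idn].
- by move=> n w; rewrite min_norm.
- exact: integrable_norm1.
Unshelve. all: by end_near. Qed.

Lemma jet_first_order_mean (C c : R) (k : 'rV[R]_d -> R) : jet C k -> 0 <= c ->
  (forall z, `|k z| <= 1) -> (forall i, \int[P]_w Y w 0 i = 0) ->
  measurable_fun [set: O] (fun w => k (c *: Y w)) ->
  `|\int[P]_w k (c *: Y w) - k 0| <= (2 + 4 * C) * (c * trunc_mean Y c).
Proof.
move=> jk c0 k1 EY mk; have C0 := jet_ge0 jk.
have [l kl] := jet_first_order jk k1.
have il : P.-integrable [set: O] (EFin \o (fun w => lin l (c *: Y w))).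
  apply: (eq_integrable measurableT (EFin \o (fun w => \sum_i (l i * c) * Y w 0 i))).
    by move=> w _ /=; congr EFin; apply: eq_bigr => i _; rewrite mxE mulrA.
  by apply: integrable_Rsum => i; apply: integrable_scale; exact: iY.
have ilE : \int[P]_w lin l (c *: Y w) = 0.
  rewrite Rintegral_sum => [|i]; last first.
    apply: (eq_integrable measurableT (EFin \o (fun w => (l i * c) * Y w 0 i))).
      by move=> w _ /=; rewrite mxE mulrA.
    by apply: integrable_scale; exact: iY.
  apply: big1 => i _; rewrite (eq_Rintegral _ (g := fun w => (l i * c) * Y w 0 i)).
    by rewrite RintegralZl ?EY ?mulr0//; exact: iY.
  by move=> w _; rewrite mxE mulrA.
have ic : P.-integrable [set: O] (EFin \o (fun=> k 0)).
  by apply: (@bounded_integrable _ _ _ _ _ `|k 0|).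
have ik : P.-integrable [set: O] (EFin \o (fun w => k (c *: Y w))).
  by apply: (@bounded_integrable _ _ _ _ _ 1).
have icl := integrableD measurableT ic il.
have iB := integrableB measurableT ik icl.
have itm : P.-integrable [set: O] (EFin \o (fun w => norm1 (Y w) * Num.min 1 (c * norm1 (Y w)))).
  exact: le_integrable_fun (mtm c) (fun w => min_norm w c0) integrable_norm1.
have -> : k 0 = \int[P]_w (k 0 + lin l (c *: Y w)).
  by rewrite (RintegralD measurableT ic il) Rintegral_cstT ilE addr0.
rewrite -(RintegralB measurableT ik icl) mulrA -RintegralZl//.
apply: (le_trans (le_normr_Rintegral measurableT iB)).
apply: le_Rintegral => //.
- exact: (integrable_norm iB).
- exact: integrable_scale itm.
- move=> w _; apply: (le_trans (kl _)); rewrite norm1Z ger0_norm//.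
  by rewrite -!mulrA.
Qed.

End first_order.

(** With [c = 1 / n] the factor [n * c] is 1 and the bound is a multiple of [e]. First moments
    suffice, which matters for the empirical covariance: products of two entries are merely
    integrable. *)
Lemma weak_law_tail (R : realType) (d : nat) (d1 : measure_display)
    (T1 : measurableType d1) (P : probability T1 R) (n : nat)
    (y : nat -> T1 -> 'rV[R]_d) (b c e : R) :
  0 < b -> 0 <= c ->
  (forall k i, (k < n)%N -> P.-integrable [set: T1] (EFin \o (fun w => y k w 0 i))) ->
  (forall k i, (k < n)%N -> \int[P]_w y k w 0 i = 0) ->
  (forall k, (k < n)%N -> trunc_mean P (y k) c <= e) ->
  adapted_indep_l P n y ->
  fine (P [set w | b < sqn (c *: \sum_(k < n) y k w)]) <=
  n%:R * ((2 + 4 * @jet_prod_bound R 1 0 b) * (c * e)).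
Proof.
move=> b0 c0 iy Ey ye indy; set D := 2 + 4 * _.
pose s (k : nat) : 'cV[R]_1 := const_mx c; pose s1 : 'cV[R]_1 := const_mx 1.
have s11 j : `|s1 j 0| <= 1 by rewrite !mxE normr1.
have sE k w : s k *m y k w = s1 *m (c *: y k w).
  by apply/matrixP => i j; rewrite !mxE !big_ord1 !mxE mul1r.
have my k i : (k < n)%N -> measurable_fun [set: T1] (fun w => y k w 0 i).
  by move=> kn; exact: measurable_integrable (iy k i kn).
have mA k : (k < n)%N -> vmeas (fun w => s k *m y k w).
  by move=> kn; apply: vmeas_mul => j; exact: my.
have rowA w : row 0 (\sum_(k < n) s k *m y k w) = c *: \sum_(k < n) y k w.
  apply/rowP => j; rewrite !mxE !summxE mulr_sumr; apply: eq_bigr => k _.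
  by rewrite !mxE big_ord1 !mxE.
have -> : [set w | b < sqn (c *: \sum_(k < n) y k w)] =
    [set w | b < sqn (row 0 (\sum_(k < n) s k *m y k w))].
  by apply/seteqP; split=> w /=; rewrite rowA.
have -> : n%:R * (D * (c * e)) = \sum_(k < n) D * (c * e).
  by rewrite sumr_const card_ord mulr_natl.
apply: (sum_tail (A := fun k w => s k *m y k w)
  (e := fun=> D * (c * e))) => // [k kn|k kn x].
  exact: indy.
have jk := jet_step_prod 0 b x s11.
have := jet_first_order_mean (iy k ^~ kn) jk c0 (fun u => step_prod_norm_le1 _ _ _)
  (Ey k ^~ kn) _.
rewrite mulmx0 addr0.
rewrite (eq_Rintegral _ (g := fun w => step_prod 0 b (x + s k *m y k w))); last first.
  by move=> w _; rewrite sE.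
move=> H; apply: (le_trans (H _)).
  rewrite (_ : (fun _ => _) = (fun w => step_prod 0 b (x + s k *m y k w))); last first.
    by apply/funext => w; rewrite sE.
  apply: (@mtest_step_prod R d 1 0 b _ _ (fun w => x + s k *m y k w)).
  exact: vmeasD (vmeas_cst _) (mA k kn).
have := jet_ge0 jk => D0.
by rewrite ler_wpM2l ?ler_wpM2l ?ye// /D; lra.
Qed.

(** * Ottaviani's inequality *)

Section euclidean_norm.
Context (R : realType) (d : nat).
Implicit Types x y : 'rV[R]_d.

Lemma enormE x : enorm x = Num.sqrt (sqn x). Proof. by []. Qed.

Lemma enorm_ge0 x : 0 <= enorm x. Proof. exact: sqrtr_ge0. Qed.

Lemma sqr_enorm x : enorm x ^+ 2 = sqn x.
Proof. by rewrite sqr_sqrtr ?sqn_ge0. Qed.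

Definition dot x y : R := \sum_i x 0 i * y 0 i.

(** Lagrange's identity: twice the difference of the two sides is the sum of the squared 2 by 2
    minors over ordered pairs of indices. *)
Lemma Cauchy_Schwarz x y : dot x y ^+ 2 <= sqn x * sqn y.
Proof.
have : 0 <= \sum_i \sum_j (x 0 i * y 0 j - x 0 j * y 0 i) ^+ 2.
  by apply: sumr_ge0 => i _; apply: sumr_ge0 => j _; exact: sqr_ge0.
have -> : \sum_i \sum_j (x 0 i * y 0 j - x 0 j * y 0 i) ^+ 2 =
    2 * (sqn x * sqn y - dot x y ^+ 2); last by rewrite pmulr_rge0 // subr_ge0.
have E1 : sqn x * sqn y = \sum_i \sum_j x 0 i ^+ 2 * y 0 j ^+ 2.
  by rewrite mulr_suml; apply: eq_bigr => i _; rewrite mulr_sumr.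
have E2 : sqn x * sqn y = \sum_i \sum_j x 0 j ^+ 2 * y 0 i ^+ 2.
  by rewrite E1 exchange_big.
have E3 : dot x y ^+ 2 = \sum_i \sum_j (x 0 i * y 0 i) * (x 0 j * y 0 j).
  by rewrite expr2 mulr_suml; apply: eq_bigr => i _; rewrite mulr_sumr.
rewrite mulrBr mulr_natl mulr2n {1}E1 E2 E3 -big_split mulr_sumr -sumrB /=.
apply: eq_bigr => i _.
rewrite mulr_sumr -big_split -sumrB/=; apply: eq_bigr => j _; ring.
Qed.

Lemma enormD x y : enorm (x + y) <= enorm x + enorm y.
Proof.
rewrite -[leRHS]ger0_norm ?addr_ge0 ?enorm_ge0// -sqrtr_sqr ler_wsqrtr//.
have -> : \sum_(i < d) (x + y) 0 i ^+ 2 = sqn x + sqn y + 2 * dot x y.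
  rewrite /sqn /dot mulr_sumr -!big_split; apply: eq_bigr => i _.
  by rewrite mxE/=; ring.
suff : dot x y <= enorm x * enorm y.
  by rewrite sqrrD !sqr_enorm -mulr_natl; lra.
rewrite (le_trans (ler_norm _))// -sqrtr_sqr /enorm -sqrtrM ?sqn_ge0//.
by rewrite ler_wsqrtr// Cauchy_Schwarz.
Qed.

Lemma enormZ (c : R) x : enorm (c *: x) = `|c| * enorm x.
Proof. by rewrite !enormE sqnZ sqrtrM ?sqr_ge0// sqrtr_sqr. Qed.

Lemma enormN x : enorm (- x) = enorm x.
Proof. by rewrite -scaleN1r enormZ normrN1 mul1r. Qed.

Lemma enormB x y : enorm x - enorm y <= enorm (x - y).
Proof. by rewrite lerBlDr -{1}[x](subrK y) enormD. Qed.

Lemma enorm_le_sqn x (c : R) : 0 <= c -> (enorm x <= c) = (sqn x <= c ^+ 2).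
Proof.
by move=> c0; rewrite -(ler_pXn2r (n := 2))// ?nnegrE ?enorm_ge0// sqr_enorm.
Qed.

Lemma enorm_gt_sqn x (c : R) : 0 <= c -> (c < enorm x) = (c ^+ 2 < sqn x).
Proof. by move=> c0; rewrite !ltNge enorm_le_sqn. Qed.

Lemma measurable_enorm (dT : measure_display) (T : measurableType dT)
    (A : T -> 'rV[R]_d) : vmeas A -> measurable_fun [set: T] (fun w => enorm (A w)).
Proof.
move=> mA; apply: (measurableT_comp (continuous_measurable_fun (@sqrt_continuous R))).
by apply: measurable_sum => i; apply: measurable_funX; exact: mA.
Qed.
End euclidean_norm.

Lemma vmeas_sum_nat (R : realType) (J d : nat) (dT : measure_display)
    (T : measurableType dT) (A : nat -> T -> 'M[R]_(J, d)) i l :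
  (forall k, (i <= k < l)%N -> vmeas (A k)) ->
  vmeas (fun w => \sum_(i <= k < l) A k w).
Proof.
move=> mA; rewrite (_ : (fun w => _) = (fun w => \sum_(k < l) (if (i <= k)%N then A k w else 0))).
  apply: (vmeas_sum (A := fun k w => if (i <= k)%N then A k w else 0)) => k kl.
  by case: (boolP (i <= k)%N) => ik; [apply: mA; rewrite ik|exact: vmeas_cst].
apply/funext => w; rewrite -(big_mkord xpredT (fun k => if (i <= k)%N then A k w else 0)).
case: (leqP i l) => il; last first.
  rewrite [LHS]big_geq ?(ltnW il)//; apply/esym; rewrite big_nat.
  by apply: big1 => k /andP[_ kl]; rewrite leqNgt (ltn_trans kl il).
have E0 : \sum_(0 <= k < i) (if (i <= k)%N then A k w else 0) = 0.
  by rewrite big_nat; apply: big1 => k /andP[_ ki]; rewrite leqNgt ki.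
rewrite (big_cat_nat (leq0n i) il)/= E0 add0r.
by apply: eq_big_nat => k /andP[-> _].
Qed.

Section Ottaviani.
Context (R : realType) (d : nat) (dO dT : measure_display)
  (O : measurableType dO) (T : measurableType dT) (P : probability O R)
  (X : nat -> O -> T) (F : nat -> T -> 'rV[R]_d).
Hypotheses (mX : forall k, measurable_fun [set: O] (X k))
  (iX : mutually_independent P X) (mF : forall k, vmeas (F k)).

Let z k w := F k (X k w).
Let S i l w : 'rV[R]_d := \sum_(i <= k < l) z k w.

Lemma measurable_enorm_sum i l (c : R) :
  measurable [set w | c < enorm (S i l w)].
Proof.
rewrite (_ : [set _ | _] = (fun w => enorm (S i l w)) @^-1` `]c, +oo[).
  rewrite -[_ @^-1` _]setTI; apply: measurable_enorm => //.
  by apply: vmeas_sum_nat => k _; exact: vmeas_comp (mX k) (mF k).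
by apply/seteqP; split=> w /=; rewrite in_itv/= andbT.
Qed.

Lemma sigma_enorm_sum (J : {fset nat}) i l (c : R) :
  (forall k, (i <= k < l)%N -> k \in J) ->
  <<s cylinders X J >> [set w | c < enorm (S i l w)].
Proof.
move=> kJ; pose TJ := g_sigma_algebraType (cylinders X J).
rewrite (_ : [set _ | _] = (fun w => enorm (S i l w)) @^-1` `]c, +oo[); last first.
  by apply/seteqP; split=> w /=; rewrite in_itv/= andbT.
have mS : measurable_fun [set: TJ] (fun w : TJ => enorm (S i l w)).
  apply: (measurable_enorm (T := TJ)); apply: (vmeas_sum_nat (T := TJ)) => k ikl.
  apply: (vmeas_comp (T1 := TJ) (f := X k) _ (mF k)).
  by apply: measurable_cylinders; exact: kJ.
have := mS measurableT [set` `]c, +oo[] (measurable_itv _).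
by rewrite setTI.
Qed.

(* The events that [k] is the first index with [2 c < |S i k|] are disjoint, and on
   each of them, with conditional probability at least 1/2, [|S k l| <= c] and so
   [c < |S i l|]. *)
Lemma Ottaviani_inequality i l (c : R) : (i <= l)%N -> 0 <= c ->
  (forall k, (i <= k <= l)%N -> fine (P [set w | c < enorm (S k l w)]) <= 1 / 2) ->
  fine (P [set w | exists2 k, (i <= k <= l)%N & 2 * c < enorm (S i k w)]) <=
  2 * fine (P [set w | c < enorm (S i l w)]).
Proof.
move=> il c0 half.
pose E k := [set w | (i <= k)%N /\ 2 * c < enorm (S i k w)].
have EE k : E k = if (i <= k)%N then [set w | 2 * c < enorm (S i k w)] else set0.
  rewrite /E; case: (leqP i k) => ik; apply/seteqP; split=> w //=.
    by case.
  by case.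
have mE k : measurable (E k).
  by rewrite EE; case: ifP => // _; exact: measurable_enorm_sum.
(* The indices before [k] and those from [k] on. The event [seqDU E k], that [k] is the first index,
   depends on the former, the event [G k] below on the latter. *)
pose L k := [fset x in iota 0 k]%fset; pose U k := [fset x in iota k (l - k)]%fset.
have LU k : [disjoint L k & U k]%fset.
  by apply/fdisjointP => x; rewrite !inE !mem_iota add0n /= => xk; apply/negP; lia.
have sE k j : (j <= k)%N -> <<s cylinders X (L k) >> (E j).
  move=> jk; rewrite EE; case: ifP => _; last exact: sigma_algebra0.
  by apply: sigma_enorm_sum => x; rewrite inE mem_iota /=; lia.
have sDE k : <<s cylinders X (L k) >> (seqDU E k).
  rewrite /seqDU.
  apply: (@measurableD _ (g_sigma_algebraType (cylinders X (L k)))); first exact: sE.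
  apply: (@bigsetU_measurable _ (g_sigma_algebraType (cylinders X (L k)))) => j _.
  by apply: sE; exact: ltnW.
have mDE k : measurable (seqDU E k) by exact: sub_sigma_cylinders (sDE k).
pose G k := ~` [set w | c < enorm (S k l w)].
have mG k : measurable (G k) by apply/measurableC; exact: measurable_enorm_sum.
have sG k : (k <= l)%N -> <<s cylinders X (U k) >> (G k).
  move=> kl; apply: (@measurableC _ (g_sigma_algebraType (cylinders X (U k)))).
  by apply: sigma_enorm_sum => x; rewrite inE mem_iota /=; lia.
have PDG k : (i <= k < l.+1)%N ->
    fine (P (seqDU E k)) <= 2 * fine (P (seqDU E k `&` G k)).
  move=> ikl; have kl : (k <= l)%N by lia.
  rewrite (independent_sigma_cylinders mX iX (LU k) (sDE k) (sG k kl)).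
  rewrite fineM ?fin_num_measure// fine_probabilityC//; last exact: measurable_enorm_sum.
  have : fine (P [set w | c < enorm (S k l w)]) <= 1 / 2 by apply: half; lia.
  have : 0 <= fine (P (seqDU E k)) by rewrite fine_ge0.
  nra.
have -> : [set w | exists2 k, (i <= k <= l)%N & 2 * c < enorm (S i k w)] =
    \big[setU/set0]_(k < l.+1) E k.
  rewrite -bigcup_mkord; apply/seteqP; split=> [w /= [k ikl ck]|w [k /= kl [ik ck]]].
    by exists k => /=; [lia|split; [lia|]].
  by exists k => //; lia.
rewrite bigsetU_seqDU measure_semi_additive_ord//; last 2 first.
- by apply/trivIsetP => k k' _ _ kk'; move/trivIsetP : (trivIset_seqDU E); apply.
- by apply: bigsetU_measurable.
have fsum (H : nat -> set O) : (forall k, measurable (H k)) ->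
    fine (\sum_(k < l.+1) P (H k))%E = \sum_(k < l.+1) fine (P (H k)).
  by move=> mH; rewrite -sum_fine// => k _; exact: fin_num_measure.
rewrite fsum//.
apply: (@le_trans _ _ (2 * \sum_(k < l.+1) fine (P (seqDU E k `&` G k)))).
  rewrite mulr_sumr; apply: ler_sum => -[k kl] _ /=.
  case: (leqP i k) => ik; first by apply: PDG; rewrite ik.
  have -> : seqDU E k = set0.
    by apply/seteqP; split=> w // [[]]; rewrite leqNgt ik.
  by rewrite set0I !measure0/= mulr0.
apply: ler_wpM2l => //.
rewrite -(fsum (fun k => seqDU E k `&` G k)); last by move=> k; exact: measurableI.
have mU : measurable (\big[setU/set0]_(k < l.+1) (seqDU E k `&` G k)).
  by apply: bigsetU_measurable => k _; exact: measurableI.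
have <- : P (\big[setU/set0]_(k < l.+1) (seqDU E k `&` G k)) =
    (\sum_(k < l.+1) P (seqDU E k `&` G k))%E.
  apply: measure_semi_additive_ord => // [k|]; first exact: measurableI.
  move=> k k' _ _ [w [[wk _] [wk' _]]]; apply/val_inj.
  by apply: (trivIset_seqDU E k k') => //; exists w.
apply: fine_probability_le.
- by apply: bigsetU_measurable => k _; exact: measurableI.
- exact: measurable_enorm_sum.
rewrite -(bigcup_mkord l.+1 (fun k => seqDU E k `&` G k)) => w [k /= kl [[[ik ck] _]]] /= /negP; rewrite -leNgt => Gk.
have := enormB (S i k w) (- S k l w); rewrite opprK enormN.
have -> : S i k w + S k l w = S i l w by rewrite /S -big_cat_nat.
lra.
Qed.

End Ottaviani.

(** * Brownian motion *)

(** Heine's theorem by contradiction: pairs of points at distance at most [1 / n] whose values stay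
    more than [e] apart have, by Bolzano-Weierstrass, a subsequence converging to a point at which
    [f] would not be continuous. *)
Lemma continuous_segment_uniform (R : realType) (V : normedModType R) (f : R -> V)
    (e : R) :
  {within `[0, 1], continuous f} -> 0 < e ->
  exists2 dl : R, 0 < dl & forall s t, 0 <= s <= 1 -> 0 <= t <= 1 ->
    `|s - t| <= dl -> `|f s - f t| <= e.
Proof.
move=> /subspace_continuousP cf e0; apply: contrapT => H.
have {}H (n : nat) : exists st : R * R, [/\ 0 <= st.1 <= 1, 0 <= st.2 <= 1,
    `|st.1 - st.2| <= n.+1%:R^-1 & e < `|f st.1 - f st.2|].
  apply: contrapT => Hn; apply: H; exists n.+1%:R^-1; first by rewrite invr_gt0 ltr0n.
  move=> s t s01 t01 st; rewrite leNgt; apply/negP => fst_e.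
  by apply: Hn; exists (s, t).
have [st stP] := choice H.
have bs : bounded_fun (fun n => (st n).1).
  exists 1; split; rewrite ?num_real// => x x1 n _ /=.
  have [/andP[s0 s1] _ _ _] := stP n; rewrite ger0_norm// (le_trans s1)//; exact: ltW.
have [g ginc /cvg_ex[x gx]] := bolzano_weierstrass bs.
have x01 : 0 <= x <= 1.
  apply/andP; split.
    rewrite -(cvg_lim _ gx)//; apply: limr_ge; first exact: cvgP gx.
    by apply: nearW => n /=; have [/andP[]] := stP (g n).
  rewrite -(cvg_lim _ gx)//; apply: limr_le; first exact: cvgP gx.
  by apply: nearW => n /=; have [/andP[]] := stP (g n).
have xI : `[0, 1]%classic x by rewrite /= in_itv.
have /cvgrPdist_lt /(_ (e / 2)) := cf x xI.
rewrite divr_gt0// => /(_ isT) /nbhs_ballP[dl /= dl0 Hd].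
have near1 : \forall n \near \oo, `|x - (st (g n)).1| < dl / 2.
  by move/cvgrPdist_lt : gx => /(_ (dl / 2)); apply; rewrite divr_gt0.
have near2 : \forall n \near \oo, (n.+1%:R^-1 : R) < dl / 2.
  exact: near_infty_natSinv_lt (PosNum (divr_gt0 dl0 (ltr0n R 2))).
have [n [n1 n2]] : exists n, `|x - (st (g n)).1| < dl / 2 /\ (n.+1%:R^-1 : R) < dl / 2.
  apply: (@filter_ex _ \oo); near=> n; split; near: n.
    exact: near1.
  exact: near2.
have gn : (n <= g n)%N.
  elim: (n) => // k IH; apply: (leq_ltn_trans IH).
  have := ginc k.+1 k; rewrite ltnn => H1; rewrite ltnNge; apply/negP => H2.
  by move: H1; rewrite (H2 : (g k.+1 <= g k)%O).
have [s01 t01 stn efst] := stP (g n).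
have xs : `|x - (st (g n)).1| < dl by lra.
have xt : `|x - (st (g n)).2| < dl.
  have -> : x - (st (g n)).2 = (x - (st (g n)).1) + ((st (g n)).1 - (st (g n)).2) by ring.
  apply: (le_lt_trans (ler_normD _ _)).
  have gn1 : ((g n).+1%:R^-1 : R) <= n.+1%:R^-1 by rewrite lef_pV2 ?posrE ?ltr0n// ler_nat ltnS.
  rewrite [ltRHS]splitr; apply: ltr_leD => //.
  by apply: (le_trans stn); apply: (le_trans gn1); exact: ltW.
have H1 := Hd _ xs; have H2 := Hd _ xt.
rewrite /= !in_itv/= in H1 H2; have {}H1 := H1 s01; have {}H2 := H2 t01.
have := ler_distD (f x) (f (st (g n)).1) (f (st (g n)).2).
rewrite (distrC (f (st (g n)).1) (f x)); lra.
Unshelve. all: by end_near. Qed.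

Section norm_comparison.
Context (R : realType) (d : nat).
Implicit Types x : 'rV[R]_d.

Lemma entry_le_mx_norm x i : `|x 0 i| <= `|x|.
Proof.
rewrite [leRHS]/Num.norm /= mx_normrE; apply/bigmax_geP; right => /=.
by exists (0, i).
Qed.

Lemma sqn_le_mx_norm x : sqn x <= d%:R * `|x| ^+ 2.
Proof.
apply: (@le_trans _ _ (\sum_(i < d) `|x| ^+ 2)).
  apply: ler_sum => i _; rewrite -real_normK ?num_real//.
  by rewrite lerXn2r ?nnegrE// entry_le_mx_norm.
by rewrite sumr_const card_ord mulr_natl.
Qed.

Lemma enorm_le_mx_norm x : enorm x <= d%:R * `|x|.
Proof.
rewrite enorm_le_sqn ?mulr_ge0// (le_trans (sqn_le_mx_norm x))// exprMn.
rewrite ler_wpM2r ?sqr_ge0// -natrX ler_nat.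
by case: (d) => // k; rewrite expnS leq_pmulr// expn_gt0.
Qed.
End norm_comparison.

Section path_modulus.
Context (R : realType) (d : nat) (f : R -> 'rV[R]_d).
Hypothesis cf : {within `[0, 1], continuous f}.

Lemma path_uniform (e : R) : 0 < e ->
  exists2 dl : R, 0 < dl & forall s t, 0 <= s <= 1 -> 0 <= t <= 1 ->
    `|s - t| <= dl -> enorm (f s - f t) <= e.
Proof.
(* [d.+1] instead of [d], which may be 0. *)
move=> e0; have e1 : 0 < e / d.+1%:R by rewrite divr_gt0.
have [dl dl0 H] := continuous_segment_uniform cf e1.
exists dl => // s t s01 t01 st; apply: (le_trans (enorm_le_mx_norm _)).
apply: (@le_trans _ _ (d.+1%:R * (e / d.+1%:R))).
  by rewrite ler_pM// ?H// ler_nat.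
by rewrite mulrCA divff ?mulr1// pnatr_eq0.
Qed.
End path_modulus.

(** * Gaussian vectors and Brownian increments *)

Section coordinate_sigma_algebra.
Context (R : realType) (d : nat).

(* The sigma-algebra of the coordinates, for which [id] is trivially [vmeas]. *)
Definition entry_preimages : set (set 'rV[R]_d) :=
  [set C | exists i (A : set R), measurable A /\ C = (fun x : 'rV[R]_d => x 0 i) @^-1` A].

Definition entriesType := g_sigma_algebraType entry_preimages.

Lemma measurable_entriesType (dT : measure_display) (T : measurableType dT)
    (f : T -> 'rV[R]_d) : (forall i, measurable_fun [set: T] (fun w => f w 0 i)) ->
  measurable_fun [set: T] (f : T -> entriesType).
Proof.
move=> mf; apply: (@measurability _ _ T entriesType setT f entry_preimages) => // _ [_ [i [A [mA ->]]] <-].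
exact: mf.
Qed.

Lemma vmeas_entriesType : vmeas (id : entriesType -> 'rV[R]_d).
Proof.
move=> i j _ A mA; rewrite setTI; apply: sub_sigma_algebra.
by exists j, A; split => //; rewrite (ord1 i).
Qed.

Lemma entriesType_borel (A : set 'rV[R]_d) :
  @measurable _ entriesType A -> @measurable _ (borel 'rV[R]_d) A.
Proof.
move=> mA; have := @measurable_entriesType _ (borel 'rV[R]_d) id _ measurableT A mA.
rewrite setTI; apply => i.
by apply: (@continuous_borel_measurable R 'rV[R]_d); exact: coord_continuous.
Qed.
End coordinate_sigma_algebra.

Section isotropic_gaussian.
Context (R : realType) (d : nat) (dO : measure_display) (O : measurableType dO)
  (P : probability O R) (v : R) (Y : O -> 'rV[R]_d).
Hypotheses (v0 : 0 < v) (mY : forall i, measurable_fun [set: O] (fun w => Y w 0 i))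
  (gY : centered_isotropic_gaussian P v Y).

Let s := Num.sqrt v.
Let s0 : 0 < s. Proof. by rewrite sqrtr_gt0. Qed.
Let s2 : s ^+ 2 = v. Proof. by rewrite sqr_sqrtr// ltW. Qed.

Lemma gaussian_entry i (A : set (measurableTypeR R)) : measurable A ->
  P ((fun w => Y w 0 i) @^-1` A) = normal_prob 0 s A.
Proof.
move=> mA; pose C j := if j == i then A else setT.
have mC j : measurable (C j) by rewrite /C; case: ifP.
rewrite (_ : _ @^-1` _ = [set w | forall j, C j (Y w 0 j)]).
  rewrite gY// (bigD1 i)//= big1 => [|j ji]; last by rewrite /C (negbTE ji) probability_setT.
  by rewrite mule1 /C eqxx.
apply/seteqP; split=> w /= H; last by have := H i; rewrite /C eqxx.
by move=> j; rewrite /C; case: eqP => // ->.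
Qed.

Lemma gaussian_entries_independent i j : i != j ->
  independent_maps P (fun w => Y w 0 i : measurableTypeR R)
   (fun w => Y w 0 j : measurableTypeR R).
Proof.
move=> ij A B mA mB; rewrite !gaussian_entry//.
pose C k := if k == i then A else if k == j then B else setT.
have mC k : measurable (C k) by rewrite /C; do 2 case: ifP => //.
rewrite (_ : _ `&` _ = [set w | forall k, C k (Y w 0 k)]).
  rewrite gY// (bigD1 i)//= (bigD1 j)/=; last by rewrite eq_sym.
  rewrite big1 => [|k /andP[ki kj]]; last by rewrite /C (negbTE ki) (negbTE kj) probability_setT.
  by rewrite mule1 /C eqxx eq_sym (negbTE ij) eqxx.
apply/seteqP; split=> w /=.
  by move=> [Aw Bw] k; rewrite /C; case: eqP => [->//|_]; case: eqP => // ->.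
move=> H; split; first by have := H i; rewrite /C eqxx.
by have := H j; rewrite /C eq_sym (negbTE ij) eqxx.
Qed.

Lemma gaussian_centered_with_cov : centered_with_cov P v Y.
Proof.
have sY : sqint P Y.
  by move=> i; split => //; exact: (gaussian_integrable s0 (mY i) (gaussian_entry i)).
split=> // [i|i j].
  exact: (gaussian_mean s0 (mY i) (gaussian_entry i)).
have [->|ij] := eqVneq i j.
  rewrite mulr1n -s2; under eq_Rintegral do rewrite -expr2.
  exact: (gaussian_variance s0 (mY j) (gaussian_entry j)).
rewrite mulr0n.
have mh : measurable_fun [set: measurableTypeR R * measurableTypeR R]
    (fun z : R * R => z.1 * z.2).
  by apply: measurable_funM; [exact: measurable_fst|exact: measurable_snd].
rewrite /Rintegral.
have := @independent_maps_Fubini _ _ _ O (measurableTypeR R) (measurableTypeR R) R P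
  (fun w => Y w 0 i) (fun w => Y w 0 j) (fun z => z.1 * z.2) (mY i) (mY j)
  (gaussian_entries_independent ij) mh (integrable_entryM sY i j).
move=> /= ->; rewrite (_ : (\int[P]_w _)%E = 0%E)//.
apply: integral0_eq => w _.
under eq_integral do rewrite EFinM.
rewrite integralZl//; last exact: (integrable_entry sY j).
rewrite (_ : (\int[P]_x (Y x 0 j)%:E)%E = 0%E) ?mule0//.
have := gaussian_mean s0 (mY j) (gaussian_entry j); rewrite /Rintegral => E0.
by rewrite -[LHS]fineK ?E0//; exact: (integrable_fin_num measurableT (integrable_entry sY j)).
Qed.

Definition gaussian_rho_bound : R := (d%:R ^+ 2 + 128 * d%:R ^+ 4) / 2.

(** The third absolute moment is reduced to even ones by [t ^+ 3 <= s / 2 * t ^+ 2 + t ^+ 4 / (2 *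
    s)]. With the variance and the bound on the fourth moment, the two terms give [d ^+ 2 / 2] and
    [64 * d ^+ 4]. *)
Lemma gaussian_rho : \int[P]_w rho (Y w) <= gaussian_rho_bound * s ^+ 3.
Proof.
have [sY _ _] := gaussian_centered_with_cov.
have i2 i := (sY i).2.
have i4 i := gaussian_integrable4 s0 (mY i) (gaussian_entry i).
have i2' := integrable_scale (s / 2 * d%:R) (integrable_Rsum (index_enum 'I_d) i2).
have i4' := integrable_scale (d%:R ^+ 3 / (2 * s)) (integrable_Rsum (index_enum 'I_d) i4).
apply: (@le_trans _ _ (\int[P]_w (s / 2 * d%:R * (\sum_i Y w 0 i ^+ 2) +
   d%:R ^+ 3 / (2 * s) * \sum_i Y w 0 i ^+ 4))).
  apply: le_Rintegral => //.
  - exact: integrable_rho sY.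
  - exact: (integrableD measurableT i2' i4').
  move=> w _; apply: (le_trans (rho_le3 _)).
  set t := norm1 (Y w); have t0 : 0 <= t := norm1_ge0 _.
  have t2 : t ^+ 2 <= d%:R * \sum_i Y w 0 i ^+ 2 by exact: norm1_sqr_le.
  have t4 : t ^+ 4 <= d%:R ^+ 3 * \sum_i Y w 0 i ^+ 4.
    rewrite (_ : t ^+ 4 = (t ^+ 2) ^+ 2); last by rewrite -exprM.
    apply: (@le_trans _ _ ((d%:R * \sum_i Y w 0 i ^+ 2) ^+ 2)).
      by rewrite lerXn2r ?nnegrE ?sqr_ge0// mulr_ge0// sumr_ge0// => i _; exact: sqr_ge0.
    rewrite exprMn (_ : d%:R ^+ 3 * _ = d%:R ^+ 2 * (d%:R * \sum_i Y w 0 i ^+ 4)); last by ring.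
    rewrite ler_wpM2l ?sqr_ge0//.
    have := norm1_sqr_le (\row_i (Y w 0 i ^+ 2)).
    have -> : norm1 (\row_i (Y w 0 i ^+ 2)) = \sum_i Y w 0 i ^+ 2.
      by apply: eq_bigr => i _; rewrite mxE ger0_norm ?sqr_ge0.
    have -> // : \sum_i (\row_i (Y w 0 i ^+ 2)) 0 i ^+ 2 = \sum_i Y w 0 i ^+ 4.
    by apply: eq_bigr => i _; rewrite mxE -exprM.
  have amgm : t ^+ 3 <= s / 2 * t ^+ 2 + t ^+ 4 / (2 * s).
    rewrite -subr_ge0 (_ : _ - _ = t ^+ 2 * (s - t) ^+ 2 / (2 * s)); last by field; rewrite gt_eqF.
    by apply: divr_ge0; [apply: mulr_ge0; exact: sqr_ge0|apply: mulr_ge0 => //; exact: ltW].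
  apply: (le_trans amgm); apply: lerD.
    by rewrite -[leRHS]mulrA; apply: ler_wpM2l => //; apply: divr_ge0 => //; exact: ltW.
  rewrite [leRHS]mulrAC; apply: ler_wpM2r => //; rewrite invr_ge0; apply: mulr_ge0 => //; exact: ltW.
rewrite (RintegralD measurableT i2' i4') !RintegralZl//; last 2 first.
- exact: integrable_Rsum.
- exact: integrable_Rsum.
rewrite !Rintegral_sum//.
rewrite (eq_bigr (fun=> s ^+ 2)) => [|i _]; last first.
  exact: (gaussian_variance s0 (mY i) (gaussian_entry i)).
rewrite sumr_const card_ord.
have : \sum_(i < d) \int[P]_w Y w 0 i ^+ 4 <= d%:R * (128 * s ^+ 4).
  rewrite mulr_natl -[X in _ *+ X]card_ord -sumr_const; apply: ler_sum => i _.
  exact: (gaussian_moment4 s0 (mY i) (gaussian_entry i)).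
move=> H; have := ler_wpM2l (_ : 0 <= d%:R ^+ 3 / (2 * s)) H.
have -> : d%:R ^+ 3 / (2 * s) * (d%:R * (128 * s ^+ 4)) = 64 * d%:R ^+ 4 * s ^+ 3.
  by field; rewrite gt_eqF.
rewrite -[s ^+ 2 *+ d]mulr_natl => /(_ _) H'.
rewrite (_ : gaussian_rho_bound * s ^+ 3 = s / 2 * d%:R * (d%:R * s ^+ 2) + 64 * d%:R ^+ 4 * s ^+ 3).
  by rewrite lerD2l H'// divr_ge0 ?exprn_ge0// mulr_ge0// ltW.
by rewrite /gaussian_rho_bound; field.
Qed.

End isotropic_gaussian.

Section brownian.
Context (R : realType) (d : nat) (dO : measure_display) (O : measurableType dO)
  (P : probability O R) (B : R -> O -> 'rV[R]_d).
Hypothesis B_bm : standard_brownian_motion P B.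

(* [minn] keeps the time in [[0, 1]] for every [k]. *)
Definition grid (n k : nat) : R := (minn k n)%:R / n%:R.

Lemma grid01 n k : 0 <= grid n k <= 1.
Proof.
rewrite /grid divr_ge0//=; case: n => [|n]; first by rewrite invr0 mulr0.
by rewrite ler_pdivrMr ?ltr0n// mul1r ler_nat geq_minr.
Qed.

Lemma gridE n k : (k <= n)%N -> grid n k = k%:R / n%:R.
Proof. by move=> kn; rewrite /grid (minn_idPl kn). Qed.

Lemma gridS n k : (k < n)%N -> grid n k.+1 - grid n k = n%:R^-1.
Proof. by move=> kn; rewrite (gridE kn) (gridE (ltnW kn)) -mulrBl -natrB// subSnn mul1r. Qed.

Definition increment (n k : nat) (w : O) : 'rV[R]_d :=
  B (grid n k.+1) w - B (grid n k) w.

Lemma measurable_B u i : 0 <= u <= 1 -> measurable_fun [set: O] (fun w => B u w 0 i).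
Proof. by move=> u01; have [mB _ _ _ _] := B_bm; apply: borel_measurable_entry; exact: mB. Qed.

Lemma measurable_increment n k i :
  measurable_fun [set: O] (fun w => increment n k w 0 i).
Proof.
rewrite (_ : (fun _ => _) = (fun w => B (grid n k.+1) w 0 i - B (grid n k) w 0 i)).
  by apply: measurable_funB; apply: measurable_B; exact: grid01.
by apply/funext => w; rewrite !mxE.
Qed.

Lemma increment_gaussian n k : (k < n)%N ->
  centered_isotropic_gaussian P n%:R^-1 (increment n k).
Proof.
move=> kn; have [_ _ _ _ gB] := B_bm.
rewrite -(gridS kn); apply: gB.
- by have /andP[] := grid01 n k.
- rewrite -subr_gt0 gridS// invr_gt0 ltr0n; exact: leq_ltn_trans kn.
- by have /andP[] := grid01 n k.+1.
Qed.

Lemma increment_independent n :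
  mutually_independent P (fun (k : 'I_n) w => increment n k w : entriesType R d).
Proof.
have [_ _ _ iB _] := B_bm => J A mA.
apply: (iB n (grid n)).
- by have /andP[] := grid01 n 0.
- by move=> i j ij; rewrite /grid ler_wpM2r ?invr_ge0// ler_nat leq_min !geq_min leqnn orbT ij.
- by have /andP[] := grid01 n n.
- by move=> i iJ; apply: entriesType_borel; exact: mA.
Qed.

Lemma increment_adapted_indep n : adapted_indep_r P n (increment n).
Proof.
case: n => [|n] J s k // kn.
pose F i (x : entriesType R d) := s i *m (x : 'rV[R]_d).
have mF i : vmeas (F i) by apply: vmeas_mul => j; exact: vmeas_entriesType.
have mX (i : 'I_n.+1) : measurable_fun [set: O] (increment n.+1 i : O -> entriesType R d).
  by apply: measurable_entriesType => j; exact: measurable_increment.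
have ne i : (i < k)%N -> (inord i : 'I_n.+1) != inord k.
  move=> ik; apply/eqP => /(congr1 val)/=; rewrite !inordK//; first lia.
  exact: ltn_trans kn.
have [_] := indep_vectors_family mX (@increment_independent n.+1) mF ne.
rewrite /F; have -> : (fun w => \sum_(i < k) s i *m increment n.+1 (inord i : 'I_n.+1) w) =
   (fun w => \sum_(i < k) s i *m increment n.+1 i w).
  apply/funext => w; apply: eq_bigr => i _; rewrite inordK//.
  exact: ltn_trans kn.
by rewrite inordK.
Qed.

Lemma sum_increment n i l w : (i <= l <= n)%N ->
  \sum_(i <= k < l) increment n k w = B (grid n l) w - B (grid n i) w.
Proof. by move=> /andP[il ln]; rewrite telescope_sumr. Qed.

End brownian.

(** * Continuity of the test functions and suprema of paths *)

Section limits.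
Context (R : realType) (T : Type) (F : set_system T) {FF : Filter F}.

Lemma cvg_Rsum (I : Type) (r : seq I) (f : I -> T -> R) (l : I -> R) :
  (forall i, f i t @[t --> F] --> l i) ->
  \sum_(i <- r) f i t @[t --> F] --> \sum_(i <- r) l i.
Proof.
move=> fl; elim: r => [|i r IH].
  rewrite big_nil (_ : (fun _ => _) = fun=> 0); first exact: cvg_cst.
  by apply/funext => t; rewrite big_nil.
rewrite big_cons (_ : (fun _ => _) = fun t => f i t + \sum_(j <- r) f j t).
  exact: cvgD.
by apply/funext => t; rewrite big_cons.
Qed.

Lemma cvg_Rprod (I : Type) (r : seq I) (f : I -> T -> R) (l : I -> R) :
  (forall i, f i t @[t --> F] --> l i) ->
  \prod_(i <- r) f i t @[t --> F] --> \prod_(i <- r) l i.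
Proof.
move=> fl; elim: r => [|i r IH].
  rewrite big_nil (_ : (fun _ => _) = fun=> 1); first exact: cvg_cst.
  by apply/funext => t; rewrite big_nil.
rewrite big_cons (_ : (fun _ => _) = fun t => f i t * \prod_(j <- r) f j t).
  exact: cvgM.
by apply/funext => t; rewrite big_cons.
Qed.

Lemma cvg_sqn d (x : T -> 'rV[R]_d) (l : 'rV[R]_d) :
  (forall i, x t 0 i @[t --> F] --> l 0 i) -> sqn (x t) @[t --> F] --> sqn l.
Proof. by move=> xl; apply: cvg_Rsum => i; apply: cvgM; exact: xl. Qed.

Lemma cvg_cub (f : T -> R) (l : R) :
  f t @[t --> F] --> l -> cub (f t) @[t --> F] --> cub l.
Proof.
(* The positive part is [(x + |x|) / 2], so sums, products and norms are enough. *)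
move=> fl; have E (x : R) : cub x = ((x + `|x|) / 2) * (((x + `|x|) / 2) * ((x + `|x|) / 2)).
  have -> : (x + `|x|) / 2 = Num.max 0 x.
    by rewrite maxr_absE add0r sub0r normrN.
  by rewrite /cub !exprS expr0 mulr1.
rewrite E (_ : (fun _ => _) = fun t => ((f t + `|f t|) / 2) *
   (((f t + `|f t|) / 2) * ((f t + `|f t|) / 2))); last by apply/funext => t.
have H : (f t + `|f t|) / 2 @[t --> F] --> (l + `|l|) / 2.
  by apply: cvgMr_tmp; apply: cvgD => //; exact: cvg_norm.
by apply: cvgM => //; exact: cvgM.
Qed.

Lemma cvg_step (a b : R) (q : T -> R) (l : R) : 0 <= l ->
  q t @[t --> F] --> l -> step a b (q t) @[t --> F] --> step a b l.
Proof.
move=> l0 ql; apply: cvg_cub; apply: cvgB; first exact: cvg_cst.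
apply: cvg_cub; apply: cvgB; first exact: cvg_cst.
apply: cvgMl_tmp; apply: cvgV; first by rewrite gt_eqF// ltr_pwDl.
by apply: cvgD => //; exact: cvg_cst.
Qed.

Lemma cvg_step_prod J d (a b : R) (x : T -> 'M[R]_(J, d)) (l : 'M[R]_(J, d)) :
  (forall j i, x t j i @[t --> F] --> l j i) ->
  step_prod a b (x t) @[t --> F] --> step_prod a b l.
Proof.
move=> xl; apply: cvg_Rprod => j; apply: cvg_step; first exact: sqn_ge0.
apply: cvg_sqn => i; rewrite mxE (_ : (fun _ => _) = fun t => x t j i); first exact: xl.
by apply/funext => t; rewrite mxE.
Qed.
End limits.

Lemma path_cvg (R : realType) (d : nat) (f : R -> 'rV[R]_d) (u : nat -> R) (l : R) i :
  {within `[0, 1], continuous f} -> (forall n, 0 <= u n <= 1) -> 0 <= l <= 1 ->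
  u n @[n --> \oo] --> l -> f (u n) 0 i @[n --> \oo] --> f l 0 i.
Proof.
move=> cf u01 l01 /cvgrPdist_le ul; apply/cvgrPdist_le => e e0.
have [dl dl0 H] := continuous_segment_uniform cf e0.
near=> n; have := H _ _ l01 (u01 n); rewrite -[_ - f (u n) 0 i]/((f l) 0 i - f (u n) 0 i).
move=> H'; apply: le_trans (H' _); last by near: n; exact: ul.
by have := entry_le_mx_norm (f l - f (u n)) i; rewrite !mxE.
Unshelve. all: by end_near. Qed.

Section path_supremum.
Context (R : realType) (dO : measure_display) (O : measurableType dO)
  (g : R -> O -> R).
Hypotheses (cg : forall w, {within `[0, 1], continuous (fun u => g u w)})
  (mg : forall u, 0 <= u <= 1 -> measurable_fun [set: O] (g u)).

Definition path_sup w := sup [set g u w | u in `[0, 1]].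
(** The default value [g 0 w] is already the term [j = 0]. *)
Definition grid_max m w := \big[Num.max/g 0 w]_(j < m.+1) g (grid R m j) w.

Lemma path_sup_attained w : exists2 c, 0 <= c <= 1 &
  path_sup w = g c w /\ forall u, 0 <= u <= 1 -> g u w <= path_sup w.
Proof.
have [c c01 H] := @EVT_max R (fun u => g u w) 0 1 ler01 (@cg w).
exists c; first by move: c01; rewrite in_itv.
have ub : ubound [set g u w | u in `[0, 1]] (g c w).
  by move=> _ [u /= u01 <-]; exact: H.
have E : path_sup w = g c w.
  apply/eqP; rewrite eq_le; apply/andP; split.
    by apply: ge_sup => //; exists (g c w); exists c.
  by apply: ub_le_sup; [exists (g c w)|exists c].
by split=> // u u01; rewrite E; apply: H; rewrite in_itv.
Qed.

Lemma grid_max_le m w : grid_max m w <= path_sup w.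
Proof.
have [c _ [_ H]] := path_sup_attained w.
apply/bigmax_leP; split => [|j _]; apply: H; last exact: grid01.
by rewrite lexx ler01.
Qed.

Lemma grid_max_ge m (j : 'I_m.+1) w : g (grid R m j) w <= grid_max m w.
Proof. by apply/bigmax_geP; right; exists j. Qed.

Lemma grid_dense (c : R) m : (0 < m)%N -> 0 <= c <= 1 ->
  exists2 j : 'I_m.+1, grid R m j <= c & `|c - grid R m j| <= m%:R^-1.
Proof.
move=> m0 /andP[c0 c1]; have m0' : 0 < m%:R :> R by rewrite ltr0n.
have cm0 : 0 <= c * m%:R by rewrite mulr_ge0.
have /andP[t1 t2] := truncn_itv cm0.
have jm : (Num.truncn (c * m%:R) < m.+1)%N.
  by rewrite ltnS -(ler_nat R) (le_trans t1)// ler_piMl.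
have gE : grid R m (Ordinal jm) = (Num.truncn (c * m%:R))%:R / m%:R.
  by rewrite /= gridE.
exists (Ordinal jm); rewrite gE; first by rewrite ler_pdivrMr.
rewrite ger0_norm ?subr_ge0 ?ler_pdivrMr// -(ler_pM2r m0') mulrBl divfK ?gt_eqF//.
by rewrite mulVf ?gt_eqF// lerBlDr addrC natr1; exact: ltW.
Qed.

Lemma grid_max_cvg w : grid_max m w @[m --> \oo] --> path_sup w.
Proof.
apply/cvgrPdist_le => e e0; have [c c01 [Ec _]] := path_sup_attained w.
have [dl dl0 H] := continuous_segment_uniform (@cg w) e0.
near=> m.
have m0 : (0 < m)%N by near: m; exact: nbhs_infty_gt.
have [j _ cj] := grid_dense m0 c01.
rewrite ger0_norm ?subr_ge0 ?grid_max_le// Ec.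
apply: (@le_trans _ _ (g c w - g (grid R m j) w)); first by rewrite lerB// grid_max_ge.
apply: le_trans (ler_norm _) _; apply: H => //; first exact: grid01.
apply: (le_trans cj); rewrite -[dl]invrK lef_pV2 ?posrE ?invr_gt0 ?ltr0n//.
by near: m; exact: nbhs_infty_ger.
Unshelve. all: by end_near. Qed.

Lemma measurable_grid_max m : measurable_fun [set: O] (grid_max m).
Proof.
rewrite /grid_max; elim: (index_enum _) => [|j r IH].
  rewrite (_ : (fun _ => _) = g 0); first by apply: mg; rewrite lexx ler01.
  by apply/funext => w; rewrite big_nil.
rewrite (_ : (fun _ => _) = fun w => Num.max (g (grid R m j) w) (\big[Num.max/g 0 w]_(i <- r) g (grid R m i) w)).
  by apply: measurable_maxr => //; apply: mg; exact: grid01.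
by apply/funext => w; rewrite big_cons.
Qed.

Lemma measurable_path_sup : measurable_fun [set: O] path_sup.
Proof.
apply: (@measurable_fun_cvg _ _ _ _ grid_max) => //.
  exact: measurable_grid_max.
by move=> w _; exact: grid_max_cvg.
Qed.

(** The gap between the supremum and its grid version tends to 0 at every point, so the probability
    of [D m], where the gap reaches [b - a], tends to 0. Off [D m], a grid maximum at most [a]
    forces the supremum below [b]. *)
Lemma grid_max_prob (P : probability O R) (a b : R) : a < b ->
  forall e, 0 < e -> \forall m \near \oo,
  fine (P [set w | grid_max m w <= a]) <= fine (P [set w | path_sup w <= b]) + e.
Proof.
move=> ab e e0.
pose D m := [set w | b - a <= path_sup w - grid_max m w].
have mD m : measurable (D m).
  rewrite -[D m]setTI; apply: measurable_fun_ler => //.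
  by apply: measurable_funB; [exact: measurable_path_sup|exact: measurable_grid_max].
have : (fun m => \int[P]_w \1_(D m) w) @ \oo --> \int[P]_w (0 : R).
  apply: (@Rintegral_dominated_cvg _ _ _ P (fun m => \1_(D m)) (fun=> 0) (fun=> 1)) => //.
  - by move=> w; apply: cvg_near_cst; have /cvgrPdist_lt /(_ (b - a)) := @grid_max_cvg w;
    rewrite subr_gt0 => /(_ ab); apply: filterS => m; rewrite ger0_norm ?subr_ge0 ?grid_max_le// => H;
    rewrite indicE memNset//= /D/=; apply/negP; rewrite -ltNge.
  - by move=> m w; rewrite indicE; case: (_ \in _); rewrite ?normr1 ?normr0.
  - by apply: (@bounded_integrable _ _ _ _ _ 1) => // w; rewrite normr1.
rewrite Rintegral_cstT => /cvgrPdist_le /(_ e e0); apply: filterS => m.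
rewrite Rintegral_indicator// sub0r normrN ger0_norm ?fine_ge0// => H.
have mg1 : measurable [set w | grid_max m w <= a].
  by rewrite -[X in measurable X]setTI; apply: measurable_fun_ler => //; exact: measurable_grid_max.
have mg2 : measurable [set w | path_sup w <= b].
  by rewrite -[X in measurable X]setTI; apply: measurable_fun_ler => //; exact: measurable_path_sup.
apply: (@le_trans _ _ (fine (P ([set w | path_sup w <= b] `|` D m)))).
  apply: fine_probability_le => //; first exact: measurableU.
  move=> w /= ga; case: (leP (path_sup w) b) => wb; [by left|right].
  by rewrite /D/=; lra.
by apply: (le_trans (fine_probabilityU_le _ _ _)) => //; rewrite lerD2l.
Qed.
End path_supremum.

Section weighted_sums.
Context (R : realType) (J d : nat).
Implicit Types (l h : 'I_J -> nat) (c : 'I_J -> R).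

(* [l = 0], [h = k_j] and [c = k_j / n] give the bridge of the partial sums at
   [k_j]; [c = 0] gives a block sum. *)
Definition weights l h c (k : nat) : 'cV[R]_J :=
  \col_j ((l j <= k < h j)%N%:R - c j).

Lemma weights_le1 l h c k j : 0 <= c j <= 1 -> `|weights l h c k j 0| <= 1.
Proof.
move=> /andP[c0 c1]; rewrite mxE; case: (_ <= _ < _)%N; rewrite /= ler_norml.
  by rewrite mulr1n; lra.
by rewrite mulr0n; lra.
Qed.

Lemma row_weighted_sum l h c n (z : nat -> 'rV[R]_d) j :
  (l j <= h j <= n)%N ->
  row j (\sum_(k < n) weights l h c k *m z k) =
  \sum_(l j <= k < h j) z k - c j *: \sum_(0 <= k < n) z k.
Proof.
move=> /andP[lh hn]; apply/rowP => i; rewrite !mxE !summxE.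
rewrite (eq_bigr (fun k : 'I_n => (l j <= k < h j)%N%:R * z k 0 i - c j * z k 0 i)); last first.
  by move=> k _; rewrite mxE big_ord1 mxE mulrBl.
rewrite big_split/= sumrN -mulr_sumr -(big_mkord xpredT (fun k => z k 0 i)).
congr (_ - _).
rewrite -(big_mkord xpredT (fun k => (l j <= k < h j)%N%:R * z k 0 i)).
rewrite [RHS](big_nat_widen _ _ n)//= [RHS](big_nat_widenl _ 0)//= [RHS]big_mkcond/=.
apply: eq_bigr => k _; rewrite andbC; case: ifP => _; by rewrite ?mul1r ?mul0r.
Qed.
End weighted_sums.

Section brownian_limits.
Context (R : realType) (d : nat) (dO : measure_display) (O : measurableType dO)
  (P : probability O R) (B : R -> O -> 'rV[R]_d).
Hypothesis B_bm : standard_brownian_motion P B.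

(** What [weights] make of Brownian increments once the sums telescope. The times [lo], [hi] and the
    drifts [c] are real, so that limits can be taken in them. *)
Definition path_comb J (lo hi c : 'I_J -> R) (w : O) : 'M[R]_(J, d) :=
  \matrix_(j, i) (B (hi j) w 0 i - B (lo j) w 0 i - c j * (B 1 w 0 i - B 0 w 0 i)).

Lemma vmeas_path_comb J (lo hi c : 'I_J -> R) :
  (forall j, 0 <= lo j <= 1) -> (forall j, 0 <= hi j <= 1) ->
  vmeas (path_comb lo hi c).
Proof.
move=> lo01 hi01 j i; rewrite (_ : (fun _ => _) = fun w => B (hi j) w 0 i - B (lo j) w 0 i -
   c j * (B 1 w 0 i - B 0 w 0 i)); last by apply/funext => w; rewrite mxE.
have m1 : measurable_fun [set: O] (fun w => B 1 w 0 i).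
  by apply: (measurable_B B_bm); rewrite ler01 lexx.
have m0 : measurable_fun [set: O] (fun w => B 0 w 0 i).
  by apply: (measurable_B B_bm); rewrite lexx ler01.
apply: measurable_funB; last by apply: measurable_funM => //; exact: measurable_funB.
by apply: measurable_funB; apply: (measurable_B B_bm).
Qed.

Lemma weighted_increments J (l h : 'I_J -> nat) (c : 'I_J -> R) n w :
  (0 < n)%N -> (forall j, (l j <= h j <= n)%N) ->
  \sum_(k < n) weights l h c k *m increment B n k w =
  path_comb (fun j => grid R n (l j)) (fun j => grid R n (h j)) c w.
Proof.
move=> n0 lh; apply/row_matrixP => j; rewrite (@row_weighted_sum R J d l h c n (fun k => increment B n k w) j (lh j)).
rewrite !sum_increment//; last by rewrite leqnn.
have -> : grid R n n = 1 by rewrite gridE// divff// pnatr_eq0 -lt0n.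
have -> : grid R n 0 = 0 by rewrite gridE// mul0r.
by apply/rowP => i; rewrite !mxE.
Qed.

Lemma path_comb_cvg J (a b : R) (lo hi c : nat -> 'I_J -> R) (lo' hi' c' : 'I_J -> R) :
  (forall n j, 0 <= lo n j <= 1) -> (forall n j, 0 <= hi n j <= 1) ->
  (forall j, 0 <= lo' j <= 1) -> (forall j, 0 <= hi' j <= 1) ->
  (forall j, lo n j @[n --> \oo] --> lo' j) ->
  (forall j, hi n j @[n --> \oo] --> hi' j) ->
  (forall j, c n j @[n --> \oo] --> c' j) ->
  (fun n => \int[P]_w step_prod a b (path_comb (lo n) (hi n) (c n) w)) @ \oo -->
  \int[P]_w step_prod a b (path_comb lo' hi' c' w).
Proof.
move=> lo1 hi1 lo1' hi1' clo chi cc; have [_ _ cB _ _] := B_bm.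
apply: (@Rintegral_dominated_cvg _ _ _ P
  (fun n w => step_prod a b (path_comb (lo n) (hi n) (c n) w)) _ (fun=> 1)).
- by move=> n; apply: (@mtest_step_prod R d J a b); exact: vmeas_path_comb.
- by apply: (@mtest_step_prod R d J a b); exact: vmeas_path_comb.
- move=> w; apply: cvg_step_prod => j i.
  rewrite mxE (_ : (fun _ => _) = fun n => B (hi n j) w 0 i - B (lo n j) w 0 i -
     c n j * (B 1 w 0 i - B 0 w 0 i)); last by apply/funext => n; rewrite mxE.
  apply: cvgB; last by apply: cvgMr_tmp.
  by apply: cvgB; apply: (@path_cvg R d (fun u => B u w)).
- by move=> n w; exact: step_prod_norm_le1.
- by apply: (@bounded_integrable _ _ _ _ _ 1) => // w; rewrite normr1.
Qed.

(** An additional factor does not raise the product: [(1 - p) * (1 + p + S) <= 1 + S] for [p] and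
    [S] nonnegative. *)
Lemma prod_sum_le1 (I : Type) (r : seq I) (p : I -> R) : (forall i, 0 <= p i <= 1) ->
  0 <= \prod_(i <- r) (1 - p i) /\ \prod_(i <- r) (1 - p i) * (1 + \sum_(i <- r) p i) <= 1.
Proof.
move=> p01; elim: r => [|i r [IH0 IH]]; first by rewrite !big_nil addr0 mulr1.
rewrite !big_cons; have /andP[p0 p1] := p01 i.
split; first by rewrite mulr_ge0// subr_ge0.
have S0 : 0 <= \sum_(i <- r) p i by apply: sumr_ge0 => j _; have /andP[] := p01 j.
apply: (le_trans _ IH); rewrite -mulrA mulrCA; apply: ler_wpM2l => //; nra.
Qed.

Lemma increment_set_measurable (c : R) n k :
  measurable [set w | c < sqn (increment B n k w)].
Proof.
have mi i : measurable_fun [set: O] (fun w => increment B n k w 0 i).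
  exact: (measurable_increment B_bm).
rewrite -[X in measurable X]setTI; apply: measurable_fun_ltr => //.
rewrite /sqn; apply: measurable_sum => i.
by apply: measurable_funX.
Qed.

Lemma max_increment_prob (c : R) n :
  fine (P [set w | forall k : 'I_n, sqn (increment B n k w) <= c]) =
  \prod_(k < n) (1 - fine (P [set w | c < sqn (increment B n k w)])).
Proof.
have mS : measurable_fun [set: entriesType R d] (fun x : 'rV[R]_d => sqn x).
  by rewrite /sqn; apply: measurable_sum => i; apply: measurable_funX;
    exact: (@vmeas_entriesType R d).
have mA : measurable ([set x | sqn x <= c] : set (entriesType R d)).
  by rewrite -[X in measurable X]setTI; apply: measurable_fun_ler.
have := @increment_independent _ _ _ _ _ _ B_bm n [fset i in index_enum 'I_n]%fset
  (fun=> [set x | sqn x <= c]) (fun _ _ => mA).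
rewrite (_ : \bigcap_(_ in _) _ = [set w | forall k : 'I_n, sqn (increment B n k w) <= c]); last first.
  apply/seteqP; split => w /= H k; last by move=> _; exact: H.
  by apply: H; rewrite /= inE /= mem_index_enum.
have -> : (\prod_(i <- [fset i in index_enum 'I_n]%fset)
   P ((fun w => increment B n i w) @^-1` [set x | (sqn x <= c)%R]) =
   \prod_(k < n) (1 - fine (P [set w | (c < sqn (increment B n k w))%R]))%R%:E)%E.
  rewrite (perm_big (index_enum 'I_n))/=; last first.
    apply: uniq_perm; rewrite ?fset_uniq ?index_enum_uniq// => i.
    by rewrite inE /= mem_index_enum.
  apply: eq_bigr => k _; rewrite -fine_probabilityC; last exact: increment_set_measurable.
  rewrite fineK; last by apply: fin_num_measure; apply: measurableC; exact: increment_set_measurable.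
  by congr (P _); apply/seteqP; split => w /=; rewrite leNgt => /negP.
move=> ->; elim: (index_enum _) => [|k r IH]; first by rewrite !big_nil.
by rewrite !big_cons fineM ?IH// -?EFinM; elim: r {IH} => [|k' r IH]; rewrite ?big_nil// big_cons fin_numM.
Qed.

(* The product of the [1 - p_k] is the probability that no increment exceeds the
   threshold, which tends to 1, and [prod (1 - p_k) * (1 + sum p_k) <= 1]. *)
Lemma sum_increment_tail (c : R) : 0 < c -> forall e, 0 < e -> \forall n \near \oo,
  \sum_(k < n) fine (P [set w | c < sqn (increment B n k w)]) <= e.
Proof.
move=> c0 e e0; have [_ _ cB _ _] := B_bm.
pose D n := [set w | forall k : 'I_n, sqn (increment B n k w) <= c].
have mD n : measurable (D n).
  rewrite (_ : D n = \bigcap_(k in [set: 'I_n]) ~` [set w | c < sqn (increment B n k w)]).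
    by apply: fin_bigcap_measurable => // k _; apply: measurableC; exact: increment_set_measurable.
  apply/seteqP; split => w /= H k; first by move=> _; rewrite /= ltNge H.
  by rewrite leNgt; apply/negP; exact: H.
have : (fun n => \int[P]_w \1_(D n) w) @ \oo --> \int[P]_w (1 : R).
  apply: (@Rintegral_dominated_cvg _ _ _ P (fun n => \1_(D n)) (fun=> 1) (fun=> 1)) => //.
  - move=> w; apply: cvg_near_cst.
    have [dl dl0 H] : exists2 dl : R, 0 < dl & forall s t, 0 <= s <= 1 -> 0 <= t <= 1 ->
       `|s - t| <= dl -> enorm (B s w - B t w) <= Num.sqrt c.
      by apply: (@path_uniform _ _ (fun u => B u w)) => //; rewrite sqrtr_gt0.
    near=> n; rewrite indicE mem_set// => k; rewrite -sqr_enorm -[leRHS]sqr_sqrtr ?(ltW c0)//.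
    rewrite lerXn2r ?nnegrE ?sqrtr_ge0//; apply: H; try exact: grid01.
    rewrite gridS// ger0_norm ?invr_ge0//.
    rewrite -[dl]invrK lef_pV2 ?posrE ?invr_gt0 ?ltr0n//; last exact: leq_ltn_trans (ltn_ord k).
    by near: n; exact: nbhs_infty_ger.
  - by move=> m w; rewrite indicE; case: (_ \in _); rewrite ?normr1 ?normr0.
  - by apply: (@bounded_integrable _ _ _ _ _ 1) => // w; rewrite normr1.
(* The tolerance for which [q >= (1 + e)^-1] and [q * (1 + S) <= 1] give [S <= e]. *)
have q0 : 0 < 1 - (1 + e)^-1 by rewrite subr_gt0 invf_lt1 ?ltr_pwDr// ltrDl.
rewrite Rintegral_cstT => /cvgrPdist_le /(_ _ q0); apply: filterS => n.
rewrite Rintegral_indicator// max_increment_prob; set q := \prod_(k < n) _.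
have p01 (k : 'I_n) : 0 <= fine (P [set w | c < sqn (increment B n k w)]) <= 1.
  rewrite fine_ge0//= -lee_fin fineK ?probability_le1//; last exact: fin_num_measure (increment_set_measurable c n k).
  exact: increment_set_measurable.
have [qq0 qS] := prod_sum_le1 (index_enum 'I_n) p01.
rewrite -/q in qq0 qS; set S := \sum_(k < n) _ in qS *.
move=> H; have {H} q1 : (1 + e)^-1 <= q by move: H; rewrite ler_norml => /andP[_]; lra.
have S0 : 0 <= S by apply: sumr_ge0 => k _; have /andP[] := p01 k.
have H : (1 + e)^-1 * (1 + S) <= 1 by apply: le_trans qS; rewrite ler_wpM2r// addr_ge0.
by move: H; rewrite mulrC ler_pdivrMr ?addr_gt0// mul1r lerD2l.
Unshelve. all: by end_near. Qed.

(* [B 0] vanishes only almost surely. *)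
Definition bridge (u : R) (w : O) : 'rV[R]_d := B u w - B 0 w - u *: (B 1 w - B 0 w).

(** With [x] and [y] free this covers both [bridge] and the process of the theorem, which differ by
    the value of [B 0]. *)
Lemma drifted_path_continuous (x y : 'rV[R]_d) w :
  {within `[0, 1], continuous (fun u => sqn (B u w - x - u *: y))}.
Proof.
have [_ _ cB _ _] := B_bm.
apply/subspace_continuousP => u0 u01.
have /subspace_continuousP /(_ u0 u01) cx := cB w.
apply: cvg_sqn => i; rewrite !mxE.
rewrite (_ : (fun _ => _) = fun u => B u w 0 i - x 0 i - u * y 0 i); last first.
  by apply/funext => u; rewrite !mxE.
apply: cvgB; last first.
  by apply: cvgMr_tmp; apply: cvg_within_filter; exact: cvg_id.
apply: cvgB; last exact: cvg_cst.
exact: (cvg_comp _ _ cx (@coord_continuous R 1 d 0 i (B u0 w))).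
Qed.

Lemma measurable_drifted_path (x y : O -> 'rV[R]_d) u : vmeas x -> vmeas y ->
  0 <= u <= 1 -> measurable_fun [set: O] (fun w => sqn (B u w - x w - u *: y w)).
Proof.
move=> mx my u01; rewrite /sqn; apply: measurable_sum => i; apply: measurable_funX.
rewrite (_ : (fun _ => _) = fun w => B u w 0 i - x w 0 i - u * y w 0 i); last first.
  by apply/funext => w; rewrite !mxE.
apply: measurable_funB; last by apply: measurable_funM => //; exact: my.
by apply: measurable_funB; [exact: (measurable_B B_bm)|exact: mx].
Qed.

Lemma vmeas_path u : 0 <= u <= 1 -> vmeas (B u).
Proof. by move=> u01 i0 i; rewrite (ord1 i0); exact: (measurable_B B_bm). Qed.

Lemma bridge_continuous w : {within `[0, 1], continuous (fun u => sqn (bridge u w))}.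
Proof. exact: drifted_path_continuous. Qed.

Lemma measurable_bridge u : 0 <= u <= 1 ->
  measurable_fun [set: O] (fun w => sqn (bridge u w)).
Proof.
have I0 : 0 <= (0 : R) <= 1 by rewrite lexx ler01.
have I1 : 0 <= (1 : R) <= 1 by rewrite ler01 lexx.
apply: measurable_drifted_path; first exact: vmeas_path.
move=> i0 i; rewrite (_ : (fun _ => _) = fun w => B 1 w i0 i - B 0 w i0 i).
  by apply: measurable_funB; exact: vmeas_path.
by apply/funext => w; rewrite !mxE.
Qed.

Lemma bridge_grid_max (a : R) m :
  [set w | forall j, sqn (row j (path_comb (fun _ : 'I_m.+1 => 0) (fun j => grid R m j)
     (fun j => grid R m j) w)) <= a] =
  [set w | grid_max (fun u w => sqn (bridge u w)) m w <= a].
Proof.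
have E w (j : 'I_m.+1) : row j (path_comb (fun=> 0) (fun j => grid R m j)
     (fun j => grid R m j) w) = bridge (grid R m j) w.
  by apply/rowP => i; rewrite !mxE.
apply/seteqP; split => w /=.
  move=> H; apply/bigmax_leP; split=> [|j _]; last by rewrite -E.
  by have := H ord0; rewrite E (_ : grid R m ord0 = 0)// /grid/= min0n mul0r.
by move=> /bigmax_leP[_ H] j; rewrite E; exact: H.
Qed.
End brownian_limits.

(** * Partial sums against the Brownian bridge *)

Section blocks.
Local Open Scope nat_scope.

Definition block (m n j : nat) : nat := (j * n) %/ m.

Lemma block0 m n : block m n 0 = 0.
Proof. by rewrite /block mul0n div0n. Qed.

Lemma block_last m n : 0 < m -> block m n m = n.
Proof. by move=> m0; rewrite /block mulKn. Qed.

Lemma leq_block m n i j : i <= j -> block m n i <= block m n j.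
Proof. by move=> ij; apply: leq_div2r; rewrite leq_mul2r ij orbT. Qed.

Lemma block_le m n j : j <= m -> block m n j <= n.
Proof.
case: m => [|m] jm; first by rewrite /block divn0.
by rewrite -[X in _ <= X](@block_last m.+1)//; exact: leq_block.
Qed.

Lemma block_size m n j : block m n j.+1 <= block m n j + (n %/ m).+1.
Proof.
case: m => [|m]; first by rewrite /block !divn0.
have E1 := divn_eq (j * n) m.+1; have E2 := divn_eq n m.+1.
have H1 : (j * n) %% m.+1 < m.+1 by rewrite ltn_mod.
have H2 : n %% m.+1 < m.+1 by rewrite ltn_mod.
rewrite /block mulSn -ltnS ltn_divLR//.
set q1 := (j * n) %/ m.+1 in E1 *; set q2 := n %/ m.+1 in E2 *.
rewrite [X in _ + X]E1 [X in X + _]E2; nia.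
Qed.

Lemma block_ex m n k : 0 < m -> k <= n ->
  exists2 j, j < m & block m n j <= k <= block m n j.+1.
Proof.
move=> m0 kn; have {m0 kn} : 0 < m /\ k <= block m n m by rewrite block_last.
elim: {1 3 4}m => [[]//|p IH [_ kp]].
case: (leqP (block m n p) k) => [pk|kp']; first by exists p; rewrite ?pk.
case: p IH kp kp' => [|p] IH kp kp'; first by rewrite block0 in kp'.
have [j jp kj] := IH (conj isT (ltnW kp')).
by exists j => //; exact: ltnW.
Qed.
End blocks.

(** Rounding [j * n / m] down moves the time by less than [1 / n]. *)
Lemma block_cvg (R : realType) (m j : nat) : (0 < m)%N -> (j <= m)%N ->
  grid R n (block m n j) @[n --> \oo] --> grid R m j.
Proof.
move=> m0 jm; apply/cvgrPdist_le => e e0; near=> n.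
have n0 : (0 < n)%N by near: n; exact: nbhs_infty_gt.
rewrite !gridE// ?block_le//.
have n0' : 0 < n%:R :> R by rewrite ltr0n.
have m0' : 0 < m%:R :> R by rewrite ltr0n.
have E : (j * n)%:R = (block m n j)%:R * m%:R + ((j * n) %% m)%:R :> R.
  by rewrite -natrM -natrD -divn_eq.
have -> : j%:R / m%:R - (block m n j)%:R / n%:R = ((j * n) %% m)%:R / m%:R / n%:R :> R.
  rewrite natrM in E; have -> : ((j * n) %% m)%:R = j%:R * n%:R - (block m n j)%:R * m%:R :> R by rewrite E addrC addKr.
  by field; rewrite !gt_eqF.
rewrite ger0_norm ?divr_ge0//; apply: (@le_trans _ _ (n%:R^-1)).
  rewrite ler_piMl ?invr_ge0// ler_pdivrMr// mul1r ler_nat; apply: ltnW; exact: ltn_pmod.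
rewrite -[e]invrK lef_pV2 ?posrE ?invr_gt0//.
by near: n; exact: nbhs_infty_ger.
Unshelve. all: by end_near. Qed.

Section partial_sums.
Context (R : realType) (d : nat) (dO dT : measure_display)
  (O : measurableType dO) (T : measurableType dT) (P : probability O R)
  (X : nat -> O -> T) (phi : T -> 'rV[R]_d).
Hypotheses (mX : forall k, measurable_fun [set: O] (X k))
  (iX : mutually_independent P X) (mphi : vmeas phi).

Let z k w := phi (X k w).
(** Identical distribution enters through these three facts, which make every bound uniform in
    [k]. *)
Hypotheses (cz : forall k, centered_with_cov P 1 (z k))
  (tz : forall k c, trunc_moment P (z k) c = trunc_moment P (z 0%N) c)
  (nz : forall k, \int[P]_w norm1 (z k w) ^+ 2 = \int[P]_w norm1 (z 0%N w) ^+ 2).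

Definition psum n i l w : 'rV[R]_d :=
  \sum_(i <= k < l) ((Num.sqrt n%:R)^-1 *: phi (X k w)).

Definition psum_bridge n k w : 'rV[R]_d :=
  psum n 0 k w - grid R n k *: psum n 0 n w.

Let y n k w : 'rV[R]_d := (Num.sqrt n%:R)^-1 *: z k w.

Let mz k i : measurable_fun [set: O] (fun w => z k w 0 i).
Proof. by have [sz _ _] := cz k; exact: (sz i).1. Qed.

Let vy n k : vmeas (y n k).
Proof.
move=> i0 i; rewrite (_ : (fun _ => _) = fun w => (Num.sqrt n%:R)^-1 * z k w 0 i).
  by apply: measurable_funM.
by apply/funext => w; rewrite mxE (ord1 i0).
Qed.

Lemma scaled_adapted_indep c n : adapted_indep_l P n (fun k w => c *: z k w).
Proof.
move=> J s k _.
have mF i : vmeas (fun x : T => s i *m (c *: phi x)).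
  apply: vmeas_mul => j; rewrite (_ : (fun _ => _) = fun w => c * phi w 0 j).
    by apply: measurable_funM => //; exact: (mphi 0 j).
  by apply/funext => w; rewrite mxE.
have ne i : (i < k)%N -> id i != k by move=> ik; rewrite ltn_eqF.
by have [] := indep_vectors_family mX iX mF ne.
Qed.

Lemma scaled_centered n k : (0 < n)%N -> centered_with_cov P n%:R^-1 (y n k).
Proof.
move=> n0; have := centered_scale (Num.sqrt n%:R)^-1 (cz k).
by rewrite mulr1 exprVn sqr_sqrtr.
Qed.

Lemma scaled_norm1_sqr n k : (0 < n)%N ->
  \int[P]_w norm1 (y n k w) ^+ 2 = n%:R^-1 * \int[P]_w norm1 (z 0%N w) ^+ 2.
Proof.
move=> n0; rewrite -(nz k) -RintegralZl//; last first.
  by have [sz _ _] := cz k; exact: integrable_norm1_sqr.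
apply: eq_Rintegral => w _.
by rewrite norm1Z ger0_norm ?invr_ge0 ?sqrtr_ge0// exprMn exprVn sqr_sqrtr.
Qed.

Context (dB : measure_display) (OB : measurableType dB) (P' : probability OB R)
  (B : R -> OB -> 'rV[R]_d).
Hypothesis B_bm : standard_brownian_motion P' B.

(** Two comparisons. At fixed [n] the summands are exchanged for the increments of [B] over the grid
    of mesh [1 / n], whose weighted sum is exactly a [path_comb]; then the continuity of the paths
    moves its times and drifts to their limits. *)
Lemma weighted_sum_clt J (a b : R) (l h : nat -> 'I_J -> nat) (c : nat -> 'I_J -> R)
    (lo hi c' : 'I_J -> R) :
  (forall n j, (l n j <= h n j <= n)%N) -> (forall n j, 0 <= c n j <= 1) ->
  (forall j, 0 <= lo j <= 1) -> (forall j, 0 <= hi j <= 1) ->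
  (forall j, grid R n (l n j) @[n --> \oo] --> lo j) ->
  (forall j, grid R n (h n j) @[n --> \oo] --> hi j) ->
  (forall j, c n j @[n --> \oo] --> c' j) ->
  (fun n => \int[P]_w step_prod a b (\sum_(k < n) weights (l n) (h n) (c n) k *m y n k w))
    @ \oo --> \int[P']_w step_prod a b (path_comb B lo hi c' w).
Proof.
move=> lh c01 lo01 hi01 clo chi cc.
have C1 := @path_comb_cvg _ _ _ _ _ _ B_bm J a b (fun n j => grid R n (l n j))
  (fun n j => grid R n (h n j)) c lo hi c' (fun n j => grid01 R n _)
  (fun n j => grid01 R n _) lo01 hi01 clo chi cc.
have dz : (1 + 3 * @jet_prod_bound R J a b) *
   (trunc_moment P (z 0%N) (Num.sqrt n%:R)^-1 + gaussian_rho_bound R d * (Num.sqrt n%:R)^-1)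
   @[n --> \oo] --> (0 : R).
  rewrite -(mulr0 (1 + 3 * jet_prod_bound J a b)); apply: cvgMl_tmp.
  rewrite -(addr0 0); apply: cvgD; first by apply: trunc_moment_cvg0; have [] := cz 0%N.
  by rewrite -(mulr0 (gaussian_rho_bound R d)); apply: cvgMl_tmp; exact: invsqrt_cvg0.
apply/cvgrPdist_le => e e0.
have e2 : 0 < e / 2 by rewrite divr_gt0.
move/cvgrPdist_le : C1 => /(_ _ e2) C1; move/cvgrPdist_le : dz => /(_ _ e2) dz.
near=> n.
have n0 : (0 < n)%N by near: n; exact: nbhs_infty_gt.
have n0' : 0 < n%:R :> R by rewrite ltr0n.
have s0 : 0 < Num.sqrt n%:R :> R by rewrite sqrtr_gt0.
have ss : (Num.sqrt n%:R)^-1 ^+ 2 = n%:R^-1 :> R by rewrite exprVn sqr_sqrtr.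
have N1 : `|\int[P']_w step_prod a b (path_comb B lo hi c' w) -
   \int[P']_w step_prod a b (path_comb B (fun j => grid R n (l n j)) (fun j => grid R n (h n j)) (c n) w)| <= e / 2.
  by near: n; exact: C1.
have N2 : `|0 - (1 + 3 * @jet_prod_bound R J a b) *
   (trunc_moment P (z 0%N) (Num.sqrt n%:R)^-1 + gaussian_rho_bound R d * (Num.sqrt n%:R)^-1)| <= e / 2.
  by near: n; exact: dz.
(* The cost of one exchange. The factor [n] turns it into the sequence of [dz], which tends to 0. *)
pose en := n%:R^-1 * trunc_moment P (z 0%N) (Num.sqrt n%:R)^-1 +
   gaussian_rho_bound R d * (Num.sqrt n%:R)^-1 ^+ 3.
have N3 : `|\int[P]_w step_prod a b (\sum_(k < n) weights (l n) (h n) (c n) k *m y n k w) -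
   \int[P']_w step_prod a b (\sum_(k < n) weights (l n) (h n) (c n) k *m increment B n k w)| <=
   n%:R * ((1 + 3 * @jet_prod_bound R J a b) * en).
  apply: (@clt_comparison R d J _ _ _ _ P P' n (y n) (increment B n) n%:R^-1 en a b).
  - by move=> k _; exact: scaled_centered.
  - move=> k kn; apply: gaussian_centered_with_cov; rewrite ?invr_gt0//.
      by move=> i; exact: (measurable_increment B_bm).
    exact: (increment_gaussian B_bm).
  - move=> k kn; apply: lerD.
      rewrite Rintegral_rho_scale ?invr_ge0 ?sqrtr_ge0//; last by have [] := cz k.
      by rewrite ss tz.
    rewrite -sqrtrV ?ler0n//; apply: gaussian_rho; rewrite ?invr_gt0//.
      by move=> i; exact: (measurable_increment B_bm).
    exact: (increment_gaussian B_bm).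
  - exact: scaled_adapted_indep.
  - exact: (increment_adapted_indep B_bm).
  - by move=> k j; exact: weights_le1.
have En : n%:R * ((1 + 3 * @jet_prod_bound R J a b) * en) = (1 + 3 * @jet_prod_bound R J a b) *
   (trunc_moment P (z 0%N) (Num.sqrt n%:R)^-1 + gaussian_rho_bound R d * (Num.sqrt n%:R)^-1).
  rewrite /en exprS ss mulrCA; congr (_ * _).
  by field; rewrite !gt_eqF.
rewrite En in N3.
rewrite sub0r normrN in N2; have {N2} N2 := le_trans (ler_norm _) N2.
rewrite (_ : (fun w => step_prod a b (path_comb B (fun j => grid R n (l n j)) _ _ w)) =
  (fun w => step_prod a b (\sum_(k < n) weights (l n) (h n) (c n) k *m increment B n k w))) in N1; last first.
  by apply/funext => w; rewrite weighted_increments.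
rewrite distrC in N3.
by rewrite [leRHS]splitr; apply: le_trans (ler_distD _ _ _) _; apply: lerD; [exact: N1|exact: le_trans N3 N2].
Unshelve. all: by end_near. Qed.

Lemma row_weighted_psum J n (l h : 'I_J -> nat) (c : 'I_J -> R) j w :
  (l j <= h j <= n)%N ->
  row j (\sum_(k < n) weights l h c k *m y n k w) = psum n (l j) (h j) w - c j *: psum n 0 n w.
Proof. by move=> lh; rewrite (@row_weighted_sum R J d l h c n (fun k => y n k w) j lh). Qed.

Lemma vmeas_psum n i l : vmeas (psum n i l).
Proof. by apply: vmeas_sum_nat => k _; exact: vy. Qed.

Lemma vmeas_weighted_psum J n (l h : 'I_J -> nat) (c : 'I_J -> R) :
  vmeas (fun w => \sum_(k < n) weights l h c k *m y n k w).
Proof.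
apply: (@vmeas_sum R J d _ _ (fun k w => weights l h c k *m y n k w)) => k _.
by apply: vmeas_mul => i; exact: (@vy n k 0 i).
Qed.

Lemma measurable_sqn_psum_bridge n k :
  measurable_fun [set: O] (fun w => sqn (psum_bridge n k w)).
Proof.
rewrite /sqn; apply: measurable_sum => i; apply: measurable_funX.
rewrite (_ : (fun _ => _) = fun w => psum n 0 k w 0 i - grid R n k * psum n 0 n w 0 i).
  apply: measurable_funB; first exact: (@vmeas_psum n 0 k 0 i).
  by apply: measurable_funM => //; exact: (@vmeas_psum n 0 n 0 i).
by apply/funext => w; rewrite !mxE.
Qed.

Lemma measurable_psum_bridge_le n (a : R) :
  measurable [set w | forall k : 'I_n.+1, sqn (psum_bridge n k w) <= a].
Proof.
rewrite (_ : [set w | _] = \bigcap_(k in [set: 'I_n.+1]) [set w | sqn (psum_bridge n k w) <= a]).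
  apply: fin_bigcap_measurable => // k _.
  rewrite -[X in measurable X]setTI; apply: measurable_fun_ler => //.
  exact: measurable_sqn_psum_bridge.
by apply/seteqP; split => w /= H k; [move=> _|]; exact: H.
Qed.

Let W m n w : 'M[R]_(m.+1, d) := \sum_(k < n)
  weights (fun=> 0%N) (fun j : 'I_m.+1 => block m n j) (fun j => grid R n (block m n j)) k *m y n k w.

Let rowW m n j w : row j (W m n w) = psum_bridge n (block m n j) w.
Proof. by rewrite /W row_weighted_psum// block_le// -ltnS. Qed.

Let cvgW m a b : (0 < m)%N -> \int[P]_w step_prod a b (W m n w) @[n --> \oo] -->
  \int[P']_w step_prod a b (path_comb B (fun _ : 'I_m.+1 => 0) (fun j => grid R m j) (fun j => grid R m j) w).
Proof.
move=> m0; apply: weighted_sum_clt => [n j|n j|j|j|j|j|j].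
- by rewrite leq0n block_le// -ltnS.
- exact: grid01.
- by rewrite lexx ler01.
- exact: grid01.
- rewrite (_ : (fun _ => _) = fun=> 0); first exact: cvg_cst.
  by apply/funext => n; rewrite gridE// mul0r.
- by apply: block_cvg => //; rewrite -ltnS.
- by apply: block_cvg => //; rewrite -ltnS.
Qed.

Let BS := path_sup (fun u w => sqn (bridge B u w)).

(** The half that needs no control between grid points: restricting to the grid only enlarges the
    event. The cut-off uses the gap from [a] to [a1] and the passage from the grid to the whole path
    that from [a1] to [b]; each limit costs [e / 2]. *)
Lemma psum_bridge_prob_le (a b e : R) : 0 <= a -> a < b -> 0 < e ->
  \forall n \near \oo,
  fine (P [set w | forall k : 'I_n.+1, sqn (psum_bridge n k w) <= a]) <=
  fine (P' [set w | BS w <= b]) + e.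
Proof.
move=> a0 ab e0; pose a1 := (a + b) / 2.
have a1a : a < a1 by rewrite /a1; lra.
have a1b : a1 < b by rewrite /a1; lra.
have e2 : 0 < e / 2 by rewrite divr_gt0.
have := grid_max_prob (@bridge_continuous _ _ _ _ _ _ B_bm)
  (@measurable_bridge _ _ _ _ _ _ B_bm) P' a1b e2.
move=> /(filterI (nbhs_infty_gt 0)) /filter_ex[m [m0 Hm]].
have /cvgrPdist_le /(_ _ e2) := @cvgW m a a1 m0.
apply: filterS => n; rewrite distrC ler_norml => /andP[_ H].
have S1 := step_le_prob P' a0 a1a
  (@vmeas_path_comb _ _ _ _ _ _ B_bm m.+1 (fun=> 0) (fun j => grid R m j) (fun j => grid R m j)
   (fun=> ltac:(by rewrite lexx ler01)) (fun j => grid01 R m j)).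
rewrite bridge_grid_max in S1.
have S2 := prob_le_step P a0 a1a (@vmeas_weighted_psum m.+1 n (fun=> 0%N) (fun j => block m n j) (fun j => grid R n (block m n j))).
have S3 : fine (P [set w | forall k : 'I_n.+1, sqn (psum_bridge n k w) <= a]) <=
   fine (P [set w | forall j, sqn (row j (W m n w)) <= a]).
  apply: fine_probability_le.
  - exact: measurable_psum_bridge_le.
  - by apply: measurable_all_sqn_le; exact: vmeas_weighted_psum.
  move=> w /= Hw j; rewrite rowW.
  have bn : (block m n j < n.+1)%N by rewrite ltnS block_le// -ltnS.
  exact: (Hw (Ordinal bn)).
rewrite -/(W m n) in S2.
apply: (le_trans S3); apply: (le_trans S2).
move: H Hm S1; rewrite /BS; lra.
Qed.

(** * Oscillation of the partial sums within blocks *)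

Definition block_oscillates m n j (c : R) := [set w |
  exists2 k, (block m n j <= k <= block m n j.+1)%N & c < enorm (psum n (block m n j) k w)].

Definition oscillates m n (c : R) := \big[setU/set0]_(j < m) block_oscillates m n j c.

Let measurable_enorm_psum n i l c : measurable [set w | c < enorm (psum n i l w)].
Proof.
rewrite -[X in measurable X]setTI; apply: measurable_fun_ltr => //.
by apply: measurable_enorm; exact: vmeas_psum.
Qed.

Lemma measurable_block_oscillates m n j c : measurable (block_oscillates m n j c).
Proof.
have -> : block_oscillates m n j c = \big[setU/set0]_(k < (block m n j.+1).+1)
   if (block m n j <= k)%N then [set w | c < enorm (psum n (block m n j) k w)] else set0.
  apply/seteqP; split => w.
    move=> [k /andP[jk kj] H]; rewrite -bigcup_seq; have kj' : (k < (block m n j.+1).+1)%N by [].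
    by exists (Ordinal kj'); rewrite /= ?mem_index_enum// jk.
  rewrite -bigcup_seq => -[k _] /=; case: ifP => // jk H.
  by exists k => //; rewrite jk -ltnS ltn_ord.
apply: bigsetU_measurable => k _.
by case: ifP => _ //; exact: measurable_enorm_psum.
Qed.

Lemma measurable_oscillates m n c : measurable (oscillates m n c).
Proof. by apply: bigsetU_measurable => j _; exact: measurable_block_oscillates. Qed.

(** A stretch inside one block has at most [n %/ m + 1], hence at most [2 * n / m], summands with
    second moment [m2 / n], so [partial_sum_tail] gives at most [2 * K / m]. This is at most 1/2
    once [m >= 4 * K], uniformly in [n >= m]. *)
Lemma psum_tail_half (c : R) : 0 < c -> \forall m \near \oo, forall n, (m <= n)%N ->
  forall j, (j < m)%N -> forall k, (block m n j <= k <= block m n j.+1)%N ->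
  fine (P [set w | c < enorm (psum n k (block m n j.+1) w)]) <= 1 / 2.
Proof.
move=> c0; pose m2 := \int[P]_w norm1 (z 0%N w) ^+ 2.
pose K := (1 + 4 * @jet_prod_bound R 1 0 (c ^+ 2)) * m2.
have c2 : 0 < c ^+ 2 by rewrite exprn_gt0.
have J0 : 0 <= @jet_prod_bound R 1 0 (c ^+ 2).
  by apply: jet_ge0; exact: (@jet_step_prod R d 1 0 (c ^+ 2) 0 0 ltac:(by move=> j; rewrite mxE normr0)).
have m20 : 0 <= m2 by apply: Rintegral_ge0 => w _; exact: sqr_ge0.
have K0 : 0 <= K by rewrite mulr_ge0// addr_ge0// mulr_ge0.
near=> m => n mn j jm k /andP[jk kj].
have m0 : (0 < m)%N by near: m; exact: nbhs_infty_gt.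
have n0 : (0 < n)%N by exact: leq_trans mn.
have m0' : 0 < m%:R :> R by rewrite ltr0n.
have n0' : 0 < n%:R :> R by rewrite ltr0n.
have mK : 4 * K <= m%:R by near: m; exact: nbhs_infty_ger.
have H := @partial_sum_tail R d _ _ P k (block m n j.+1) (y n) n%:R^-1 (c ^+ 2) (n%:R^-1 * m2) kj c2
  (fun i _ => scaled_centered i n0) (fun i _ => ltac:(by rewrite scaled_norm1_sqr)) (@scaled_adapted_indep _ _).
rewrite (_ : [set w | c < _] = [set w | c ^+ 2 < sqn (\sum_(k <= i < block m n j.+1) y n i w)]); last first.
  by apply/seteqP; split => w /=; rewrite enorm_gt_sqn// ltW.
apply: (le_trans H); have E : (1 + 4 * @jet_prod_bound R 1 0 (c ^+ 2)) * (n%:R^-1 * m2) = n%:R^-1 * K.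
  by rewrite /K; ring.
rewrite E; set L := (block m n j.+1 - k)%N.
have Lm : L%:R * m%:R <= 2 * n%:R :> R.
  rewrite -!natrM ler_nat /L; have := block_size m n j; have := leq_trunc_div n m.
  move: jk; move: (block m n j) (block m n j.+1) (n %/ m)%N => b1 b2 q; nia.
rewrite mulrCA ler_pdivrMl//; have L0 : 0 <= L%:R :> R by [].
move: Lm mK L0 K0; nra.
Unshelve. all: by end_near. Qed.

(** A central limit comparison with a single row and no drift. The cut-off acts between the levels
    [(c / 2) ^+ 2] and [c ^+ 2], hence the halved threshold on the Brownian side. *)
Lemma block_tail (c : R) m j : 0 < c -> (j < m)%N -> forall e, 0 < e -> \forall n \near \oo,
  fine (P [set w | c < enorm (psum n (block m n j) (block m n j.+1) w)]) <=
  fine (P' [set w | (c / 2) ^+ 2 < sqn (increment B m j w)]) + e.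
Proof.
move=> c0 jm e e0; have m0 : (0 < m)%N by exact: leq_ltn_trans jm.
have a0 : 0 <= (c / 2) ^+ 2 by exact: sqr_ge0.
have ab : (c / 2) ^+ 2 < c ^+ 2 by rewrite ltrXn2r// ?nnegrE; lra.
have lim : \int[P]_w step_prod ((c / 2) ^+ 2) (c ^+ 2) (\sum_(k < n)
    weights (fun _ : 'I_1 => block m n j) (fun=> block m n j.+1) (fun=> 0) k *m y n k w) @[n --> \oo] -->
  \int[P']_w step_prod ((c / 2) ^+ 2) (c ^+ 2)
    (path_comb B (fun _ : 'I_1 => grid R m j) (fun=> grid R m j.+1) (fun=> 0) w).
  apply: weighted_sum_clt => [n _|n _|_|_|_|_|_].
  - by rewrite leq_block// block_le.
  - by rewrite lexx ler01.
  - exact: grid01.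
  - exact: grid01.
  - by apply: block_cvg => //; exact: ltnW.
  - by apply: block_cvg.
  - exact: cvg_cst.
have S1 := prob_le_step P' a0 ab
  (@vmeas_path_comb _ _ _ _ _ _ B_bm 1 (fun=> grid R m j) (fun=> grid R m j.+1) (fun=> 0)
   (fun=> grid01 R m _) (fun=> grid01 R m _)).
have E1 : [set w | forall j0, sqn (row j0 (path_comb B (fun _ : 'I_1 => grid R m j)
    (fun=> grid R m j.+1) (fun=> 0) w)) <= (c / 2) ^+ 2] =
    ~` [set w | (c / 2) ^+ 2 < sqn (increment B m j w)].
  have E w (j0 : 'I_1) : row j0 (path_comb B (fun _ : 'I_1 => grid R m j)
    (fun=> grid R m j.+1) (fun=> 0) w) = increment B m j w.
    by apply/rowP => i; rewrite !mxE mul0r subr0.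
  apply/seteqP; split => w /= H; first by rewrite ltNge -(E w 0) H.
  by move=> j0; rewrite E leNgt; apply/negP.
rewrite E1 fine_probabilityC in S1; last exact: (increment_set_measurable B_bm).
move/cvgrPdist_le : lim => /(_ _ e0); apply: filterS => n; rewrite ler_norml => /andP[_ H].
have S2 := step_le_prob P a0 ab (@vmeas_weighted_psum 1 n (fun=> block m n j) (fun=> block m n j.+1) (fun=> 0)).
have E2 : [set w | forall j0, sqn (row j0 (\sum_(k < n)
    weights (fun _ : 'I_1 => block m n j) (fun=> block m n j.+1) (fun=> 0) k *m y n k w)) <= c ^+ 2] =
    ~` [set w | c < enorm (psum n (block m n j) (block m n j.+1) w)].
  have E w (j0 : 'I_1) : row j0 (\sum_(k < n) weights (fun _ : 'I_1 => block m n j)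
      (fun=> block m n j.+1) (fun=> 0) k *m y n k w) = psum n (block m n j) (block m n j.+1) w.
    by rewrite row_weighted_psum ?leq_block ?block_le// scale0r subr0.
  apply/seteqP; split => w /= H'; first by rewrite enorm_gt_sqn ?(ltW c0)// ltNge -(E w 0) H'.
  by move=> j0; rewrite E leNgt -enorm_gt_sqn ?(ltW c0)//; apply/negP.
rewrite E2 fine_probabilityC in S2; last exact: measurable_enorm_psum.
by move: S1 S2 H; lra.
Qed.

(** A union bound over the [m] blocks. Ottaviani's inequality contributes a factor 2,
    [sum_increment_tail] a total of [e / 4], and [block_tail] an error [e / 4 / m] for each block;
    the mesh is fixed before [n] grows. *)
Lemma psum_oscillation (c : R) : 0 < c -> forall e, 0 < e ->
  \forall m \near \oo, \forall n \near \oo, fine (P (oscillates m n (2 * c))) <= e.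
Proof.
move=> c0 e e0; have c2 : 0 < (c / 2) ^+ 2 by rewrite exprn_gt0 ?divr_gt0.
have e4 : 0 < e / 4 by rewrite divr_gt0.
near=> m.
have m0 : (0 < m)%N by near: m; exact: nbhs_infty_gt.
have half : forall n, (m <= n)%N ->
  forall j, (j < m)%N -> forall k, (block m n j <= k <= block m n j.+1)%N ->
  fine (P [set w | c < enorm (psum n k (block m n j.+1) w)]) <= 1 / 2.
  by near: m; exact: psum_tail_half.
have sumB : \sum_(j < m) fine (P' [set w | (c / 2) ^+ 2 < sqn (increment B m j w)]) <= e / 4.
  by near: m; exact: (sum_increment_tail B_bm).
have m0' : 0 < m%:R :> R by rewrite ltr0n.
have e4m : 0 < e / 4 / m%:R by rewrite divr_gt0.
near=> n.
have mn : (m <= n)%N by near: n; exact: nbhs_infty_ge.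
have tails : forall j : 'I_m, fine (P [set w | c < enorm (psum n (block m n j) (block m n j.+1) w)]) <=
  fine (P' [set w | (c / 2) ^+ 2 < sqn (increment B m j w)]) + e / 4 / m%:R.
  by near: n; apply: filter_forall => j; exact: block_tail.
apply: (le_trans (fine_probability_bigU_le P _ (fun j : 'I_m => measurable_block_oscillates m n j _))).
apply: (@le_trans _ _ (\sum_(j < m) 2 * (fine (P' [set w | (c / 2) ^+ 2 < sqn (increment B m j w)]) + e / 4 / m%:R))).
  apply: ler_sum => j _; apply: (@le_trans _ _ (2 * fine (P [set w | c < enorm (psum n (block m n j) (block m n j.+1) w)]))).
    apply: (@Ottaviani_inequality R d _ _ O T P X (fun _ x => (Num.sqrt n%:R)^-1 *: phi x)) => //.
    - move=> _ i0 i; rewrite (_ : (fun _ => _) = fun w => (Num.sqrt n%:R)^-1 * phi w i0 i).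
        by apply: measurable_funM => //; exact: mphi.
      by apply/funext => w; rewrite mxE.
    - exact: leq_block.
    - exact: ltW.
    - by move=> k kj; exact: half.
  by rewrite ler_wpM2l.
rewrite -mulr_sumr big_split/= sumr_const card_ord.
have -> : (e / 4 / m%:R) *+ m = e / 4 by rewrite -mulr_natr divfK ?gt_eqF.
by move: sumB; lra.
Unshelve. all: by end_near. Qed.

Lemma psum_cat n i k l w : (i <= k <= l)%N -> psum n i l w = psum n i k w + psum n k l w.
Proof. by move=> /andP[ik kl]; rewrite /psum (big_cat_nat _ kl). Qed.

(** One [c] is for the position inside the block. The drift changes by at most [(n / m + 1) / n]
    times the norm of the total sum, which is at most [m * c] when added up block by block; as
    [m <= n], this is at most [2 * c]. *)
Lemma psum_bridge_oscillation m n (a c : R) w : (0 < m)%N -> (m <= n)%N -> 0 <= c -> 0 <= a ->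
  ~ oscillates m n c w -> (forall j, (j <= m)%N -> enorm (psum_bridge n (block m n j) w) <= a) ->
  forall k, (k <= n)%N -> enorm (psum_bridge n k w) <= a + 3 * c.
Proof.
move=> m0 mn c0 a0 Hosc Hgrid k kn.
have osc j k' : (j < m)%N -> (block m n j <= k' <= block m n j.+1)%N ->
    enorm (psum n (block m n j) k' w) <= c.
  move=> jm jk; rewrite leNgt; apply/negP => H; apply: Hosc.
  rewrite /oscillates -bigcup_seq; exists (Ordinal jm); first by rewrite /= mem_index_enum.
  by exists k'.
have total p : (p <= m)%N -> enorm (psum n 0 (block m n p) w) <= p%:R * c.
  elim: p => [|p IH] pm.
    by rewrite block0 /psum big_geq// mul0r /enorm big1 ?sqrtr0// => i _; rewrite mxE expr0n.
  rewrite (@psum_cat n 0 (block m n p) (block m n p.+1)) ?leq_block//.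
  rewrite -natr1 mulrDl mul1r; apply: (le_trans (enormD _ _)); apply: lerD; first exact: IH (ltnW pm).
  by apply: osc => //; rewrite leq_block//=.
have := total m (leqnn m); rewrite block_last// => tot.
have [j jm /andP[jk kj]] := block_ex m0 kn.
have -> : psum_bridge n k w = psum_bridge n (block m n j) w + (psum n (block m n j) k w -
   (grid R n k - grid R n (block m n j)) *: psum n 0 n w).
  rewrite /psum_bridge (@psum_cat n 0 (block m n j) k) ?jk// scalerBl.
  by apply/rowP => i; rewrite !mxE; ring.
apply: (le_trans (enormD _ _)); apply: lerD; first exact: Hgrid (ltnW jm).
apply: (le_trans (enormD _ _)); rewrite enormN enormZ.
rewrite (_ : 3 * c = c + 2 * c); last by ring.
apply: lerD; first by apply: osc => //; rewrite jk.
have m0' : 0 < m%:R :> R by rewrite ltr0n.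
have n0 : (0 < n)%N by exact: leq_trans mn.
have n0' : 0 < n%:R :> R by rewrite ltr0n.
rewrite !gridE ?(leq_trans jk)// -mulrBl -natrB// ger0_norm ?divr_ge0//.
apply: (@le_trans _ _ ((k - block m n j)%:R / n%:R * (m%:R * c))).
  by rewrite ler_wpM2l// divr_ge0.
rewrite mulrA ler_wpM2r// mulrAC ler_pdivrMr// -!natrM ler_nat.
have := block_size m n j; have := leq_trunc_div n m.
move: jk kj mn; move: (block m n j) (block m n j.+1) (n %/ m)%N => b1 b2 q; nia.
Qed.

(** Here control at every index has to be recovered from the grid, at the price of the event
    [oscillates]: the cut-off uses the gap from [a] to [a1], the oscillation that from [a1] to
    [b]. *)
Lemma psum_bridge_prob_ge (a b e : R) : 0 <= a -> a < b -> 0 < e ->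
  \forall n \near \oo,
  fine (P' [set w | BS w <= a]) - e <=
  fine (P [set w | forall k : 'I_n.+1, sqn (psum_bridge n k w) <= b]).
Proof.
move=> a0 ab e0; pose a1 := (a + b) / 2.
have a1a : a < a1 by rewrite /a1; lra.
have a1b : a1 < b by rewrite /a1; lra.
have e2 : 0 < e / 2 by rewrite divr_gt0.
have sab : Num.sqrt a1 < Num.sqrt b by rewrite ltr_sqrt//; exact: le_lt_trans ab.
(* At oscillation level [2 * c] the loss in [psum_bridge_oscillation] is [3 * (2 * c)], exactly the
   gap between the two square roots. *)
pose c := (Num.sqrt b - Num.sqrt a1) / 6.
have c0 : 0 < c by rewrite /c; lra.
have := psum_oscillation c0 e2.
move=> /(filterI (nbhs_infty_gt 0)) /filter_ex[m [m0 Hm]].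
have /cvgrPdist_le /(_ _ e2) := @cvgW m a a1 m0.
apply: filterS3 Hm (nbhs_infty_ge m) => n Hn mn; rewrite ler_norml => /andP[_ H].
have S1 := prob_le_step P' a0 a1a
  (@vmeas_path_comb _ _ _ _ _ _ B_bm m.+1 (fun=> 0) (fun j => grid R m j) (fun j => grid R m j)
   (fun=> ltac:(by rewrite lexx ler01)) (fun j => grid01 R m j)).
rewrite bridge_grid_max in S1.
have S2 := step_le_prob P a0 a1a (@vmeas_weighted_psum m.+1 n (fun=> 0%N) (fun j => block m n j) (fun j => grid R n (block m n j))).
have mcg := @bridge_continuous _ _ _ _ _ _ B_bm.
have mmg := @measurable_bridge _ _ _ _ _ _ B_bm.
have S0 : fine (P' [set w | BS w <= a]) <= fine (P' [set w | grid_max (fun u w => sqn (bridge B u w)) m w <= a]).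
  apply: fine_probability_le.
  - rewrite -[X in measurable X]setTI; apply: measurable_fun_ler => //.
    exact: measurable_path_sup.
  - rewrite -[X in measurable X]setTI; apply: measurable_fun_ler => //.
    exact: measurable_grid_max.
  by move=> w /=; apply: le_trans; exact: grid_max_le.
have mW : measurable [set w | forall j, sqn (row j (W m n w)) <= a1].
  by apply: measurable_all_sqn_le; exact: vmeas_weighted_psum.
have S3 : fine (P [set w | forall j, sqn (row j (W m n w)) <= a1]) <=
   fine (P [set w | forall k : 'I_n.+1, sqn (psum_bridge n k w) <= b]) + fine (P (oscillates m n (2 * c))).
  apply: le_trans (fine_probabilityU_le _ (measurable_psum_bridge_le _ _) (measurable_oscillates _ _ _)).
  apply: fine_probability_le => //.
    by apply: measurableU; [exact: measurable_psum_bridge_le|exact: measurable_oscillates].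
  move=> w /= Hw; have [Ho|Ho] := pselect (oscillates m n (2 * c) w); [by right|left] => k.
  rewrite -(@sqr_sqrtr _ b) -?enorm_le_sqn ?sqrtr_ge0//; last by apply: ltW; apply: le_lt_trans ab.
  rewrite (_ : Num.sqrt b = Num.sqrt a1 + 3 * (2 * c)); last by rewrite /c; field.
  apply: (@psum_bridge_oscillation m n) => //.
  - by rewrite mulr_ge0// ltW.
  - move=> j jm; have jm' : (j < m.+1)%N by [].
    have := Hw (Ordinal jm'); rewrite rowW /= enorm_le_sqn ?sqrtr_ge0// sqr_sqrtr//.
    by apply: ltW; apply: le_lt_trans a1a.
  - by rewrite -ltnS.
rewrite -/(W m n) in S2.
by move: S0 S1 S2 S3 H Hn; lra.
Qed.

End partial_sums.

(** * From distribution functions to convergence in distribution *)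

Section staircase.
Context (R : realType) (f : R -> R) (t : nat -> R) (N : nat).
Hypothesis t_homo : forall i j, (i <= j)%N -> t i <= t j.

(** Takes the value of [f] at the right end of each interval of the partition, and [f (t N)] beyond.
    It is written as a summation by parts so that its mean is a linear combination of values of the
    distribution function. *)
Definition staircase (x : R) : R :=
  f (t N) + \sum_(i < N) (f (t i) - f (t i.+1)) * (x <= t i)%R%:R.

Lemma staircase_ge x : t N < x -> staircase x = f (t N).
Proof.
move=> tx; rewrite /staircase big1 ?addr0// => i _.
by rewrite leNgt (le_lt_trans (t_homo (ltnW (ltn_ord i))) tx) mulr0.
Qed.

Lemma staircase_at x j : (j <= N)%N -> x <= t j -> (forall i, (i < j)%N -> t i < x) ->
  staircase x = f (t j).
Proof.
move=> jN xj xi; rewrite /staircase -(big_mkord xpredT (fun i => (f (t i) - f (t i.+1)) * (x <= t i)%R%:R)).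
rewrite (@big_cat_nat _ _ _ j)//= big_nat_cond big1 ?add0r => [|i /andP[/andP[_ ij] _]]; last first.
  by rewrite leNgt xi// mulr0.
rewrite (@eq_big_nat _ _ _ _ _ _ (fun i => f (t i) - f (t i.+1))) => [|i /andP[ji _]]; last first.
  by rewrite (le_trans xj (t_homo ji)) mulr1.
by rewrite (telescope_sumr_eq (fun i => - f (t i)))//; [ring|move=> i _; ring].
Qed.

Lemma staircase_approx (e : R) : 0 <= e -> t 0%N = 0 ->
  (forall i, (i < N)%N -> forall x, t i <= x <= t i.+1 -> `|f x - f (t i.+1)| <= e) ->
  forall x, 0 <= x <= t N -> `|f x - staircase x| <= e.
Proof.
move=> e0 t0 osc x /andP[x0 xN].
have ex : exists j, (x <= t j) by exists N.
case: (ex_minnP ex) => j xj jmin.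
have jN : (j <= N)%N by exact: jmin.
have ij i : (i < j)%N -> t i < x.
  by move=> ij; rewrite ltNge; apply/negP => /jmin; rewrite leqNgt ij.
rewrite (staircase_at jN xj ij); case: j xj jmin jN ij => [|j] xj jmin jN ij.
  have -> : x = t 0%N by apply/eqP; rewrite eq_le xj t0.
  by rewrite subrr normr0.
by apply: osc => //; rewrite xj andbT ltW// ij.
Qed.
End staircase.

Section portmanteau.
Context (R : realType).

Section staircase_mean.
Context (dO : measure_display) (O : measurableType dO) (P : probability O R)
  (X : O -> R) (f : R -> R) (t : nat -> R) (N : nat).
Hypotheses (mX : measurable_fun [set: O] X)
  (t_homo : forall i j, (i <= j)%N -> t i <= t j).

Lemma measurable_le_set (a : R) : measurable [set w | X w <= a].
Proof. by rewrite -[X in measurable X]setTI; apply: measurable_fun_ler. Qed.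

Lemma Rintegral_staircase : \int[P]_w staircase f t N (X w) =
  f (t N) + \sum_(i < N) (f (t i) - f (t i.+1)) * fine (P [set w | X w <= t i]).
Proof.
have E a : (fun w => (X w <= a)%R%:R : R) = \1_[set w | X w <= a].
  apply/funext => w; rewrite indicE; case: (boolP (X w <= a)) => H.
    by rewrite mem_set.
  by rewrite memNset//; exact/negP.
have iI a : P.-integrable [set: O] (EFin \o (fun w => (X w <= a)%R%:R : R)).
  apply: (@bounded_integrable _ _ _ _ _ 1).
    by rewrite E; apply: measurable_indic; exact: measurable_le_set.
  by move=> w; case: (X w <= a); rewrite /= ?mulr1n ?mulr0n ?normr1 ?normr0.
have iS i := integrable_scale (f (t i) - f (t i.+1)) (iI (t i)).
have iC : P.-integrable [set: O] (EFin \o (fun _ : O => f (t N))).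
  by apply: (@bounded_integrable _ _ _ _ _ `|f (t N)|).
rewrite /staircase (RintegralD measurableT iC (integrable_Rsum _ (fun i : 'I_N => iS i))).
rewrite Rintegral_cstT Rintegral_sum//.
congr (_ + _); apply: eq_bigr => i _; rewrite RintegralZl//.
by rewrite E Rintegral_indicator//; exact: measurable_le_set.
Qed.

Lemma staircase_mean_approx (M e : R) : measurable_fun [set: R] f ->
  (forall x, `|f x| <= M) -> 0 <= e -> t 0%N = 0 ->
  (forall i, (i < N)%N -> forall x, t i <= x <= t i.+1 -> `|f x - f (t i.+1)| <= e) ->
  (forall w, 0 <= X w) ->
  `|\int[P]_w f (X w) - \int[P]_w staircase f t N (X w)| <=
  e + 2 * M * (1 - fine (P [set w | X w <= t N])).
Proof.
move=> mf fM e0 t0 osc X0.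
have M0 : 0 <= M := le_trans (normr_ge0 _) (fM 0).
have mS : measurable_fun [set: O] (fun w => staircase f t N (X w)).
  apply: measurable_funD => //; apply: measurable_sum => i; apply: measurable_funM => //.
  rewrite (_ : (fun _ => _) = \1_[set w | X w <= t i]).
    by apply: measurable_indic; exact: measurable_le_set.
  apply/funext => w; rewrite indicE; case: (boolP (X w <= t i)) => H.
    by rewrite mem_set.
  by rewrite memNset//; exact/negP.
have mfX : measurable_fun [set: O] (fun w => f (X w)) by apply: measurableT_comp.
have D w : `|f (X w) - staircase f t N (X w)| <= e + 2 * M * \1_(~` [set w | X w <= t N]) w.
  rewrite indicE; case: (leP (X w) (t N)) => H.
    rewrite memNset /=; last by rewrite H.
    by rewrite mulr0 addr0; apply: staircase_approx => //; rewrite X0 H.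
  rewrite mem_set /=; last by apply/negP; rewrite -ltNge.
  rewrite mulr1 staircase_ge//; apply: (le_trans (ler_normB _ _)).
  by have := fM (X w); have := fM (t N); lra.
have mC : measurable (~` [set w | X w <= t N]) by apply: measurableC; exact: measurable_le_set.
have iI : P.-integrable [set: O] (EFin \o \1_(~` [set w | X w <= t N])).
  apply: (@bounded_integrable _ _ _ _ _ 1); first exact: measurable_indic.
  by move=> w; rewrite indicE; case: (_ \in _); rewrite ?normr1 ?normr0.
have iC : P.-integrable [set: O] (EFin \o (fun _ : O => e)).
  by apply: (@bounded_integrable _ _ _ _ _ `|e|).
have iR := integrableD measurableT iC (integrable_scale (2 * M) iI).
have iD : P.-integrable [set: O] (EFin \o (fun w => f (X w) - staircase f t N (X w))).
  by apply: (le_integrable_fun _ D iR); apply: measurable_funB.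
have iF : P.-integrable [set: O] (EFin \o (fun w => f (X w))).
  by apply: (@bounded_integrable _ _ _ _ _ M).
have iG : P.-integrable [set: O] (EFin \o (fun w => staircase f t N (X w))).
  rewrite (_ : (fun w => staircase f t N (X w)) = fun w => f (X w) + (-1) * (f (X w) - staircase f t N (X w))).
    exact: (integrableD measurableT iF (integrable_scale (-1) iD)).
  by apply/funext => w; ring.
rewrite -RintegralB//; apply: (le_trans (le_normr_Rintegral measurableT iD)).
apply: (@le_trans _ _ (\int[P]_w (e + 2 * M * \1_(~` [set w | X w <= t N]) w))).
  apply: le_Rintegral => //.
  by apply: (@le_integrable_fun _ _ _ _ _ (fun w => e + 2 * M * \1_(~` [set w | X w <= t N]) w)) => //;
    [apply: measurableT_comp => //; apply: measurable_funB|move=> w; rewrite normr_id].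
rewrite (RintegralD measurableT iC (integrable_scale (2 * M) iI)) Rintegral_cstT RintegralZl//.
by rewrite Rintegral_indicator// fine_probabilityC//; exact: measurable_le_set.
Qed.
End staircase_mean.

Lemma prob_tail_cvg0 (dO : measure_display) (O : measurableType dO) (P : probability O R)
    (Y : O -> R) : measurable_fun [set: O] Y ->
  forall e, 0 < e -> exists2 K, 0 < K & 1 - fine (P [set w | Y w <= K]) <= e.
Proof.
move=> mY e e0.
have : (fun n => \int[P]_w \1_[set w | Y w <= n.+1%:R] w) @ \oo --> \int[P]_w (1 : R).
  apply: (@Rintegral_dominated_cvg _ _ _ P (fun n => \1_[set w | Y w <= n.+1%:R]) (fun=> 1) (fun=> 1)) => //.
  - by move=> n; apply: measurable_indic; exact: measurable_le_set.
  - move=> w; apply: cvg_near_cst; near=> n; rewrite indicE mem_set//=.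
    by apply: (@le_trans _ _ n%:R); [near: n; exact: nbhs_infty_ger|rewrite ler_nat].
  - by move=> n w; rewrite indicE; case: (_ \in _); rewrite ?normr1 ?normr0.
  - by apply: (@bounded_integrable _ _ _ _ _ 1) => // w; rewrite normr1.
rewrite Rintegral_cstT => /cvgrPdist_le /(_ e e0) /filter_ex[n].
rewrite Rintegral_indicator; last exact: measurable_le_set.
by move=> H; exists n.+1%:R => //; exact: le_trans (ler_norm _) H.
Unshelve. all: by end_near. Qed.

(* [f] is compared with a staircase of mesh [h] and jumps at most [e].  At each step
   [t i] the two distribution functions differ by at most the growth of the limit
   one over [[t i - h, t i + h]], and these growths sum up to at most 2, so atoms
   of the limit do no harm. *)
Lemma cvg_distribution_sandwich (dO dO' : measure_display) (O : measurableType dO)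
    (O' : measurableType dO') (P : probability O R) (P' : probability O' R)
    (X : nat -> O -> R) (Y : O' -> R) :
  (forall n, measurable_fun [set: O] (X n)) -> measurable_fun [set: O'] Y ->
  (forall n w, 0 <= X n w) -> (forall w, 0 <= Y w) ->
  (forall a b e, 0 <= a -> a < b -> 0 < e -> \forall n \near \oo,
     fine (P [set w | X n w <= a]) <= fine (P' [set w | Y w <= b]) + e /\
     fine (P' [set w | Y w <= a]) - e <= fine (P [set w | X n w <= b])) ->
  cvg_in_distribution P P' X Y.
Proof.
move=> mX mY X0 Y0 H; split=> // f cf [M0 [_ bf]].
have [M fM] : exists M : R, forall x, `|f x| <= M.
  by exists (M0 + 1) => x; apply: (bf (M0 + 1)) => //; rewrite ltrDl.
have M_ge0 : 0 <= M := le_trans (normr_ge0 _) (fM 0).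
have mf : measurable_fun [set: R] f by exact: continuous_measurable_fun.
have EE (dT : measure_display) (T : measurableType dT) (Q : probability T R) (Z : T -> R) :
    measurable_fun [set: T] Z -> ('E_Q[f \o Z] = (\int[Q]_w f (Z w))%:E)%E.
  move=> mZ; rewrite unlock /Rintegral fineK//; apply: integrable_fin_num => //.
  by apply: (@bounded_integrable _ _ _ _ _ M) => //; exact: measurableT_comp.
rewrite EE// (_ : (fun n => 'E_P[f \o X n])%E = (fun n => (\int[P]_w f (X n w))%:E)); last first.
  by apply/funext => n; rewrite EE.
apply: cvg_EFin; first by apply: nearW.
apply/cvgrPdist_le => eps eps0.
(* The budget: two staircase errors [e], an error [e * (2 + e) <= 3 * e] between the staircase
   means, and tails of mass [e] and [2 * e] weighted by [2 * M], in all at most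
   [e * (5 + 6 * M)]. *)
pose e := Num.min 1 (eps / (5 + 8 * M)).
have D0 : 0 < 5 + 8 * M by rewrite ltr_pwDl// mulr_ge0.
have e0 : 0 < e by rewrite lt_min ltr01 divr_gt0.
have e1 : e <= 1 by rewrite ge_min lexx.
have eE : e * (5 + 8 * M) <= eps by rewrite -ler_pdivlMr// ge_min lexx orbT.
have [K K0 HK] := prob_tail_cvg0 P' mY e0.
(* The margin 1 keeps [t N - h >= K], since [h <= 1]. *)
pose K1 := K + 1; have K10 : 0 < K1 by rewrite /K1 addr_gt0.
have [dl dl0 unif] : exists2 dl : R, 0 < dl & forall s t, 0 <= s <= 1 -> 0 <= t <= 1 ->
    `|s - t| <= dl -> `|f (K1 * s) - f (K1 * t)| <= e.
  apply: (@continuous_segment_uniform R R (fun s => f (K1 * s))) => //.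
  apply: continuous_subspaceT => s; apply: continuous_comp; last exact: cf.
  exact: mulrl_continuous.
have [N [N0 [NK Ndl]]] : exists N : nat, (0 < N)%N /\ K1 <= N%:R /\ dl^-1 <= N%:R.
  near \oo => N; exists N; split; first by near: N; exact: nbhs_infty_gt.
  by split; near: N; exact: nbhs_infty_ger.
have N0' : 0 < N%:R :> R by rewrite ltr0n.
pose h := K1 / N%:R; have h0 : 0 < h by rewrite divr_gt0.
have h1 : h <= 1 by rewrite ler_pdivrMr// mul1r.
pose t (i : nat) := h * i%:R.
have t_homo i j : (i <= j)%N -> t i <= t j by move=> ij; rewrite /t ler_pM2l// ler_nat.
have t0 : t 0%N = 0 by rewrite /t mulr0.
have tN : t N = K1 by rewrite /t divfK// gt_eqF.
have tS i : t i.+1 = t i + h by rewrite /t -natr1 mulrDr mulr1.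
have tg0 i : 0 <= t i by rewrite /t mulr_ge0// ltW.
have osc i : (i < N)%N -> forall x, t i <= x <= t i.+1 -> `|f x - f (t i.+1)| <= e.
  move=> iN x /andP[x1 x2]; have x0 : 0 <= x := le_trans (tg0 i) x1.
  have xK : x <= K1 by rewrite -tN; exact: le_trans x2 (t_homo _ _ iN).
  have K1n : K1 != 0 by rewrite gt_eqF.
  have -> : x = K1 * (x / K1) by rewrite mulrC divfK.
  have -> : t i.+1 = K1 * (t i.+1 / K1) by rewrite [RHS]mulrC divfK.
  apply: unif.
  - by rewrite divr_ge0 ?(ltW K10)//= ler_pdivrMr// mul1r.
  - by rewrite divr_ge0 ?(ltW K10)//= ler_pdivrMr// mul1r -tN t_homo.
  rewrite -mulrBl normrM (ger0_norm (ltW _ : 0 <= K1^-1)) ?invr_gt0// ler_pdivrMr//.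
  rewrite distrC ger0_norm ?subr_ge0//; apply: (@le_trans _ _ h); first by rewrite tS in x2 *; lra.
  by rewrite /h [leLHS]mulrC ler_pM2r// -[dl]invrK lef_pV2 ?posrE ?invr_gt0.
pose F a := fine (P' [set w | Y w <= a]).
have FE a b : a <= b -> F a <= F b.
  move=> ab; apply: fine_probability_le; [exact: measurable_le_set|exact: measurable_le_set|].
  by move=> w /= /le_trans; apply.
have F01 a : 0 <= F a <= 1.
  by rewrite fine_ge0//= -lee_fin fineK ?probability_le1//; [exact: measurable_le_set|exact: fin_num_measure (measurable_le_set _ _)].
have Fneg a : a < 0 -> F a = 0.
  move=> a0; rewrite /F (_ : [set w | _] = set0) ?measure0//.
  by apply/seteqP; split => w //= Ya; have := Y0 w; rewrite leNgt (le_lt_trans Ya a0).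
have eN : 0 < e / N.+1%:R by rewrite divr_gt0.
pose G n a := fine (P [set w | X n w <= a]).
have G01 n a : 0 <= G n a <= 1.
  by rewrite fine_ge0//= -lee_fin fineK ?probability_le1//; [exact: measurable_le_set|exact: fin_num_measure (measurable_le_set _ _)].
have near_all : \forall n \near \oo, forall i : 'I_N.+1,
   F (t i - h) - e / N.+1%:R <= G n (t i) <= F (t i + h) + e / N.+1%:R.
  apply: filter_forall => i.
  have H1 := H (t i) (t i + h) _ (tg0 i) (ltac:(by rewrite ltrDl)) eN.
  (* [H] speaks of nonnegative levels only; below 0 the limit distribution function vanishes because
     [Y] is nonnegative. *)
  have [i0|i0] := leP 0 (t i - h).
    have H2 := H (t i - h) (t i) _ i0 (ltac:(by rewrite gtrDl oppr_lt0)) eN.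
    by apply: filterS2 H1 H2 => n [A1 _] [_ A2]; rewrite A2.
  apply: filterS H1 => n [A1 _]; rewrite A1 andbT Fneg//.
  by have /andP[g0 _] := G01 n (t i); rewrite sub0r (le_trans _ g0)// oppr_le0 ltW.
apply: filterS near_all => n Hn.
have A1 := staircase_mean_approx P (mX n) t_homo mf fM (ltW e0) t0 osc (X0 n).
have A2 := staircase_mean_approx P' mY t_homo mf fM (ltW e0) t0 osc Y0.
rewrite -/(G n (t N)) in A1; rewrite -/(F (t N)) in A2.
have A3 : `|\int[P']_w staircase f t N (Y w) - \int[P]_w staircase f t N (X n w)| <= e * (2 + e).
  rewrite !Rintegral_staircase//.
  rewrite opprD addrACA subrr add0r -sumrB.
  apply: (le_trans (ler_norm_sum _ _ _)).
  apply: (@le_trans _ _ (\sum_(i < N) e * ((F (t i.+1) - F (t i)) + (F (t i) - F (t i - h)) + e / N.+1%:R))).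
    apply: ler_sum => i _; rewrite -mulrBr normrM; apply: ler_pM => //.
      by apply: osc => //; rewrite lexx t_homo.
    have := Hn (widen_ord (leqnSn N) i); rewrite /= -tS => /andP[B1 B2].
    have B3 : F (t i - h) <= F (t i) by apply: FE; rewrite gerDl oppr_le0 ltW.
    have B4 : F (t i) <= F (t i.+1) by apply: FE; exact: t_homo.
    change (`|F (t i) - G n (t i)| <= F (t i.+1) - F (t i) + (F (t i) - F (t i - h)) + e / N.+1%:R).
    move: B1 B2 B3 B4; move: (F (t i)) (F (t i.+1)) (F (t i - h)) (G n (t i)) (e / N.+1%:R) => x1 x2 x3 x4 x5.
    by move=> *; rewrite ler_norml; apply/andP; split; lra.
  rewrite -mulr_sumr ler_pM2l// !big_split/=.
  have T1 : \sum_(i < N) (F (t i.+1) - F (t i)) <= 1.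
    rewrite -(big_mkord xpredT (fun i => F (t i.+1) - F (t i))) telescope_sumr//.
    by have /andP[_ u1] := F01 (t N); have /andP[u2 _] := F01 (t 0%N); lra.
  have T2 : \sum_(i < N) (F (t i) - F (t i - h)) <= 1.
    rewrite (eq_bigr (fun i : 'I_N => (fun i => F (t i - h)) i.+1 - F (t i - h))) => [|i _]; last first.
      by rewrite tS addrK.
    rewrite -(big_mkord xpredT (fun i => F (t i.+1 - h) - F (t i - h))) (telescope_sumr (fun i => F (t i - h)))//.
    by have /andP[_ u1] := F01 (t N - h); have /andP[u2 _] := F01 (t 0%N - h); lra.
  have T3 : \sum_(i < N) e / N.+1%:R <= e.
    rewrite sumr_const card_ord -[_ *+ _]mulr_natr mulrAC ler_pdivrMr// ler_pM2l// ler_nat leqnSn.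
    by [].
  by move: T1 T2; rewrite !big_split/=; lra.
have B1 : 1 - F (t N) <= e.
  apply: le_trans HK; rewrite lerB// FE// tN /K1; lra.
have B2 : 1 - G n (t N) <= 2 * e.
  have := Hn ord_max => /= /andP[C1 _].
  have C2 : F K <= F (t N - h) by apply: FE; rewrite tN /K1; lra.
  have C3 : e / N.+1%:R <= e by rewrite ler_pdivrMr// ler_peMr ?(ltW e0)// ler1n.
  have HK' : 1 - F K <= e := HK.
  move: C1 C2 C3 HK'; move: (F K) (F (t N - h)) (e / N.+1%:R) (G n (t N)) => x1 x2 x3 x4.
  by move=> *; lra.
have M2 : 0 <= 2 * M by rewrite mulr_ge0.
have C1 := ler_wpM2l M2 B1; have C2 := ler_wpM2l M2 B2.
apply: le_trans eE.
have -> : \int[P']_w f (Y w) - \int[P]_w f (X n w) =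
  (\int[P']_w f (Y w) - \int[P']_w staircase f t N (Y w)) +
  (\int[P']_w staircase f t N (Y w) - \int[P]_w staircase f t N (X n w)) -
  (\int[P]_w f (X n w) - \int[P]_w staircase f t N (X n w)) by ring.
apply: (le_trans (ler_normB _ _)); apply: (le_trans (lerD (ler_normD _ _) (lexx _))).
have ee : e * e <= e by rewrite ler_piMr// ltW.
nra.
Unshelve. all: by end_near. Qed.
End portmanteau.

(** * Linear algebra *)

Section near_identity.
Context (R : realType) (d : nat).
Implicit Types (x v : 'rV[R]_d) (E N : 'M[R]_d).

Definition mx_sum_norm E : R := \sum_i \sum_j `|E i j|.

Lemma dotE x v : (x *m v^T) 0 0 = dot x v.
Proof. by rewrite mxE; apply: eq_bigr => i _; rewrite mxE. Qed.

Lemma sqn_eq0 x : sqn x = 0 -> x = 0.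
Proof.
move=> /eqP; rewrite psumr_eq0 => [/allP H|i _]; last exact: sqr_ge0.
apply/rowP => i; apply/eqP; rewrite mxE -sqrf_eq0; apply: H.
by rewrite mem_index_enum.
Qed.

Lemma entry_le_enorm x i : `|x 0 i| <= enorm x.
Proof.
rewrite -sqrtr_sqr ler_wsqrtr// (bigD1 i)//= lerDl.
by apply: sumr_ge0 => j _; exact: sqr_ge0.
Qed.

Lemma enorm_le_norm1 x : enorm x <= norm1 x.
Proof. by rewrite enorm_le_sqn ?norm1_ge0//; exact: sqn_le. Qed.

Lemma enorm_mulmx v E : enorm (v *m E) <= mx_sum_norm E * enorm v.
Proof.
apply: (le_trans (enorm_le_norm1 _)).
rewrite /mx_sum_norm exchange_big/= mulr_suml; apply: ler_sum => j _.
rewrite mxE mulr_suml; apply: (le_trans (ler_norm_sum _ _ _)); apply: ler_sum => i _.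
by rewrite normrM mulrC ler_wpM2l// entry_le_enorm.
Qed.

Lemma dot_norm_le x v : `|dot x v| <= enorm x * enorm v.
Proof.
rewrite -(@ler_pXn2r _ 2)//= ?nnegrE ?mulr_ge0 ?enorm_ge0// real_normK ?num_real//.
by rewrite exprMn !sqr_enorm; exact: Cauchy_Schwarz.
Qed.

(* With [v = x N^-1] and [N = 1 + E], the difference is [- x . v E], and
   [|v| <= 2 |x|]. *)
Lemma quad_inv_close N (eta : R) : mx_sum_norm (N - 1%:M) <= eta -> eta <= 1 / 2 ->
  N \in unitmx /\ forall x, `|(x *m invmx N *m x^T) 0 0 - sqn x| <= 2 * eta * sqn x.
Proof.
set E := N - 1%:M => Eeta eta12.
have NE v : v *m N = v + v *m E by rewrite /E mulmxBr mulmx1 addrC subrK.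
have vE v : enorm (v *m E) <= eta * enorm v.
  by apply: (le_trans (enorm_mulmx _ _)); rewrite ler_wpM2r// enorm_ge0.
have v2 v : enorm v <= 2 * enorm (v *m N).
  have : enorm v <= enorm (v *m N) + enorm (v *m E).
    by rewrite -{1}[v](addrK (v *m E)) -NE; apply: (le_trans (enormD _ _)); rewrite enormN.
  have := vE v; have := enorm_ge0 v; nra.
(* By [v2] every row of the kernel of [N] has norm 0. *)
have uN : N \in unitmx.
  rewrite -row_free_unit -kermx_eq0; apply/eqP/row_matrixP => i; rewrite row0.
  apply: sqn_eq0; have := v2 (row i (kermx N)).
  rewrite -row_mul mulmx_ker row0 {2}/enorm big1 ?sqrtr0 ?mulr0 => [H|j _]; last by rewrite mxE expr0n.
  by rewrite -sqr_enorm (_ : enorm _ = 0) ?expr0n//; apply/eqP; rewrite eq_le H enorm_ge0.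
split=> // x; pose v := x *m invmx N.
have xv : x = v + v *m E by rewrite -NE /v mulmxKV.
have -> : (x *m invmx N *m x^T) 0 0 - sqn x = - dot x (v *m E).
  rewrite -/v dotE (_ : sqn x = dot x x); last first.
    by apply: eq_bigr => i _; rewrite expr2.
  rewrite -sumrB -sumrN; apply: eq_bigr => i _.
  have xi : x 0 i = v 0 i + (v *m E) 0 i by rewrite [in LHS]xv mxE.
  have -> : (v *m E) 0 i = x 0 i - v 0 i by lra.
  by ring.
rewrite normrN; apply: (le_trans (dot_norm_le _ _)).
have := v2 v; rewrite (_ : v *m N = x); last by rewrite NE -xv.
move=> H; rewrite -sqr_enorm.
have H1 := vE v; have H2 := enorm_ge0 x; have H3 := enorm_ge0 v; have H4 := enorm_ge0 (v *m E).
have eta0 : 0 <= eta.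
  by apply: le_trans Eeta; apply: sumr_ge0 => i _; apply: sumr_ge0.
have H5 : enorm (v *m E) <= eta * (2 * enorm x).
  by apply: (le_trans H1); rewrite ler_wpM2l.
have := ler_wpM2l H2 H5; lra.
Qed.
End near_identity.

(** * Whitening a positive definite matrix *)

Section whitening.
Context (R : realType).

Definition pos_def d (S : 'M[R]_d) := forall v : 'rV_d, v != 0 -> 0 < (v *m S *m v^T) 0 0.

(* Eliminating the first coordinate leaves the Schur complement. *)
Lemma congruent_to_1 d (S : 'M[R]_d) : S^T = S -> pos_def S ->
  exists2 A : 'M[R]_d, A \in unitmx & A^T *m S *m A = 1%:M.
Proof.
move=> sS pS; suff [A AS] : exists A : 'M[R]_d, A^T *m S *m A = 1%:M.
  by exists A => //; have [] := mulmx1_unit AS.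
elim: d S sS pS => [|d IH] S sS pS; first by exists 0; apply/matrixP => -[].
rewrite -[d.+1]/(1 + d)%N in S sS pS *.
pose a := S 0 0; pose r := ursubmx S; pose S' := drsubmx S.
have SE : S = block_mx a%:M r r^T S'.
  rewrite -[LHS]submxK; congr block_mx.
    by rewrite [LHS]mx11_scalar; congr (_%:M); rewrite !mxE; congr (S _ _); apply: val_inj.
  by rewrite /r -{1}sS trmx_ursub.
have a0 : 0 < a.
  have := pS (delta_mx 0 0); rewrite -rowE trmx_delta -colE !mxE; apply.
  by apply/eqP => /matrixP /(_ 0 0) /eqP; rewrite !mxE eqxx oner_eq0.
pose C := - a^-1 *: r; pose A0 : 'M[R]_(1 + d) := block_mx 1%:M C 0 1%:M.
pose S2 := S' - a^-1 *: (r^T *m r).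
have A0S : A0^T *m S *m A0 = block_mx a%:M 0 0 S2.
  rewrite SE /A0 tr_block_mx !trmx1 trmx0 !mulmx_block !mul1mx !mulmx1 !mul0mx !mulmx0 !addr0.
  have CE : a%:M *m C + r = 0.
    by rewrite /C mul_scalar_mx scalerA mulrN mulfV ?gt_eqF// scaleN1r addNr.
  have CTE : C^T *m a%:M + r^T = 0 by rewrite -[_ *m _]trmxK trmx_mul tr_scalar_mx trmxK -raddfD/= CE trmx0.
  rewrite CE CTE mul0mx add0r; congr block_mx.
  by rewrite /S2 /C addrC linearZ/= -scalemxAl scaleNr.
have sS2 : S2^T = S2.
  by rewrite /S2 linearB/= linearZ/= trmx_mul trmxK /S' trmx_drsub sS.
have pS2 : pos_def S2.
  move=> v v0; pose u : 'rV[R]_(1 + d) := row_mx 0 v.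
  have -> : v *m S2 *m v^T = (u *m A0^T) *m S *m (u *m A0^T)^T.
    rewrite trmx_mul trmxK !mulmxA -(mulmxA _ A0^T) -(mulmxA u) A0S.
    by rewrite /u mul_row_block tr_row_mx mul_row_col !mul0mx mulmx0 !add0r trmx0 mulmx0 add0r.
  apply: pS; apply: contra_neq v0 => H.
  have : rsubmx (u *m A0^T) = v.
    by rewrite /u /A0 tr_block_mx mul_row_block row_mxKr mul0mx add0r trmx1 mulmx1.
  by rewrite H => <-; apply/matrixP => i j; rewrite !mxE.
have [A' A'S] := IH S2 sS2 pS2.
exists (A0 *m block_mx (Num.sqrt a)^-1%:M 0 0 A').
rewrite trmx_mul -!mulmxA (mulmxA S) (mulmxA A0^T) (mulmxA A0^T) A0S.
rewrite tr_block_mx tr_scalar_mx !trmx0 !mulmx_block !(mul0mx, mulmx0, addr0, add0r) (mulmxA A'^T) A'S.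
rewrite -!scalar_mxM (_ : _ * _ = 1); first by rewrite -scalar_mx_block.
by rewrite mulrCA -invfM -expr2 sqr_sqrtr ?ltW// mulfV// gt_eqF.
Qed.

(** A vector [v] at which the form vanishes is a minimum of it. Along a coordinate direction this
    reads [2 * t * b + t ^+ 2 * c >= 0] for all [t], which forces [b = 0]. Hence [v *m S = 0], and
    [v = 0] by invertibility. *)
Lemma pos_def_unit d (S : 'M[R]_d) : S^T = S -> (forall v : 'rV_d, 0 <= (v *m S *m v^T) 0 0) ->
  S \in unitmx -> pos_def S.
Proof.
move=> sS pS uS v v0; rewrite lt_neqAle pS andbT eq_sym; apply: contra_neq v0 => v0.
suff vS : v *m S = 0 by rewrite -[v](mulmxK uS) vS mul0mx.
apply/rowP => i; rewrite [RHS]mxE; pose w : 'rV[R]_d := delta_mx 0 i.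
have -> : (v *m S) 0 i = (v *m S *m w^T) 0 0.
  by rewrite /w trmx_delta -colE !mxE.
set b := (v *m S *m w^T) 0 0; set c := (w *m S *m w^T) 0 0.
have H t : 0 <= 2 * t * b + t ^+ 2 * c.
  have addE (M M' : 'M[R]_1) : (M + M') 0 0 = M 0 0 + M' 0 0 by rewrite mxE.
  have scaleE (k : R) (M : 'M[R]_1) : (k *: M) 0 0 = k * M 0 0 by rewrite mxE.
  have := pS (v + t *: w); rewrite linearD/= linearZ/= !mulmxDl !mulmxDr.
  rewrite -!scalemxAl -!scalemxAr !addE !scaleE v0 -/c -/b.
  have -> : (w *m S *m v^T) 0 0 = b.
    rewrite /b -[RHS](_ : (v *m S *m w^T)^T 0 0 = _); last by rewrite mxE.
    by rewrite !trmx_mul trmxK sS mulmxA.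
  by rewrite add0r => H; apply: le_trans H _; rewrite le_eqVlt; apply/orP; left; apply/eqP; ring.
have c0 : 0 <= c by exact: pS.
(* The minimizer would be [- b / c]; [c + 1] also covers the case [c = 0]. *)
have := H (- b / (c + 1)); have c1 : 0 < c + 1 by rewrite ltr_wpDl.
have -> : 2 * (- b / (c + 1)) * b + (- b / (c + 1)) ^+ 2 * c = - (b ^+ 2 * (c + 2)) / (c + 1) ^+ 2.
  by field; rewrite gt_eqF.
rewrite mulNr oppr_ge0 pmulr_lle0 ?invr_gt0 ?exprn_gt0// pmulr_lle0 ?ltr_wpDl// => b2.
by apply/eqP; rewrite -sqrf_eq0 eq_le b2 sqr_ge0.
Qed.
End whitening.

(** * The sample *)

Section weak_law.
Context (R : realType) (p : nat) (dO dT : measure_display)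
  (O : measurableType dO) (T : measurableType dT) (P : probability O R)
  (X : nat -> O -> T) (Y : T -> 'rV[R]_p).
Hypotheses (mX : forall k, measurable_fun [set: O] (X k))
  (iX : mutually_independent P X) (mY : vmeas Y)
  (iY : forall k i, P.-integrable [set: O] (EFin \o (fun w => Y (X k w) 0 i)))
  (Y0 : forall k i, \int[P]_w Y (X k w) 0 i = 0)
  (tY : forall k c, trunc_mean P (Y \o X k) c = trunc_mean P (Y \o X 0%N) c).

Lemma weak_law (b e : R) : 0 < b -> 0 < e -> \forall n \near \oo,
  fine (P [set w | b < sqn (n%:R^-1 *: \sum_(k < n) Y (X k w))]) <= e.
Proof.
move=> b0 e0; pose C := 2 + 4 * @jet_prod_bound R 1 0 b.
have : C * trunc_mean P (Y \o X 0%N) n%:R^-1 @[n --> \oo] --> (0 : R).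
  rewrite -(mulr0 C); apply: cvgMl_tmp; apply: trunc_mean_cvg0 => i; exact: iY.
move=> /cvgrPdist_le /(_ e e0) H; near=> n.
have n0 : (0 < n)%N by near: n; exact: nbhs_infty_gt.
have adp : adapted_indep_l P n (fun k w => Y (X k w)).
  have := @scaled_adapted_indep _ _ _ _ _ _ P X Y mX iX mY 1 n.
  rewrite (_ : (fun k w => 1 *: _) = (fun k w => Y (X k w)))//.
  by apply/funext => k; apply/funext => w; rewrite scale1r.
have := @weak_law_tail R p _ _ P n (fun k w => Y (X k w)) b n%:R^-1
  (trunc_mean P (Y \o X 0%N) n%:R^-1) b0 (ltac:(by rewrite invr_ge0)) (fun k i _ => iY k i) (fun k i _ => Y0 k i)
  (fun k _ => ltac:(by rewrite -(tY k))) adp.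
move=> /le_trans; apply; rewrite -/C.
have -> : n%:R * (C * (n%:R^-1 * trunc_mean P (Y \o X 0%N) n%:R^-1)) = C * trunc_mean P (Y \o X 0%N) n%:R^-1.
  by field; rewrite pnatr_eq0 -lt0n.
have : `|0 - C * trunc_mean P (Y \o X 0%N) n%:R^-1| <= e by near: n; exact: H.
by rewrite sub0r normrN; apply: le_trans; exact: ler_norm.
Unshelve. all: by end_near. Qed.
End weak_law.

Section identically_distributed.
Context (R : realType) (dO dX : measure_display) (O : measurableType dO)
  (T : measurableType dX) (Pr : probability O R) (Q : probability T R)
  (xi : nat -> {RV Pr >-> T}).
Hypothesis xi_iid : iid Q xi.

Lemma iid_Rintegral (h : T -> R) k : measurable_fun [set: T] h ->
  \int[Pr]_w h (xi k w) = \int[Q]_x h x.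
Proof.
move=> mh; rewrite /Rintegral.
rewrite -(@integral_pushforwardE _ _ _ _ _ Pr (xi k) (EFin \o h))//; last exact/measurable_EFinP.
congr fine; apply: eq_measure_integral => A mA _.
by have [H _] := xi_iid; exact: H.
Qed.

Lemma iid_integrable (h : T -> R) k : Q.-integrable [set: T] (EFin \o h) ->
  Pr.-integrable [set: O] (EFin \o (fun w => h (xi k w))).
Proof.
move=> ih; have mh := measurable_integrable ih.
apply/integrableP; split; first by apply/measurable_EFinP; apply: measurableT_comp.
have /integrableP[_] := ih; congr (_ < _)%E.
have := @integral_pushforwardE _ _ _ _ _ Pr (xi k) (fun x => `|(h x)%:E|%E).
move=> E; have {E} <- := E _ _; last 2 first.
- exact: measurable_funPT.
- by apply: measurableT_comp => //; exact/measurable_EFinP.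
apply: eq_measure_integral => A mA _.
by symmetry; exact: (xi_iid.1 k A mA).
Qed.
End identically_distributed.

Section moments.
Context (R : realType) (d : nat) (dT : measure_display) (T : measurableType dT)
  (Q : probability T R).
Implicit Types (Z : T -> 'rV[R]_d).

Lemma integrable_cstT (c : R) : Q.-integrable [set: T] (EFin \o (fun=> c)).
Proof. by apply: (@bounded_integrable _ _ _ _ _ `|c|). Qed.

Lemma sqint_subr Z (m : 'rV[R]_d) : sqint Q Z -> sqint Q (fun x => Z x - m).
Proof.
move=> sZ i; have [mZ iZ2] := sZ i; have iZ := integrable_entry sZ i; split.
  rewrite (_ : (fun _ => _) = fun x => Z x 0 i - m 0 i); first exact: measurable_funB.
  by apply/funext => x; rewrite !mxE.
rewrite (_ : (fun x => _) = fun x => Z x 0 i ^+ 2 + (- 2 * m 0 i * Z x 0 i + m 0 i ^+ 2)).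
  apply: (integrableD measurableT iZ2 (integrableD measurableT (integrable_scale _ iZ) (integrable_cstT _))).
by apply/funext => x; rewrite !mxE; ring.
Qed.

Lemma mulmx_entry (z : 'rV[R]_d) (A : 'M[R]_d) j : (z *m A) 0 j = lin (A^~ j) z.
Proof. by rewrite mxE; apply: eq_bigr => i _; rewrite mulrC. Qed.

Lemma sqint_mulmx Z (A : 'M[R]_d) : sqint Q Z -> sqint Q (fun x => Z x *m A).
Proof.
move=> sZ j; split.
  rewrite (_ : (fun _ => _) = fun x => lin (A^~ j) (Z x)); last by apply/funext => x; rewrite mulmx_entry.
  by have [i1 _] := Rintegral_lin sZ (A^~ j); exact: (measurable_integrable i1).
rewrite (_ : (fun x => _) = fun x => quad (fun i k => A i j * A k j) (Z x)).
  by have [] := Rintegral_quad sZ (fun i k => A i j * A k j).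
by apply/funext => x; rewrite mulmx_entry expr2 linM.
Qed.

Lemma mean_mulmx Z (A : 'M[R]_d) j : sqint Q Z -> (forall i, \int[Q]_x Z x 0 i = 0) ->
  \int[Q]_x (Z x *m A) 0 j = 0.
Proof.
move=> sZ Z0; under eq_Rintegral do rewrite mulmx_entry.
have [_ ->] := Rintegral_lin sZ (A^~ j).
by rewrite big1// => i _; rewrite Z0 mulr0.
Qed.

Lemma cov_mulmx Z (A S : 'M[R]_d) : sqint Q Z ->
  (forall i j, \int[Q]_x (Z x 0 i * Z x 0 j) = S i j) ->
  forall i j, \int[Q]_x ((Z x *m A) 0 i * (Z x *m A) 0 j) = (A^T *m S *m A) i j.
Proof.
move=> sZ ZS i j.
under eq_Rintegral do rewrite !mulmx_entry linM.
have [_ ->] := Rintegral_quad sZ (fun k l => A k i * A l j).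
rewrite mxE exchange_big/=; apply: eq_bigr => l _; rewrite mxE mulr_suml.
by apply: eq_bigr => k _; rewrite ZS mxE; ring.
Qed.

(** The form at [v] is the second moment of the scalar product of [Z] and [v]. *)
Lemma quad_cov_ge0 Z (S : 'M[R]_d) : sqint Q Z ->
  (forall i j, \int[Q]_x (Z x 0 i * Z x 0 j) = S i j) ->
  forall v : 'rV[R]_d, 0 <= (v *m S *m v^T) 0 0.
Proof.
move=> sZ ZS v; have [_ E] := Rintegral_quad sZ (fun k l => v 0 k * v 0 l).
have -> : (v *m S *m v^T) 0 0 = \int[Q]_x quad (fun k l => v 0 k * v 0 l) (Z x).
  rewrite E mxE exchange_big/=; apply: eq_bigr => l _; rewrite !mxE mulr_suml.
  by apply: eq_bigr => k _; rewrite ZS; ring.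
by apply: Rintegral_ge0 => x _; rewrite -linM -expr2 sqr_ge0.
Qed.
End moments.

Section model_moments.
Context (R : realType) (d : nat) (dX : measure_display) (X : measurableType dX)
  (P : 'rV[R]_d -> probability X R) (psi : X -> 'rV[R]_d) (theta0 : 'rV[R]_d).
Hypotheses (psi_meas : borel_measurable psi)
  (psi_L2 : ('E_(P theta0)[fun x => (enorm (psi x) ^+ 2)%R] < +oo)%E).

Let Q := P theta0.

Lemma vmeas_psi : vmeas psi.
Proof. by move=> i j; exact: borel_measurable_entry. Qed.

Lemma sqint_psi : sqint Q psi.
Proof.
move=> i; split; first exact: vmeas_psi.
have mE : measurable_fun [set: X] (fun x => enorm (psi x) ^+ 2).
  by apply: measurable_funX; apply: measurable_enorm; exact: vmeas_psi.
apply: (@le_integrable_fun _ _ _ _ _ (fun x => enorm (psi x) ^+ 2)).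
- by apply: measurable_funX; exact: vmeas_psi.
- move=> x; rewrite ger0_norm ?sqr_ge0// -real_normK ?num_real//.
  by rewrite lerXn2r ?nnegrE ?enorm_ge0// entry_le_enorm.
apply/integrableP; split; first exact/measurable_EFinP.
apply: le_lt_trans psi_L2; rewrite unlock le_eqVlt; apply/orP; left; apply/eqP.
by apply: eq_integral => x _ /=; rewrite ger0_norm ?sqr_ge0.
Qed.

Lemma mean_psiE theta i : mean_psi P psi theta 0 i = \int[P theta]_x psi x 0 i.
Proof. by rewrite mxE unlock. Qed.

Lemma cov_psiE i j : cov_psi P psi theta0 i j =
  \int[Q]_x ((psi x - mean_psi P psi theta0) 0 i * (psi x - mean_psi P psi theta0) 0 j).
Proof.
rewrite mxE unlock; congr fine; apply: eq_integral => x _.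
by rewrite mxE big_ord1 mxE.
Qed.

Lemma centered_psi_mean i : \int[Q]_x (psi x - mean_psi P psi theta0) 0 i = 0.
Proof.
have -> : \int[Q]_x (psi x - mean_psi P psi theta0) 0 i =
  \int[Q]_x (psi x 0 i - mean_psi P psi theta0 0 i).
  apply: eq_Rintegral => x _; by rewrite [LHS]mxE [X in _ + X]mxE.
rewrite RintegralB//; first by rewrite Rintegral_cstT mean_psiE subrr.
  exact: integrable_entry sqint_psi i.
exact: integrable_cstT.
Qed.

Lemma cov_psi_sym : (cov_psi P psi theta0)^T = cov_psi P psi theta0.
Proof.
apply/matrixP => i j; rewrite mxE !cov_psiE; apply: eq_Rintegral => x _.
by rewrite mulrC.
Qed.

Definition whitened (A : 'M[R]_d) (x : X) : 'rV[R]_d := (psi x - mean_psi P psi theta0) *m A.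

Lemma vmeas_whitened A : vmeas (whitened A).
Proof.
move=> i j; rewrite (ord1 i).
by have := sqint_mulmx A (sqint_subr (mean_psi P psi theta0) sqint_psi) j; case.
Qed.

Lemma whitening_exists : cov_psi P psi theta0 \in unitmx ->
  exists2 A : 'M[R]_d, A \in unitmx & centered_with_cov Q 1 (whitened A).
Proof.
move=> uS; have sZ := sqint_subr (mean_psi P psi theta0) sqint_psi.
have ZS i j : \int[Q]_x ((psi x - mean_psi P psi theta0) 0 i * (psi x - mean_psi P psi theta0) 0 j) =
  cov_psi P psi theta0 i j by rewrite cov_psiE.
have pS := pos_def_unit cov_psi_sym (quad_cov_ge0 sZ ZS) uS.
have [A uA AS] := congruent_to_1 cov_psi_sym pS; exists A => //; split.
- exact: sqint_mulmx.
- by move=> i; apply: mean_mulmx => // k; exact: centered_psi_mean.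
- by move=> i j; rewrite (cov_mulmx A sZ ZS) AS mxE.
Qed.
End model_moments.

Section sample_moments.
Context (R : realType) (d : nat) (dO dX : measure_display) (O : measurableType dO)
  (T : measurableType dX) (Pr : probability O R) (Q : probability T R)
  (xi : nat -> {RV Pr >-> T}) (phi : T -> 'rV[R]_d).
Hypotheses (xi_iid : iid Q xi) (mphi : vmeas phi)
  (cphi : centered_with_cov Q 1 phi).

Lemma sample_centered k : centered_with_cov Pr 1 (fun w => phi (xi k w)).
Proof.
have [sp p0 pc] := cphi; split => [i|i|i j].
- split; first exact: (measurableT_comp (mphi 0 i) (measurable_funPT (xi k))).
  by apply: (iid_integrable xi_iid k (sp i).2).
- by rewrite (iid_Rintegral xi_iid (h := fun x => phi x 0 i))//; exact: (mphi 0 i).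
- rewrite (iid_Rintegral xi_iid (h := fun x => phi x 0 i * phi x 0 j))//.
  by apply: measurable_funM; exact: (mphi 0).
Qed.

Lemma sample_norm1_sqr k :
  \int[Pr]_w norm1 (phi (xi k w)) ^+ 2 = \int[Pr]_w norm1 (phi (xi 0%N w)) ^+ 2.
Proof.
have m : measurable_fun [set: T] (fun x => norm1 (phi x) ^+ 2).
  by apply: measurable_funX; have [sp _ _] := cphi; exact: measurable_norm1 sp.
by rewrite !(iid_Rintegral xi_iid (h := fun x => norm1 (phi x) ^+ 2)).
Qed.

Lemma sample_trunc_moment k c : trunc_moment Pr (fun w => phi (xi k w)) c =
  trunc_moment Pr (fun w => phi (xi 0%N w)) c.
Proof.
have m1 : measurable_fun [set: T] (fun x => norm1 (phi x)).
  by have [sp _ _] := cphi; exact: measurable_norm1 sp.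
have m : measurable_fun [set: T] (fun x => norm1 (phi x) ^+ 2 * Num.min 1 (c * norm1 (phi x))).
  apply: measurable_funM; first exact: measurable_funX.
  by apply: measurable_minr => //; exact: measurable_funM.
by rewrite /trunc_moment !(iid_Rintegral xi_iid (h := fun x => norm1 (phi x) ^+ 2 * Num.min 1 (c * norm1 (phi x)))).
Qed.

Lemma sample_weak_law p (Y : T -> 'rV[R]_p) : vmeas Y ->
  (forall i, Q.-integrable [set: T] (EFin \o (fun x => Y x 0 i))) ->
  (forall i, \int[Q]_x Y x 0 i = 0) ->
  forall b e, 0 < b -> 0 < e -> \forall n \near \oo,
  fine (Pr [set w | b < sqn (n%:R^-1 *: \sum_(k < n) Y (xi k w))]) <= e.
Proof.
move=> mY iY Y0 b e b0 e0; have [_ ixi] := xi_iid.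
have m1 : measurable_fun [set: T] (fun x => norm1 (Y x)).
  by rewrite /norm1; apply: measurable_sum => i; apply: measurableT_comp => //; exact: mY.
apply: (@weak_law R p _ _ O T Pr (fun k => xi k) Y) => //.
- by move=> k i; exact: (iid_integrable xi_iid k (iY i)).
- by move=> k i; rewrite (iid_Rintegral xi_iid (h := fun x => Y x 0 i))//; exact: mY.
- move=> k c; have m : measurable_fun [set: T] (fun x => norm1 (Y x) * Num.min 1 (c * norm1 (Y x))).
    by apply: measurable_funM => //; apply: measurable_minr => //; exact: measurable_funM.
  by rewrite /trunc_mean /= !(iid_Rintegral xi_iid (h := fun x => norm1 (Y x) * Num.min 1 (c * norm1 (Y x)))).
Qed.

Lemma sample_mean_tail b e : 0 < b -> 0 < e -> \forall n \near \oo,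
  fine (Pr [set w | b < sqn (n%:R^-1 *: \sum_(k < n) phi (xi k w))]) <= e.
Proof.
have [sp p0 _] := cphi; apply: sample_weak_law => // i.
exact: integrable_entry.
Qed.

(** Flattened to a row, so that the weak law for row vectors applies to the empirical covariance. *)
Definition outer_defect (x : T) : 'rV[R]_(d * d) := mxvec ((phi x)^T *m phi x - 1%:M).

Lemma outer_defectE x i j :
  outer_defect x 0 (mxvec_index i j) = phi x 0 i * phi x 0 j - (i == j)%:R.
Proof. by rewrite mxvecE !mxE big_ord1 mxE. Qed.

Lemma vmeas_outer_defect : vmeas outer_defect.
Proof.
move=> i0 ij; rewrite (ord1 i0); case/mxvec_indexP: ij => i j.
rewrite (_ : (fun _ => _) = fun x => phi x 0 i * phi x 0 j - (i == j)%:R).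
  by apply: measurable_funB => //; apply: measurable_funM; exact: (mphi 0).
by apply/funext => x; rewrite outer_defectE.
Qed.

Lemma sample_cov_tail b e : 0 < b -> 0 < e -> \forall n \near \oo,
  fine (Pr [set w | b < sqn (n%:R^-1 *: \sum_(k < n) outer_defect (xi k w))]) <= e.
Proof.
have [sp _ pc] := cphi; apply: sample_weak_law; first exact: vmeas_outer_defect.
  move=> ij; case/mxvec_indexP: ij => i j.
  rewrite (_ : (fun _ => _) = fun x => phi x 0 i * phi x 0 j + (- (i == j)%:R)).
    exact: (integrableD measurableT (integrable_entryM sp i j) (integrable_cstT _ _)).
  by apply/funext => x; rewrite outer_defectE.
move=> ij; case/mxvec_indexP: ij => i j.
under eq_Rintegral do rewrite outer_defectE.
rewrite RintegralB//; first by rewrite Rintegral_cstT pc subrr.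
  exact: integrable_entryM.
exact: integrable_cstT.
Qed.
End sample_moments.

(** * The statistic *)

Section statistic.
Context (R : realType) (d : nat) (dX : measure_display) (X : measurableType dX).
Variables (P : 'rV[R]_d -> probability X R) (psi : X -> 'rV[R]_d).
Implicit Types (x : nat -> X) (theta : 'rV[R]_d) (D : 'M[R]_d).

(** [Zn] as a function of the integer part [k] of [u * n]. *)
Definition Zk x n k theta : 'rV[R]_d :=
  n%:R^-1 *: \sum_(i < k) (psi (x i) - mean_psi P psi theta).

Definition stat_term x n theta D k : R :=
  `|n%:R * (Zk x n k theta *m inv_or D (Sigma_hat P psi x n theta)
             *m (Zk x n k theta)^T) 0 0|.

(** The term at [u] depends only on the integer part of [u * n], which takes each value [k <= n] at
    [u = k / n]. The default value 0 of the maximum is harmless, the terms being absolute values. *)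
Lemma test_statisticE x n theta D :
  test_statistic P psi x n theta D = \big[Num.max/0]_(k < n.+1) stat_term x n theta D k.
Proof.
rewrite /test_statistic; set S := [set _ | _ in _]; set M := \big[_/_]_(_ < _) _.
have ubM : ubound S M.
  move=> y [u /=]; rewrite in_itv /= => /andP[u0 u1] <-.
  have un : (Num.truncn (u * n%:R) < n.+1)%N.
    rewrite ltnS -(ler_nat R); apply: (@le_trans _ _ (u * n%:R)).
      by rewrite truncn_le// mulr_ge0.
    by rewrite ler_piMl.
  by apply/bigmax_geP; right; exists (Ordinal un).
have inS (k : 'I_n.+1) : S (stat_term x n theta D k).
  exists (k%:R / n%:R).
    rewrite /= in_itv /= divr_ge0//=; case: n k {ubM M S} => [|n] k; first by rewrite invr0 mulr0.
    by rewrite ler_pdivrMr// mul1r ler_nat -ltnS.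
  rewrite /stat_term /Zk /Zn; suff -> : Num.truncn (k%:R / n%:R * n%:R : R) = k by [].
  case: n k {ubM M S} => [|n] k; first by rewrite mulr0 (ord1 k) truncn0.
  by rewrite divfK ?pnatr_eq0// natrK.
apply/eqP; rewrite eq_le; apply/andP; split.
  by apply: ge_sup => //; exists (stat_term x n theta D (@ord0 n)); exact: inS.
apply/bigmax_leP; split=> [|k _].
  apply: le_trans (ub_le_sup _ (inS (@ord0 n))); first exact: normr_ge0.
  by exists M.
by apply: ub_le_sup; [exists M|exact: inS].
Qed.

Lemma test_statistic_ge0 x n theta D : 0 <= test_statistic P psi x n theta D.
Proof. by rewrite test_statisticE; apply/bigmax_geP; left. Qed.

Lemma test_statistic_le x n theta D a : 0 <= a ->
  (test_statistic P psi x n theta D <= a) <-> forall k : 'I_n.+1, stat_term x n theta D k <= a.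
Proof.
move=> a0; rewrite test_statisticE; split.
  by move=> /bigmax_leP[_ H] k; exact: H.
by move=> H; apply/bigmax_leP; split => // k _; exact: H.
Qed.

Section on_solution.
Variables (theta0 : 'rV[R]_d) (A : 'M[R]_d) (x : nat -> X) (n : nat) (theta : 'rV[R]_d).
Hypotheses (uA : A \in unitmx) (n0 : (0 < n)%N)
  (solves : Zn P psi x n 1 theta = 0).

Let phi := whitened P psi theta0 A.
Let phi_bar : 'rV[R]_d := n%:R^-1 *: \sum_(k < n) phi (x k).
Let n_neq0 : n%:R != 0 :> R. Proof. by rewrite pnatr_eq0 -lt0n. Qed.

(** Passing from the mean at [theta0] to the mean at [theta] shifts all whitened variables by one
    vector [c]. By the moment equation the shifted variables sum to 0, so [c] is minus their sample
    mean. *)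
Lemma residual_whitened k :
  (psi (x k) - mean_psi P psi theta) *m A = phi (x k) - phi_bar.
Proof.
pose c : 'rV[R]_d := (mean_psi P psi theta0 - mean_psi P psi theta) *m A.
have E i : (psi (x i) - mean_psi P psi theta) *m A = phi (x i) + c.
  by rewrite /phi /whitened /c -mulmxDl addrA subrK.
have /eqP := solves; rewrite /Zn mul1r natrK scaler_eq0 invr_eq0 (negbTE n_neq0)/= => /eqP S0.
have : (\sum_(i < n) (psi (x i) - mean_psi P psi theta)) *m A = 0 by rewrite S0 mul0mx.
rewrite mulmx_suml (eq_bigr (fun i : 'I_n => phi (x i) + c)) => [|i _]; last exact: E.
rewrite big_split/= sumr_const card_ord.
rewrite (_ : c *+ n = n%:R *: c) => [H|]; last by rewrite scaler_nat.
rewrite E; congr (_ + _); rewrite /phi_bar.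
have -> : \sum_(i < n) phi (x i) = - (n%:R *: c) by apply/eqP; rewrite -addr_eq0 H.
by rewrite scalerN opprK scalerA mulVf// scale1r.
Qed.

Lemma Zk_whitened k : (k <= n)%N -> Zk x n k theta *m A =
  (Num.sqrt n%:R)^-1 *: (\sum_(0 <= i < k) (Num.sqrt n%:R)^-1 *: phi (x i) -
     grid R n k *: \sum_(0 <= i < n) (Num.sqrt n%:R)^-1 *: phi (x i)).
Proof.
move=> kn; rewrite /Zk -scalemxAl mulmx_suml.
rewrite (eq_bigr (fun i : 'I_k => phi (x i) - phi_bar)) => [|i _]; last exact: residual_whitened.
rewrite big_split/= sumr_const card_ord -!scaler_sumr.
rewrite -!(big_mkord xpredT (fun i => phi (x i))).
have ss : (Num.sqrt n%:R)^-1 * (Num.sqrt n%:R)^-1 = n%:R^-1 :> R.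
  by rewrite -invfM -expr2 sqr_sqrtr.
rewrite /phi_bar -(big_mkord xpredT (fun i => phi (x i))) gridE//.
move: (\sum_(0 <= i < k) phi (x i)) (\sum_(0 <= i < n) phi (x i)) => U V.
move: ss; move: (Num.sqrt n%:R)^-1 => s ss.
apply/rowP => i; rewrite mulNrn.
rewrite (_ : (n%:R^-1 *: V) *+ k = k%:R *: (n%:R^-1 *: V)); last by rewrite scaler_nat.
rewrite !mxE.
have -> : s * (s * U 0 i - k%:R / n%:R * (s * V 0 i)) = (s * s) * (U 0 i - k%:R / n%:R * V 0 i) by ring.
by rewrite ss; ring.
Qed.

(** The empirical covariance is the mean of the products minus the product of the means. *)
Lemma Sigma_hat_whitened i j :
  (A^T *m Sigma_hat P psi x n theta *m A - 1%:M) i j =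
  (n%:R^-1 *: \sum_(k < n) outer_defect phi (x k)) 0 (mxvec_index i j) -
  phi_bar 0 i * phi_bar 0 j.
Proof.
rewrite /Sigma_hat -scalemxAr -scalemxAl mulmx_sumr mulmx_suml.
rewrite (eq_bigr (fun k : 'I_n => (phi (x k) - phi_bar)^T *m (phi (x k) - phi_bar))) => [|k _]; last first.
  by rewrite -residual_whitened trmx_mul !mulmxA.
have E : n%:R * phi_bar 0 i = \sum_(k < n) phi (x k) 0 i /\ n%:R * phi_bar 0 j = \sum_(k < n) phi (x k) 0 j.
  by rewrite !mxE !summxE !mulrA divff// !mul1r.
move: E; move: (phi_bar) => f [Ei Ej].
rewrite [LHS]mxE [X in X + _]mxE [X in _ + X]mxE [X in _ - X]mxE [X in _ = X - _]mxE !summxE.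
rewrite (eq_bigr (fun k : 'I_n => phi (x k) 0 i * phi (x k) 0 j - f 0 j * phi (x k) 0 i -
   f 0 i * phi (x k) 0 j + f 0 i * f 0 j)) => [|k _]; last first.
  by rewrite mxE big_ord1 !mxE; ring.
rewrite [in RHS](eq_bigr (fun k : 'I_n => phi (x k) 0 i * phi (x k) 0 j - (i == j)%:R)) => [|k _]; last first.
  by rewrite outer_defectE.
have natE (c : R) : c *+ n = n%:R * c by rewrite mulr_natl.
rewrite !big_split/= !sumrN -!mulr_sumr -Ei -Ej !sumr_const card_ord (natE (f 0 j)) (natE (i == j)%:R).
move: (\sum_(k < n) _) => S; field.
exact: n_neq0.
Qed.

(** The thresholds [b ^+ 2] and [b] are such that each of the two parts of an entry is at most [b];
    there are [d ^+ 2] entries. *)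
Lemma Sigma_hat_near_id (b : R) : 0 <= b ->
  sqn (n%:R^-1 *: \sum_(k < n) outer_defect phi (x k)) <= b ^+ 2 -> sqn phi_bar <= b ->
  mx_sum_norm (A^T *m Sigma_hat P psi x n theta *m A - 1%:M) <= 2 * d%:R ^+ 2 * b.
Proof.
move=> b0 Hc Hm; rewrite /mx_sum_norm.
apply: (@le_trans _ _ (\sum_(i < d) \sum_(j < d) 2 * b)); last first.
  have natE (c : R) : c *+ d = d%:R * c by rewrite mulr_natl.
  rewrite !sumr_const card_ord (natE (2 * b)) (natE (d%:R * (2 * b))) le_eqVlt.
  by apply/orP; left; apply/eqP; ring.
apply: ler_sum => i _; apply: ler_sum => j _; rewrite Sigma_hat_whitened.
apply: (le_trans (ler_normB _ _)); rewrite mulr_natl mulr2n; apply: lerD.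
  by apply: (le_trans (entry_le_enorm _ _)); rewrite enorm_le_sqn.
rewrite normrM; apply: (@le_trans _ _ (enorm phi_bar * enorm phi_bar)).
  by apply: ler_pM => //; exact: entry_le_enorm.
by rewrite -expr2 sqr_enorm.
Qed.

(** The quadratic form is unchanged when [Zk] is multiplied by [A] and the covariance is replaced by
    its congruent [N]. As [N] is near 1, [quad_inv_close] compares the form with the squared norm of
    [v]. *)
Lemma stat_term_close (b : R) D k : 0 <= b -> 2 * d%:R ^+ 2 * b <= 1 / 2 ->
  sqn (n%:R^-1 *: \sum_(k < n) outer_defect phi (x k)) <= b ^+ 2 -> sqn phi_bar <= b ->
  (k <= n)%N ->
  let q := sqn (\sum_(0 <= i < k) (Num.sqrt n%:R)^-1 *: phi (x i) -
     grid R n k *: \sum_(0 <= i < n) (Num.sqrt n%:R)^-1 *: phi (x i)) in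
  `|stat_term x n theta D k - q| <= 2 * (2 * d%:R ^+ 2 * b) * q.
Proof.
move=> b0 b1 Hc Hm kn; cbv zeta; set v := (X in sqn X); set q := sqn v.
have [uN HN] := quad_inv_close (Sigma_hat_near_id b0 Hc Hm) b1.
set N := _ *m _ *m A in uN HN; set S := Sigma_hat P psi x n theta in N uN HN *.
(* Invertibility passes from [N] to [Sigma_hat], so [inv_or] does not fall back on [D] here. *)
have uS : S \in unitmx by move: uN; rewrite /N !unitmx_mul => /andP[/andP[_ ->]].
have s0 : Num.sqrt n%:R != 0 :> R by rewrite gt_eqF// sqrtr_gt0 ltr0n.
have EZ : Zk x n k theta = (Num.sqrt n%:R)^-1 *: (v *m invmx A).
  by rewrite scalemxAl -(Zk_whitened kn) mulmxK.
have EN : invmx N = invmx A *m invmx S *m (invmx A)^T.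
  have NM : N *m (invmx A *m invmx S *m (invmx A)^T) = 1%:M.
    rewrite /N !mulmxA mulmxK// mulmxK// -trmx_mul mulVmx// trmx1//.
  by rewrite -[LHS]mulmx1 -NM mulKmx.
have EQ : stat_term x n theta D k = `|(v *m invmx N *m v^T) 0 0|.
  rewrite /stat_term /inv_or -/S uS EZ linearZ/= -!scalemxAl -!scalemxAr.
  have scaleE (c : R) (M : 'M[R]_1) : (c *: M) 0 0 = c * M 0 0 by rewrite mxE.
  rewrite !scaleE !mulrA -(mulrA n%:R) -invfM -expr2 sqr_sqrtr// divff// mul1r.
  by rewrite EN trmx_mul !mulmxA.
have q0 : 0 <= q by exact: sqn_ge0.
rewrite EQ -{1}(ger0_norm q0); apply: (le_trans (ler_dist_dist _ _)).
exact: HN.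
Qed.

End on_solution.
End statistic.

(** * Measurability of the statistic *)

Section measurability.
Context (R : realType) (dO : measure_display) (O : measurableType dO).

(* [x^-1 = x * (x ^+ 2)^-1], also at 0, where inverses are 0; powers with a real
   exponent are known to be measurable. *)
Lemma measurable_invr : measurable_fun [set: R] (fun x : R => x^-1).
Proof.
rewrite (_ : (fun x : R => _) = fun x => x * (x ^+ 2) `^ (-1)).
  apply: measurable_funM => //; apply: (measurableT_comp (measurable_powR _)).
  by apply: measurable_funX.
apply/funext => x; rewrite powR_inv1 ?sqr_ge0//.
have [->|x0] := eqVneq x 0; first by rewrite invr0 mul0r.
by rewrite expr2 invfM mulrA divff// mul1r.
Qed.

Lemma vmeas_mulmx m n p (A : O -> 'M[R]_(m, n)) (B : O -> 'M[R]_(n, p)) :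
  vmeas A -> vmeas B -> vmeas (fun w => A w *m B w).
Proof.
move=> mA mB i j; rewrite (_ : (fun _ => _) = fun w => \sum_k A w i k * B w k j).
  by apply: measurable_sum => k; apply: measurable_funM; [exact: mA|exact: mB].
by apply/funext => w; rewrite mxE.
Qed.

Lemma vmeas_trmx m n (A : O -> 'M[R]_(m, n)) : vmeas A -> vmeas (fun w => (A w)^T).
Proof.
move=> mA i j; rewrite (_ : (fun _ => _) = fun w => A w j i); first exact: mA.
by apply/funext => w; rewrite mxE.
Qed.

Lemma measurable_det n (A : O -> 'M[R]_n) : vmeas A -> measurable_fun [set: O] (fun w => \det (A w)).
Proof.
move=> mA; rewrite /determinant; apply: measurable_sum => s; apply: measurable_funM => //.
elim: (index_enum 'I_n) => [|i r IH].
  by rewrite (_ : (fun _ => _) = fun=> 1)//; apply/funext => w; rewrite big_nil.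
rewrite (_ : (fun _ => _) = fun w => A w i (s i) * \prod_(j <- r) A w j (s j)).
  by apply: measurable_funM => //; exact: mA.
by apply/funext => w; rewrite big_cons.
Qed.

(** Invertibility means a nonzero determinant, and the inverse then consists of cofactors divided by
    it. *)
Lemma vmeas_inv_or n (D A : O -> 'M[R]_n) : vmeas D -> vmeas A ->
  vmeas (fun w => inv_or (D w) (A w)).
Proof.
move=> mD mA i j.
rewrite (_ : (fun _ => _) = fun w => if \det (A w) == 0 then D w i j else
   (\det (A w))^-1 * cofactor (A w) j i).
  apply: measurable_fun_ifT.
  - by apply: measurable_fun_eqr => //; exact: measurable_det.
  - exact: mD.
  apply: measurable_funM; first by apply: measurableT_comp; [exact: measurable_invr|exact: measurable_det].
  rewrite /cofactor; apply: measurable_funM => //; apply: measurable_det => k l.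
  rewrite (_ : (fun _ => _) = fun w => A w (lift j k) (lift i l)); first exact: mA.
  by apply/funext => w; rewrite !mxE.
apply/funext => w; rewrite /inv_or unitmxE unitfE.
case: eqP => [//|/eqP d0] /=; rewrite /invmx unitmxE unitfE d0 mxE mxE.
by [].
Qed.

(* [g] need not be measurable off [Theta]. *)
Lemma measurable_open_comp d (Theta : set 'rV[R]_d) (g : 'rV[R]_d -> R) (f : O -> 'rV[R]_d) :
  open Theta -> (forall t, Theta t -> {for t, continuous g}) -> borel_measurable f ->
  (forall w, Theta (f w)) -> measurable_fun [set: O] (fun w => g (f w)).
Proof.
move=> oT cg mf fT; apply: (measurability _ (RGenOpens.measurableE R)).
move=> _ [_ [a [b ->]] <-]; rewrite setTI.
rewrite (_ : _ @^-1` _ = f @^-1` (Theta `&` g @^-1` `]a, b[)); last first.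
  by apply/seteqP; split => w /=; [move=> H; split|move=> []].
rewrite -[X in measurable X]setTI; apply: mf => //; apply: sub_sigma_algebra.
rewrite /= openE => t [Tt gt]; rewrite /interior; apply: filterI; first exact: open_nbhs_nbhs.
apply: (cg t Tt); apply: open_nbhs_nbhs; split => //; exact: interval_open.
Qed.
End measurability.

Lemma ae_eventually_prob (R : realType) (dO : measure_display) (O : measurableType dO)
    (P : probability O R) (D : nat -> set O) : (forall n, measurable (D n)) ->
  {ae P, forall w, \forall n \near \oo, D n w} ->
  forall e, 0 < e -> \forall n \near \oo, fine (P (~` D n)) <= e.
Proof.
move=> mD [N [mN N0 DN]] e e0.
(* With the null set removed, the indicators tend to 0 at every point and dominated convergence
   applies. *)
pose C n := ~` D n `&` ~` N.
have mC n : measurable (C n) by apply: measurableI; exact: measurableC.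
have : (fun n => \int[P]_w \1_(C n) w) @ \oo --> \int[P]_w (0 : R).
  apply: (@Rintegral_dominated_cvg _ _ _ P (fun n => \1_(C n)) (fun=> 0) (fun=> 1)) => //.
  - move=> w; apply: cvg_near_cst; have [Nw|Nw] := pselect (N w).
      by apply: nearW => n; rewrite indicE memNset// => -[].
    have : \forall n \near \oo, D n w by apply: contrapT => H; apply: Nw; exact: DN.
    by apply: filterS => n Dn; rewrite indicE memNset// => -[].
  - by move=> n w; rewrite indicE; case: (_ \in _); rewrite ?normr1 ?normr0.
  - by apply: (@bounded_integrable _ _ _ _ _ 1) => // w; rewrite normr1.
rewrite Rintegral_cstT => /cvgrPdist_le /(_ e e0); apply: filterS => n.
rewrite Rintegral_indicator// sub0r normrN ger0_norm ?fine_ge0// => H.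
apply: (@le_trans _ _ (fine (P (C n `|` N)))).
  apply: fine_probability_le; [exact: measurableC|exact: measurableU|].
  by move=> w Dw; have [Nw|Nw] := pselect (N w); [right|left].
apply: (le_trans (fine_probabilityU_le _ _ _)) => //.
by rewrite [X in _ + fine X]N0 addr0.
Qed.

Lemma probability_eq_off_null (R : realType) (dO : measure_display) (O : measurableType dO)
    (P : probability O R) (E : set O) (X Y : O -> R) (a : R) :
  measurable_fun [set: O] X -> measurable_fun [set: O] Y ->
  {ae P, forall w, E w} -> (forall w, E w -> X w = Y w) ->
  fine (P [set w | X w <= a]) = fine (P [set w | Y w <= a]).
Proof.
move=> mX mY [N [mN N0 EN]] XY.
suff H (U V : O -> R) : measurable_fun [set: O] U -> measurable_fun [set: O] V ->
    (forall w, E w -> U w = V w) -> fine (P [set w | U w <= a]) <= fine (P [set w | V w <= a]).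
  by apply/eqP; rewrite eq_le !H// => w Ew; rewrite XY.
move=> mU mV UV.
have mUa := measurable_le_set mU a; have mVa := measurable_le_set mV a.
apply: (@le_trans _ _ (fine (P ([set w | V w <= a] `|` N)))).
  apply: fine_probability_le => //; first exact: measurableU.
  move=> w /= Uw; have [Nw|Nw] := pselect (N w); [by right|left].
  rewrite /= -UV//; apply: contrapT => H; apply: Nw; exact: EN.
apply: (le_trans (fine_probabilityU_le _ _ _)) => //.
by rewrite [X in _ + fine X]N0 addr0.
Qed.

Section statistic_measurable.
Context (R : realType) (d : nat) (Theta : set 'rV[R]_d) (dX : measure_display)
  (X : measurableType dX) (P : 'rV[R]_d -> probability X R) (psi : X -> 'rV[R]_d)
  (dO : measure_display) (O : measurableType dO) (Pr : probability O R)
  (xi : nat -> {RV Pr >-> X}) (theta_hat : O -> 'rV[R]_d) (D : O -> 'M[R]_d).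
Hypotheses (Theta_open : open Theta) (psi_meas : borel_measurable psi)
  (mean_diff : forall theta, Theta theta -> differentiable (mean_psi P psi) theta)
  (theta_hat_meas : borel_measurable theta_hat)
  (theta_hat_in : forall w, Theta (theta_hat w)) (D_meas : borel_measurable D).

Lemma measurable_residual k i :
  measurable_fun [set: O] (fun w => (psi (xi k w) - mean_psi P psi (theta_hat w)) 0 i).
Proof.
rewrite (_ : (fun _ => _) = fun w => psi (xi k w) 0 i - mean_psi P psi (theta_hat w) 0 i); last first.
  by apply/funext => w; rewrite [LHS]mxE [X in _ + X]mxE.
apply: measurable_funB.
  exact: (measurableT_comp (vmeas_psi psi_meas 0 i) (measurable_funPT (xi k))).
apply: (measurable_open_comp (g := fun t => mean_psi P psi t 0 i) Theta_open) => // t Tt.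
have ct := differentiable_continuous (mean_diff Tt).
exact: (cvg_comp _ _ ct (@coord_continuous R 1 d 0 i (mean_psi P psi t))).
Qed.

Lemma vmeas_Zk n k : vmeas (fun w => Zk P psi (fun i => xi i w) n k (theta_hat w)).
Proof.
move=> i0 i; rewrite (ord1 i0).
rewrite (_ : (fun _ => _) = fun w => n%:R^-1 * \sum_(l < k) (psi (xi l w) - mean_psi P psi (theta_hat w)) 0 i).
  by apply: measurable_funM => //; apply: measurable_sum => l; exact: measurable_residual.
by apply/funext => w; rewrite [LHS]mxE summxE.
Qed.

Lemma vmeas_Sigma_hat n :
  vmeas (fun w => Sigma_hat P psi (fun i => xi i w) n (theta_hat w)).
Proof.
move=> i j; rewrite (_ : (fun _ => _) = fun w => n%:R^-1 * \sum_(l < n)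
  ((psi (xi l w) - mean_psi P psi (theta_hat w)) 0 i * (psi (xi l w) - mean_psi P psi (theta_hat w)) 0 j)).
  apply: measurable_funM => //; apply: measurable_sum => l.
  by apply: measurable_funM; exact: measurable_residual.
apply/funext => w; rewrite [LHS]mxE summxE; congr (_ * _); apply: eq_bigr => l _.
by rewrite [LHS]mxE big_ord1 [X in X * _]mxE.
Qed.

Lemma measurable_test_statistic n : measurable_fun [set: O] (fun w =>
  test_statistic P psi (fun k => xi k w) n (theta_hat w) (D w)).
Proof.
rewrite (_ : (fun _ => _) = fun w => \big[Num.max/0]_(k < n.+1)
   stat_term P psi (fun k => xi k w) n (theta_hat w) (D w) k); last first.
  by apply/funext => w; rewrite test_statisticE.
have mt k : measurable_fun [set: O] (fun w => stat_term P psi (fun k => xi k w) n (theta_hat w) (D w) k).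
  apply: measurableT_comp => //; apply: measurable_funM => //.
  apply: vmeas_mulmx; last by apply: vmeas_trmx; exact: vmeas_Zk.
  apply: vmeas_mulmx; first exact: vmeas_Zk.
  apply: vmeas_inv_or; last exact: vmeas_Sigma_hat.
  by move=> i j; exact: borel_measurable_entry.
elim: (index_enum _) => [|k r IH].
  by rewrite (_ : (fun _ => _) = fun=> 0)//; apply/funext => w; rewrite big_nil.
rewrite (_ : (fun _ => _) = fun w => Num.max (stat_term P psi (fun k => xi k w) n (theta_hat w) (D w) k)
   (\big[Num.max/0]_(j <- r) stat_term P psi (fun k => xi k w) n (theta_hat w) (D w) j)).
  exact: measurable_maxr.
by apply/funext => w; rewrite big_cons.
Qed.

Lemma measurable_solves n :
  measurable [set w | Zn P psi (fun k => xi k w) n 1 (theta_hat w) = 0].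
Proof.
have -> : [set w | Zn P psi (fun k => xi k w) n 1 (theta_hat w) = 0] =
    [set w | sqn (Zk P psi (fun k => xi k w) n n (theta_hat w)) <= 0].
  have E w : Zn P psi (fun k => xi k w) n 1 (theta_hat w) = Zk P psi (fun k => xi k w) n n (theta_hat w).
    by rewrite /Zn mul1r natrK.
  apply/seteqP; split => w /=; rewrite E.
    by move=> ->; rewrite /sqn big1// => i _; rewrite mxE expr0n.
  by move=> H; apply: sqn_eq0; apply/eqP; rewrite eq_le H sqn_ge0.
apply: measurable_le_set; rewrite /sqn; apply: measurable_sum => i.
by apply: measurable_funX; exact: (vmeas_Zk n n 0 i).
Qed.
End statistic_measurable.

(** * Squeezing the distribution function of the statistic *)

Theorem theorem4p5 (R : realType) (d : nat) (Theta : set 'rV[R]_d)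
    (Theta_bounded : bounded_set Theta)
    (Theta_open : open Theta)
    (Theta_convex : convex_set Theta)
    (dX : measure_display) (X : measurableType dX)
    (mu : {measure set X -> \bar R})
    (P : 'rV[R]_d -> probability X R)
    (f : 'rV[R]_d -> X -> R)
    (Pf : forall theta, Theta theta -> is_density mu (P theta) (f theta))
    (psi : X -> 'rV[R]_d)
    (psi_meas : borel_measurable psi)
    (mean_exists : forall theta, Theta theta -> mintegrable (P theta) psi)
    (mean_diff : forall theta, Theta theta ->
      differentiable (mean_psi P psi) theta)
    (theta0 : 'rV[R]_d)
    (theta0_in : Theta theta0)
    (psi_L2 : ('E_(P theta0)[fun x => (enorm (psi x) ^+ 2)%R] < +oo)%E)
    (V_inv : deriv_mean P psi theta0 \in unitmx)
    (Sigma_inv : cov_psi P psi theta0 \in unitmx)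
    (dO : measure_display) (Omega : measurableType dO)
    (Pr : probability Omega R)
    (xi : nat -> {RV Pr >-> X})
    (xi_iid : iid (P theta0) xi)
    (theta_hat : nat -> Omega -> 'rV[R]_d)
    (theta_hat_meas : forall n, borel_measurable (theta_hat n))
    (theta_hat_in : forall n w, Theta (theta_hat n w))
    (theta_hat_solves : {ae Pr, forall w, \forall n \near \oo,
      Zn P psi (fun k => xi k w) n 1 (theta_hat n w) = 0})
    (D : nat -> Omega -> 'M[R]_d)
    (D_meas : forall n, borel_measurable (D n))
    (dB : measure_display) (OmegaB : measurableType dB)
    (PrB : probability OmegaB R)
    (B : R -> OmegaB -> 'rV[R]_d)
    (B_bm : standard_brownian_motion PrB B) :
  cvg_in_distribution Pr PrB
    (fun n w =>
       test_statistic P psi (fun k => xi k w) n (theta_hat n w) (D n w))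
    (fun w => sup [set enorm (B u w - u *: B 1 w) ^+ 2 | u in `[0, 1]]).
Proof.
have [A uA cA] := whitening_exists psi_meas psi_L2 Sigma_inv.
set phi := whitened P psi theta0 A in cA.
have mphi : vmeas phi := vmeas_whitened psi_meas psi_L2 A.
have mxi k : measurable_fun [set: Omega] (xi k) by exact: measurable_funPT.
have [_ ixi] := xi_iid.
have cz := sample_centered xi_iid mphi cA.
have tz := sample_trunc_moment xi_iid cA.
have nz := sample_norm1_sqr xi_iid cA.
have I0 : 0 <= (0 : R) <= 1 by rewrite lexx ler01.
have I1 : 0 <= (1 : R) <= 1 by rewrite ler01 lexx.
(* The [- 0] gives the process the shape required by [drifted_path_continuous]. *)
pose g u w := sqn (B u w - 0 - u *: B 1 w).
have -> : (fun w => sup [set enorm (B u w - u *: B 1 w) ^+ 2 | u in `[0, 1]]) = path_sup g.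
  apply/funext => w; rewrite /path_sup; congr sup; congr image.
  by apply/funext => u; rewrite /g sqr_enorm subr0.
have cg w : {within `[0, 1], continuous (fun u => g u w)}.
  rewrite /g; exact: (@drifted_path_continuous _ _ _ _ _ _ B_bm 0 (B 1 w) w).
have mg u : 0 <= u <= 1 -> measurable_fun [set: OmegaB] (g u).
  apply: (measurable_drifted_path B_bm (x := fun=> 0) (y := B 1)).
    exact: vmeas_cst.
  exact: (vmeas_path B_bm I1).
have mG := measurable_path_sup cg mg.
have mS n := measurable_test_statistic xi Theta_open psi_meas mean_diff
  (theta_hat_meas n) (theta_hat_in n) (D_meas n) n.
have mBS := measurable_path_sup (bridge_continuous B_bm) (@measurable_bridge _ _ _ _ _ _ B_bm).
(* The two processes agree wherever [B 0] vanishes, hence almost surely. *)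
have GB a : fine (PrB [set w | path_sup g w <= a]) =
    fine (PrB [set w | path_sup (fun u w => sqn (bridge B u w)) w <= a]).
  have [_ B0 _ _ _] := B_bm.
  apply: (probability_eq_off_null _ mG mBS B0) => w B0w.
  by rewrite /path_sup; congr sup; congr image; apply/funext => u; rewrite /g /bridge B0w !subr0.
apply: cvg_distribution_sandwich => //.
- by move=> n w; exact: test_statistic_ge0.
- move=> w; have [c _ [_ H]] := path_sup_attained cg w.
  by apply: le_trans (H 0 I0); exact: sqn_ge0.
move=> a b e a0 ab e0.
have b0 : 0 < b by exact: le_lt_trans ab.
pose a1 := (a + b) / 2.
have aa1 : a < a1 by rewrite /a1; lra.
have a1b : a1 < b by rewrite /a1; lra.
(* A relative error [2 * dl] of the statistic costs at most [2 * dl * b = (b - a) / 2], which is the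
   distance from [a1] to both [a] and [b]. *)
pose dl := (b - a) / (4 * b).
have dl0 : 0 < dl by rewrite divr_gt0 ?mulr_gt0// subr_gt0.
have dlb : dl * b = (b - a) / 4 by rewrite /dl; field; rewrite gt_eqF.
have dl4 : dl <= 1 / 4 by rewrite /dl ler_pdivrMr ?mulr_gt0//; lra.
(* Makes the bound [2 * d%:R ^+ 2 * beta] of [Sigma_hat_near_id] at most [dl]; [d.+1] avoids a
   division by 0. *)
pose beta := dl / (2 * d.+1%:R ^+ 2).
have d0 : 0 < d.+1%:R :> R by rewrite ltr0n.
have D0 : 0 < 2 * d.+1%:R ^+ 2 :> R by apply: mulr_gt0 => //; exact: exprn_gt0.
have beta0 : 0 < beta by exact: divr_gt0.
have betaE : 2 * d%:R ^+ 2 * beta <= dl.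
  rewrite /beta mulrCA; apply: ler_piMr; first exact: ltW.
  rewrite ler_pdivrMr// mul1r ler_pM2l//.
  by rewrite lerXn2r ?nnegrE// ler_nat.
have e4 : 0 < e / 4 by rewrite divr_gt0.
have mZ n := measurable_solves xi Theta_open psi_meas mean_diff (theta_hat_meas n) (theta_hat_in n) n.
have N1 := ae_eventually_prob mZ theta_hat_solves e4.
have N2 := sample_cov_tail xi_iid mphi cA (exprn_gt0 2 beta0) e4.
have N3 := sample_mean_tail xi_iid mphi cA beta0 e4.
have a10 : 0 <= a1 by rewrite (le_trans a0)// ltW.
have N4 := psum_bridge_prob_le mxi ixi mphi cz tz B_bm a10 a1b e4.
have N5 := psum_bridge_prob_ge mxi ixi mphi cz tz nz B_bm a0 aa1 e4.
near=> n.
have n0 : (0 < n)%N by near: n; exact: nbhs_infty_gt.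
pose H1 := ~` [set w | Zn P psi (fun k => xi k w) n 1 (theta_hat n w) = 0].
pose H2 := [set w | beta ^+ 2 < sqn (n%:R^-1 *: \sum_(k < n) outer_defect phi (xi k w))].
pose H3 := [set w | beta < sqn (n%:R^-1 *: \sum_(k < n) phi (xi k w))].
have mH1 : measurable H1 by exact: measurableC.
have mtail p (Y : X -> 'rV[R]_p) c : vmeas Y ->
    measurable [set w | c < sqn (n%:R^-1 *: \sum_(k < n) Y (xi k w))].
  move=> mY; rewrite -[X in measurable X]setTI; apply: measurable_fun_ltr => //.
  rewrite /sqn; apply: measurable_sum => i; apply: measurable_funX.
  rewrite (_ : (fun _ => _) = fun w => n%:R^-1 * \sum_(k < n) Y (xi k w) 0 i).
    apply: measurable_funM => //; apply: measurable_sum => k.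
    exact: (measurableT_comp (mY 0 i) (mxi k)).
  by apply/funext => w; rewrite mxE summxE.
have mH2 : measurable H2 by apply: mtail; exact: vmeas_outer_defect.
have mH3 : measurable H3 by exact: mtail.
(* The exceptional event: no solution of the moment equation, an empirical covariance off its limit,
   or a large sample mean. It uses three quarters of [e]; the last quarter is for the comparison
   with the bridge. *)
pose H := H1 `|` (H2 `|` H3).
have mH : measurable H by apply: measurableU => //; exact: measurableU.
have PH : fine (Pr H) <= 3 * (e / 4).
  apply: (le_trans (fine_probabilityU_le _ mH1 (measurableU _ _ mH2 mH3))).
  have P1 : fine (Pr H1) <= e / 4 by rewrite /H1; near: n; exact: N1.
  have P2 : fine (Pr H2) <= e / 4 by rewrite /H2; near: n; exact: N2.
  have P3 : fine (Pr H3) <= e / 4 by rewrite /H3; near: n; exact: N3.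
  by have := fine_probabilityU_le Pr mH2 mH3; lra.
have close w : ~ H w -> forall k, (k <= n)%N ->
    `|stat_term P psi (fun k => xi k w) n (theta_hat n w) (D n w) k -
      sqn (psum_bridge (fun k => xi k) phi n k w)| <=
    2 * dl * sqn (psum_bridge (fun k => xi k) phi n k w).
  move=> Hw k kn.
  have [/contrapT sol [nH2 nH3]] : ~ H1 w /\ ~ H2 w /\ ~ H3 w.
    by split; [|split] => h; apply: Hw; [left|right; left|right; right].
  have b1 : 2 * d%:R ^+ 2 * beta <= 1 / 2 by apply: (le_trans betaE); lra.
  have := @stat_term_close R d dX X P psi theta0 A (fun k => xi k w) n (theta_hat n w) uA n0 sol
    beta (D n w) k (ltW beta0) b1 _ _ kn.
  have h2 : sqn (n%:R^-1 *: \sum_(k < n) outer_defect phi (xi k w)) <= beta ^+ 2.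
    by rewrite leNgt; apply/negP.
  have h3 : sqn (n%:R^-1 *: \sum_(k < n) phi (xi k w)) <= beta by rewrite leNgt; apply/negP.
  move=> /(_ h2 h3) h; apply: (le_trans h).
  by rewrite ler_wpM2r ?sqn_ge0// ler_pM2l.
have mpb c := @measurable_psum_bridge_le _ _ _ _ _ _ Pr (fun k => xi k) phi cz n c.
pose R_ n w := test_statistic P psi (fun k => xi k w) n (theta_hat n w) (D n w).
have mR c : measurable [set w | R_ n w <= c] by apply: measurable_le_set; exact: mS.
have dl20 : 0 <= 2 * dl by apply: mulr_ge0 => //; exact: ltW.
rewrite (GB a) (GB b); split.
  apply: (@le_trans _ _ (fine (Pr ([set w | forall k : 'I_n.+1,
      sqn (psum_bridge (fun k => xi k) phi n k w) <= a1] `|` H)))).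
    apply: fine_probability_le; [exact: mR|exact: measurableU|].
    move=> w /= Rw; have [Hw|Hw] := pselect (H w); [by right|left] => k.
    have := close w Hw k (ltac:(by rewrite -ltnS)).
    have /(test_statistic_le _ _ _ _ _ _ a0) /(_ k) := Rw.
    have := sqn_ge0 (psum_bridge (fun k => xi k) phi n k w).
    move: (sqn _) (stat_term _ _ _ _ _ _ _) => q s q0 sa; rewrite ler_norml => /andP[h _].
    have h1 : (1 - 2 * dl) * q <= a by lra.
    have h2 : a <= (1 - 2 * dl) * a1.
      suff : 2 * dl * a1 <= (b - a) / 2 by rewrite /a1; lra.
      have : 2 * dl * a1 <= 2 * dl * b by apply: ler_wpM2l => //; exact: ltW.
      by rewrite -(mulrA 2 dl b) dlb; lra.
    by have := le_trans h1 h2; rewrite ler_pM2l//; lra.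
  apply: (le_trans (fine_probabilityU_le _ (mpb _) mH)).
  have P4 : fine (Pr [set w | forall k : 'I_n.+1, sqn (psum_bridge (fun k => xi k) phi n k w) <= a1]) <=
     fine (PrB [set w | path_sup (fun u w => sqn (bridge B u w)) w <= b]) + e / 4.
    by near: n; exact: N4.
  by move: P4 PH; lra.
have P5 : fine (PrB [set w | path_sup (fun u w => sqn (bridge B u w)) w <= a]) - e / 4 <=
    fine (Pr [set w | forall k : 'I_n.+1, sqn (psum_bridge (fun k => xi k) phi n k w) <= a1]).
  by near: n; exact: N5.
suff P6 : fine (Pr [set w | forall k : 'I_n.+1, sqn (psum_bridge (fun k => xi k) phi n k w) <= a1]) <=
    fine (Pr [set w | R_ n w <= b]) + fine (Pr H).
  by move: P5 P6 PH; rewrite /R_; lra.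
apply: le_trans (fine_probabilityU_le _ (mR _) mH).
apply: fine_probability_le; [exact: mpb|exact: measurableU|].
move=> w /= pw; have [Hw|Hw] := pselect (H w); [by right|left].
apply/test_statistic_le; first exact: ltW.
move=> k; have := close w Hw k (ltac:(by rewrite -ltnS)); have := pw k.
have := sqn_ge0 (psum_bridge (fun k => xi k) phi n k w).
move: (sqn _) (stat_term _ _ _ _ _ _ _) => q s q0 qa; rewrite ler_norml => /andP[_ h].
have h1 : 2 * dl * q <= 2 * dl * b.
  by apply: ler_wpM2l => //; lra.
rewrite -(mulrA 2 dl b) dlb in h1; move: h1 h qa; rewrite /a1; lra.
Unshelve. all: by end_near. Qed.
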